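(* Let $\varphi$ be an admissible function, $0<\alpha\le1$ and $p_0\ge1$. Let $T$ be a sublinear operator acting on measurable functions on $\mathbb{R}^n$ such that, for every $u\in A_1$, $T:L^{p_0,1}(u^\alpha)\to L^{p_0,\infty}(u^\alpha)$ is bounded with constant less than or equal to $\varphi(\|u\|_{A_1})$. Then there is a constant $C>0$ such that, for every $t>0$ and every measurable function $f$, $$(Tf)^*(t)\le C\left(\frac1{t^{\frac1{p_0}}}\int_0^t f^*(s)\,\frac{ds}{s^{1-\frac1{p_0}}}+\frac1{t^{\frac{1-\alpha}{p_0}}}\int_t^\infty\tilde\varphi\left(1+\log\frac st\right)f^*(s)\,\frac{ds}{s^{1-\frac{1-\alpha}{p_0}}}\right),$$ where $$\tilde\varphi(x)=\begin{cases}\varphi\left(x^{p_0/\alpha}\right),&0<\alpha<1,\\ x^{-1}\varphi(x),&\alpha=1.\end{cases}$$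
   Context: A function $\varphi:[1,\infty]\to[1,\infty]$ is called admissible if: (a) $\varphi(1)=1$ and $\varphi$ is log-concave, i.e. $\theta\log\varphi(x)+(1-\theta)\log\varphi(y)\le\log\varphi(\theta x+(1-\theta)y)$ for all $x,y\ge1$ and $0\le\theta\le1$; and (b) there exist $\gamma,\beta>0$ such that $\frac{\gamma}{x}\le\frac{\varphi'(x)}{\varphi(x)}\le\frac{\beta}{x}$ for every $x\ge1$. The Hardy-Littlewood maximal operator on $\mathbb{R}^n$ is $Mf(x)=\sup_{Q\ni x}\frac1{|Q|}\int_Q|f(y)|\,dy$, the supremum being over all cubes $Q$ containing $x$. A weight $u$ (a nonnegative locally integrable function on $\mathbb{R}^n$) belongs to $A_1$ if there is a constant $c$ with $Mu(x)\le c\,u(x)$ for a.e. $x$; $\|u\|_{A_1}$ is the infimum of all such $c$. For a weight $v$, $L^{p,1}(v)$ and $L^{p,\infty}(v)$ are the Lorentz spaces for the measure $v(x)\,dx$: $\|f\|_{L^{p,1}(v)}=\int_0^\infty v(\{|f|>y\})^{1/p}\,dy$ and $\|f\|_{L^{p,\infty}(v)}=\sup_{y>0}y\,v(\{|f|>y\})^{1/p}$. The decreasing rearrangement with respect to Lebesgue measure is $f^*(t)=\inf\{s>0:|\{|f|>s\}|\le t\}$.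
   Formalization: The estimate is stated for every measurable f lying in L^{p_0,1}(u^α) for some u in A_1, not for every measurable f: outside these spaces the hypotheses do not control a finitely sublinear T, and the literal claim fails. *)

(* Defs.v *)
From HB Require Import structures.
From mathcomp Require Import all_boot all_order all_algebra.
From mathcomp Require Import all_classical all_reals all_analysis.
From mathcomp Require Import measurable_realfun.

Set Implicit Arguments.
Unset Strict Implicit.
Unset Printing Implicit Defensive.

Import Order.TTheory GRing.Theory Num.Theory.
Import numFieldNormedType.Exports.

Local Open Scope classical_set_scope.
Local Open Scope ring_scope.
Local Open Scope ereal_scope.

Notation Rn R n := (n.-tuple (measurableTypeR R)).

Section LebesgueRn.
Variable R : realType.

Definition cons_Rn n (p : measurableTypeR R * Rn R n) : Rn R n.+1 :=
  [the n.+1.-tuple _ of p.1 :: p.2].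

(* Lebesgue measure on the Borel sets of R^n, by iterated products along
   R * R^n ~ R^n.+1. See [leb_itv] for its values on boxes. *)
Fixpoint leb n : set (Rn R n) -> \bar R :=
  match n with
  | 0%N => \d_([tuple] : Rn R 0)
  | m.+1 => pushforward (@lebesgue_measure R \x leb (n := m)) (@cons_Rn m)
  end.

Lemma measurable_cons_Rn n : measurable_fun setT (@cons_Rn n).
Proof. exact: measurable_cons. Qed.

Let uncons n (x : Rn R n.+1) : measurableTypeR R * Rn R n :=
  (thead x, [tuple of behead x]).

Let consK n : cancel (@cons_Rn n) (@uncons n).
Proof. by move=> [a x]; congr pair; apply/val_inj. Qed.

Let unconsK n : cancel (@uncons n) (@cons_Rn n).
Proof. by move=> x; rewrite [RHS]tuple_eta; exact/val_inj. Qed.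

Let measurable_uncons n : measurable_fun setT (@uncons n).
Proof.
apply/measurable_fun_pairP; split; last exact: measurable_behead.
exact: (measurable_tnth ord0).
Qed.

Let lebP n : exists m : {sigma_finite_measure set (Rn R n) -> \bar R},
  @leb n = m.
Proof.
elim: n => [|n [m mE]] /=; first by eexists; reflexivity.
rewrite mE; pose pm : {measure set (measurableTypeR R * Rn R n)%type -> \bar R} :=
  (@lebesgue_measure R \x m).
pose mu : {measure set _ -> \bar R} :=
  measure_function_pushforward__canonical__measure_function_Measure
    pm (@measurable_cons_Rn n).
have musf : sigma_finite setT mu.
  have /sigma_finiteP[F [FT ndF Foo]] := sigma_finiteT (@lebesgue_measure R).
  have /sigma_finiteP[G [GT ndG Goo]] := sigma_finiteT m.
  exists (fun k => @uncons n @^-1` (F k `*` G k)).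
    rewrite -preimage_bigcup; apply/esym/seteqP; split => // x _.
    have [k _ Fk] : (\bigcup_k F k) (uncons x).1 by rewrite -FT.
    have [l _ Gl] : (\bigcup_k G k) (uncons x).2 by rewrite -GT.
    exists (maxn k l) => //; split.
      by move: Fk; exact/subsetPset/ndF/leq_maxl.
    by move: Gl; exact/subsetPset/ndG/leq_maxr.
  move=> k; have [mF Fkoo] := Foo k; have [mG Gkoo] := Goo k; split.
    rewrite -[X in measurable X]setTI; apply: measurable_uncons => //.
    exact: measurableX.
  rewrite /mu /= /pushforward -comp_preimage.
  rewrite (_ : _ @^-1` _ = F k `*` G k); last first.
    by apply/seteqP; split => x; rewrite /preimage /mkset /comp consK.
  by rewrite product_measure1E// lte_mul_pinfty// ge0_fin_numE.
pose M := Measure_isSigmaFinite.Build _ _ _ mu musf.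
by exists (HB.pack_for (SigmaFiniteMeasure.type (Rn R n.+1) R)
  (Measure.sort mu) M).
Qed.

Let leb0 n : @leb n set0 = 0.
Proof. by have [m ->] := lebP n; exact: measure0. Qed.

Let leb_ge0 n A : 0 <= @leb n A.
Proof. by have [m ->] := lebP n; exact: measure_ge0. Qed.

Let leb_semi_sigma_additive n : semi_sigma_additive (@leb n).
Proof. by have [m ->] := lebP n; exact: measure_semi_sigma_additive. Qed.

HB.instance Definition _ n := isMeasure.Build _ _ _ (@leb n)
  (@leb0 n) (@leb_ge0 n) (@leb_semi_sigma_additive n).

Let leb_sigma_finite n : sigma_finite setT (@leb n).
Proof. by have [m ->] := lebP n; exact: sigma_finiteT. Qed.

HB.instance Definition _ n := Measure_isSigmaFinite.Build _ _ _ (@leb n)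
  (@leb_sigma_finite n).

Lemma measurable_box n (A : 'I_n -> set (measurableTypeR R)) :
  (forall i, measurable (A i)) ->
  measurable [set x : Rn R n | forall i, A i (tnth x i)].
Proof.
move=> mA; rewrite (_ : [set _ | _] =
    \bigcap_(i in [set: 'I_n]) ((fun x : Rn R n => tnth x i) @^-1` A i)).
  apply: fin_bigcap_measurable => // i _; rewrite -[X in measurable X]setTI.
  exact: measurable_tnth.
by apply/seteqP; split => [x Ax i _|x Ax i]; exact: Ax.
Qed.

Lemma leb_box n (A : 'I_n -> set (measurableTypeR R)) :
  (forall i, measurable (A i)) ->
  @leb n [set x | forall i, A i (tnth x i)] =
  \prod_(i < n) @lebesgue_measure R (A i).
Proof.
elim: n A => [|n IH] A mA.
  by rewrite big_ord0 /= diracE mem_set// => -[].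
rewrite big_ord_recl -IH => [|i]; last exact: mA.
rewrite -product_measure1E//=; last first.
  exact: (measurable_box (fun i => mA (lift ord0 i))).
rewrite /pushforward; congr (_ _).
apply/seteqP; split => -[a x] /=.
  move=> h; split; first exact: (h ord0).
  by move=> i; have := h (lift ord0 i); rewrite tnthS.
by move=> [h0 h] i; case: (unliftP ord0 i) => [j|] ->; rewrite ?tnthS.
Qed.

End LebesgueRn.

(* [phi^`(x) = d] for a function on [1, +oo[; one-sided at [x = 1]. *)
Definition is_deriv_from1 (R : realType) (phi : R -> R) (x d : R) : Prop :=
  ((phi y - phi x) / (y - x))%R @[y --> within [set y | 1 <= y]%R x^'] --> d.

(* [phi] is only meaningful on [1, +oo]. Differentiability forces it to be
   finite at real points; the value at [+oo] is constrained only by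
   [1 <= phi +oo]. *)
Definition admissible (R : realType) (phi : \bar R -> \bar R) : Prop :=
  [/\ forall x, 1 <= x -> 1 <= phi x,
      phi 1 = 1,
      forall x y theta : R, (1 <= x)%R -> (1 <= y)%R -> (0 <= theta <= 1)%R ->
        theta%:E * lne (phi x%:E) + (1 - theta)%:E * lne (phi y%:E) <=
        lne (phi (theta * x + (1 - theta) * y)%:E),
      forall x : R, (1 <= x)%R -> phi x%:E \is a fin_num &
      exists gamma beta : R, [/\ (0 < gamma)%R, (0 < beta)%R &
        forall x : R, (1 <= x)%R -> exists d : R,
          is_deriv_from1 (fun r => fine (phi r%:E)) x d /\
          (gamma / x <= d / fine (phi x%:E) <= beta / x)%R]].

Definition phi_tilde (R : realType) (phi : \bar R -> \bar R) (alpha p0 x : R) :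
    \bar R :=
  if (alpha < 1)%R then phi (x `^ (p0 / alpha))%:E
  else (x^-1)%:E * phi x%:E.

Section Rearrangement.
Context d (T : measurableType d) (R : realType).
Variable mu : set T -> \bar R.
Implicit Type g : T -> \bar R.

Definition distr_fun g (y : R) : \bar R := mu [set x | y%:E < `|g x|].

Definition lorentz1 (p : R) g : \bar R :=
  \int[@lebesgue_measure R]_(y in `]0%R, +oo[) poweR (distr_fun g y) p^-1.

Definition lorentz_oo (p : R) g : \bar R :=
  ereal_sup [set y%:E * poweR (distr_fun g y) p^-1 | y in `]0%R, +oo[].

Definition rearrangement g (t : R) : \bar R :=
  ereal_inf [set s%:E | s in [set s : R | (0 < s)%R /\ distr_fun g s <= t%:E]].

End Rearrangement.

Section Weights.
Variables (R : realType) (n : nat).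
Implicit Types (f g u v : Rn R n -> R) (T : (Rn R n -> R) -> Rn R n -> \bar R).

Definition cube (a : Rn R n) (l : R) : set (Rn R n) :=
  [set x | forall i, (tnth a i <= tnth x i <= tnth a i + l)%R].

Definition maximal f (x : Rn R n) : \bar R :=
  ereal_sup [set z | exists a l, [/\ (0 < l)%R, cube a l x &
    z = (fine (leb (cube a l)))^-1%:E *
        \int[@leb R n]_(y in cube a l) `|f y|%:E]].

(* Every compact set is contained in a cube, so integrability on cubes is local
   integrability. *)
Definition weight u : Prop :=
  [/\ measurable_fun setT u, forall x, (0 <= u x)%R &
      forall a l, \int[@leb R n]_(x in cube a l) (u x)%:E < +oo].

Definition weighted v (A : set (Rn R n)) : \bar R :=
  \int[@leb R n]_(x in A) (v x)%:E.

Definition A1_const u (c : R) : Prop :=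
  {ae @leb R n, forall x, maximal u x <= (c * u x)%:E}.

(* The zero weight is excluded: any nonzero [u] has [A1_norm u >= 1], so that
   [phi (A1_norm u)] makes sense. *)
Definition A1 u : Prop :=
  [/\ weight u, ~ {ae @leb R n, forall x, u x = 0%R} & exists c, A1_const u c].

Definition A1_norm u : \bar R :=
  ereal_inf [set c%:E | c in A1_const u].

Definition in_lorentz1 p v f : Prop :=
  measurable_fun setT f /\ lorentz1 (weighted v) p (EFin \o f) < +oo.

(* The union over [u] in [A1] of the spaces [L^{p0,1}(u^alpha)], which is the
   domain of an operator given by its boundedness on these spaces. It is a
   vector space since [A1] is closed under pointwise minimum. Outside of it,
   boundedness says nothing about a (merely finitely) sublinear operator. *)
Definition A1_domain alpha p0 f : Prop :=
  exists2 u, A1 u & in_lorentz1 p0 (fun x => u x `^ alpha)%R f.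

(* [T f] is extended-valued to allow for maximal operators. *)
Definition sublinear_on (D : (Rn R n -> R) -> Prop) T : Prop :=
  [/\ forall f, D f -> measurable_fun setT (T f),
      forall f g, D f -> D g -> {ae @leb R n, forall x,
        `|T (f \+ g)%R x| <= `|T f x| + `|T g x|} &
      forall (c : R) f, D f -> {ae @leb R n, forall x,
        `|T (c \*o f)%R x| = `|c|%:E * `|T f x|}].

Definition weak_bounded p v T (K : \bar R) : Prop :=
  forall f, in_lorentz1 p v f ->
    lorentz_oo (weighted v) p (T f) <= K * lorentz1 (weighted v) p (EFin \o f).

End Weights.

(* Main.v *)
Require Import Defs.
From mathcomp Require Import all_boot all_order all_algebra.
From mathcomp Require Import all_classical all_reals all_analysis.
From mathcomp Require Import measurable_realfun ring lra.

(* Write [k = (1 - alpha) / p0]. Given sets [F] and [E] with [|F| = s] and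
   [|E| <= l], the Rubio de Francia series [u = sum_j M^j 1_F / (2 D)^j] with
   [D] the size of [M] on [L^(1 + 1 / L)] and [L = 1 + ln (l / s)] is an A1
   weight with [u >= 1] on [F], [||u||_A1 <= C L] and [u(E) <= C s]: both bounds
   come from [||M||_q <= C / (q - 1)] with [q = 1 + 1 / L]. Testing the
   hypothesis on [u] with [|g| <= a 1_E] gives
   [(T g)^*(s) <= C a (l / s)^k phi(1 + ln (l / s))] for [s <= l]. As [k < 1]
   this is integrable at [s = 0], so the averages of [|T g|] over sets of measure
   [t] obey the same bound, and such averages can be summed without loss even
   though weak [L^p0] is not normable for [p0 = 1]. It remains to cut [f] at the
   heights [f^*(s_j)] with [s_0 = t]: the top piece is handled by the weight [1],
   the bottom piece tends to [0] in [L^(p0, 1)(u^alpha)] for a fixed [u], which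
   makes finite sublinearity of [T] sufficient, and the other pieces sum up to
   the second integral when [s_j / t] is [2^j] ([alpha < 1]) or [exp (2^j - 1)]
   ([alpha = 1]). *)

Import Order.TTheory GRing.Theory Num.Theory.
Import numFieldNormedType.Exports.
Local Open Scope classical_set_scope.
Local Open Scope ring_scope.
Local Open Scope ereal_scope.
Set Implicit Arguments.
Unset Strict Implicit.
Unset Printing Implicit Defensive.

(** The weight is built from a level set of the image: take [F] inside the set where |T g| > y. Then
    u >= 1 on [F] gives u^alpha(F) >= s, concavity of z^alpha gives u^alpha(E) <= C s (l / s)^(1 -
    alpha), and the factors s^(1 / p0) cancel in the weak type inequality. What is left is (l / s)^k
    and phi at C L; the upper bound on phi' / phi pulls the constant out of phi. The two choices of
    s_j answer to the two kernels. Put L = 1 + ln (s / t). For alpha < 1 the kernel is at least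
    phi(L) s^(k - 1), because x^(p0 / alpha) >= x, and its integral over a dyadic block is already
    comparable to t^k times the cost (s / t)^k phi(L) of a piece. For alpha = 1 the kernel is phi(L)
    / L ds / s, and a dyadic block yields only phi(L) / L, which is too little. A block on which L
    doubles yields phi(L), and doubling L changes phi by a bounded factor only. *)

(** * Elementary inequalities for integrals and measures *)

Section NonnegativeIntegral.
Context d (T : measurableType d) (R : realType).
Variable mu : {measure set T -> \bar R}.

(* Unlike [ge0_le_integral], this needs no measurability: the integral of a
   nonnegative function is a supremum over simple functions. *)
Lemma ge0_le_integral_nomeas (D : set T) (f g : T -> \bar R) :
  (forall x, D x -> 0 <= f x) -> (forall x, D x -> f x <= g x) ->
  \int[mu]_(x in D) f x <= \int[mu]_(x in D) g x.
Proof.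
move=> f0 fg; have g0 x : D x -> 0 <= g x.
  by move=> Dx; apply: le_trans (fg _ Dx); exact: f0.
rewrite (ge0_integralE mu f0) (ge0_integralE mu g0).
apply: le_ereal_sup => _ /= [h hf <-].
exists h => //= x; apply: le_trans (hf x) _; rewrite !patchE.
by case: ifPn => // /set_mem; exact: fg.
Qed.

Lemma le_measure_bigsetU (I : Type) (s : seq I) (P : pred I) (F : I -> set T) :
  (forall i, measurable (F i)) ->
  mu (\big[setU/set0]_(i <- s | P i) F i) <= \sum_(i <- s | P i) mu (F i).
Proof.
move=> mF; elim: s => [|i s IH]; first by rewrite !big_nil measure0.
rewrite !big_cons; case: ifPn => // _.
apply: le_trans (measureU2 _ _ _) _ => //; last exact: leeD2l.
exact: bigsetU_measurable.
Qed.

End NonnegativeIntegral.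

(** * Cubes, and a countable family that replaces all of them *)

Section Cubes.
Variables (R : realType) (n : nat).
Local Notation mu := (@leb R n).
Implicit Types (a : Rn R n) (l : R).

Lemma cubeE a l : cube a l = [set x | forall i,
  ([set` `[tnth a i, tnth a i + l]%R] : set (measurableTypeR R)) (tnth x i)].
Proof.
by apply/seteqP; split => x /= h i; have := h i; rewrite in_itv.
Qed.

Lemma measurable_cube a l : measurable (cube a l).
Proof.
rewrite cubeE.
exact: (@measurable_box _ _
  (fun i => [set` `[tnth a i, tnth a i + l]%R] : set (measurableTypeR R))).
Qed.

Lemma leb_cube a l : (0 <= l)%R -> mu (cube a l) = (l ^+ n)%:E.
Proof.
move=> l0; rewrite cubeE (@leb_box _ _
  (fun i => [set` `[tnth a i, tnth a i + l]%R] : set (measurableTypeR R)))//.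
rewrite (eq_bigr (fun=> l%:E)) => [|i _].
  by rewrite prodEFin prodr_const card_ord.
by rewrite lebesgue_measure_itv/= lte_fin; case: ltP => h; congr _%:E; lra.
Qed.

(** Rational corners and sides suffice. A supremum over countably many cubes is measurable, and
    since each cube sits in a listed one of at most twice its side, the passage costs a factor 2^n
    at most. *)
Lemma dense_cubes : exists (c : nat -> Rn R n) (w : nat -> R),
  (forall k, (0 < w k)%R) /\
  forall a l, (0 < l)%R -> exists2 k, cube a l `<=` cube (c k) (w k) &
    (w k <= 2 * l)%R.
Proof.
(* Codes that decode to nothing give the unit cube at 0. Below, nonpositive rational sides are
   replaced by 1, so that every index carries a genuine cube. *)
pose idx k : n.-tuple rat * rat := odflt ([tuple 0 | i < n]%R, 1%R) (unpickle k).
exists (fun k => [tuple ratr (tnth (idx k).1 i) | i < n]%R).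
exists (fun k => if (0 < (idx k).2)%R then ratr (idx k).2 else 1%R); split.
  by move=> k; case: ifPn => // h; rewrite ltr0q.
move=> a l l0.
have /choice[q hq] (i : 'I_n) : exists q : rat, ratr q \in `]tnth a i - l / 2,
  tnth a i[%R.
  by apply: rat_in_itvoo; lra.
(* The corner lies less than l / 2 below that of the given cube, so a side above 3 l / 2 reaches its
   far end. *)
have [r] : exists r : rat, ratr r \in `](3 / 2 * l)%R, (2 * l)%R[%R.
  by apply: rat_in_itvoo; lra.
rewrite in_itv/= => /andP[r1 r2].
exists (pickle ([tuple q i | i < n], r)); rewrite /idx pickleK/=; last first.
  by case: ifPn => [_|]; [exact: ltW|rewrite -(ltr0q R); lra].
have -> : (0 < r)%R by rewrite -(ltr0q R); lra.
move=> x hx i; rewrite !tnth_mktuple; have := hx i; have := hq i.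
rewrite in_itv/= => /andP[h1 h2] /andP[h3 h4]; apply/andP; split; lra.
Qed.

End Cubes.

(** * Finite Vitali covering by cubes *)

Section Vitali.
Variables (R : realType) (n : nat) (c : nat -> Rn R n) (w : nat -> R).
Hypothesis w_gt0 : forall k, (0 < w k)%R.
Local Notation mu := (@leb R n).
Local Notation Q k := (cube (c k) (w k)).
Local Notation Q3 k := (cube [tuple tnth (c k) i - w k | i < n]%R (3 * w k)%R).

Lemma cube_sub_triple i j : Q i `&` Q j !=set0 -> (w i <= w j)%R ->
  Q i `<=` Q3 j.
Proof.
move=> [z [zi zj]] ij x xi m; rewrite tnth_mktuple.
have /andP[a1 a2] := zi m; have /andP[a3 a4] := zj m; have /andP[a5 a6] := xi m.
apply/andP; split; lra.
Qed.

(** Greedy selection: keep a cube of largest side, discard the cubes that meet it, as they lie in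
    its triple, and recurse on the rest. *)
Lemma vitali_cubes (s : seq nat) : exists D : seq nat,
  [/\ uniq D, trivIset [set` D] (fun k => Q k), {subset D <= s} &
      forall i, i \in s -> exists2 j, j \in D & Q i `<=` Q3 j].
Proof.
have [N] := ubnP (size s); elim: N s => // N IH [|i0 s0] sN.
  exists [::]; split => //= i j /=.
have [j js jmax] : exists2 j, j \in i0 :: s0 &
    forall i, i \in i0 :: s0 -> (w i <= w j)%R.
  elim: {IH sN} s0 => [|i1 s1 IH] /=.
    by exists i0 => [|i]; rewrite mem_seq1 ?eqxx// => /eqP ->.
  have [j js jmax] := IH.
  have [h|/ltW h] := leP (w i1) (w j).
    exists j => [|i]; first by move: js; rewrite !inE orbCA => ->; rewrite orbT.
    rewrite !inE orbCA => /orP[/eqP->//|ii]; apply: jmax; by rewrite inE.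
  exists i1 => [|i]; first by rewrite !inE eqxx orbT.
  rewrite !inE orbCA => /orP[/eqP->//|ii]; apply: le_trans h; apply: jmax.
  by rewrite inE.
set s := i0 :: s0 in sN js jmax *.
pose s' := [seq i <- s | `[< Q i `&` Q j = set0 >]].
(* [Q j] meets itself, its corner being a witness, so [j] is discarded too and the list gets
   shorter. *)
have s'N : (size s' < N)%N.
  rewrite ltnS in sN; apply: leq_trans sN.
  rewrite /s' size_filter -(count_predC (fun i => `[< Q i `&` Q j = set0 >]) s).
  rewrite -addn1 leq_add2l -has_count; apply/hasP; exists j => //=.
  apply/negP => /asboolP; rewrite setIid => /seteqP[h _]; apply: (h (c j)).
  by move=> i; rewrite lexx/= lerDl ltW.
have [D [uD tD Ds hD]] := IH _ s'N.
have Qj i : i \in D -> Q i `&` Q j = set0.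
  by move=> /Ds; rewrite mem_filter => /andP[/asboolP].
have jD : j \notin D.
  apply/negP => /Qj; rewrite setIid => /seteqP[h _]; apply: (h (c j)).
  by move=> i; rewrite lexx/= lerDl ltW.
exists (j :: D); split => /=.
- by rewrite jD.
- move=> a b /=; rewrite !inE => /orP[/eqP->|aD] /orP[/eqP->|bD] //.
  + by rewrite setIC Qj// => -[].
  + by rewrite Qj// => -[].
  + exact: tD.
- move=> i; rewrite inE => /orP[/eqP->//|/Ds].
  by rewrite mem_filter => /andP[].
- move=> i si; have [h|h] := pselect (Q i `&` Q j = set0).
    have [|k kD ik] := hD i; first by rewrite mem_filter si andbT; exact/asboolP.
    by exists k => //; rewrite inE kD orbT.
  exists j; first by rewrite inE eqxx.
  apply: cube_sub_triple; last exact: jmax.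
  by apply/set0P/eqP.
Qed.

End Vitali.

(** * The maximal operator over the listed cubes: sublinearity and weak type (1, 1) *)

Section MaximalOperator.
Variables (R : realType) (n : nat) (c : nat -> Rn R n) (w : nat -> R).
Hypothesis w_gt0 : forall k, (0 < w k)%R.
Local Notation mu := (@leb R n).
Local Notation Q k := (cube (c k) (w k)).
Local Notation Q3 k := (cube [tuple tnth (c k) i - w k | i < n]%R (3 * w k)%R).
Implicit Types f g : Rn R n -> \bar R.

Definition average k f := ((w k ^+ n)^-1)%:E * \int[mu]_(x in Q k) f x.

(* [c] and [w] list the corners and sides of countably many cubes, which makes
   [maxop f] measurable. *)
Definition maxop f (x : Rn R n) : \bar R :=
  ereal_sup (range (fun k => (\1_(Q k) x)%:E * average k f)).

Lemma average_ge0 k f : (forall x, 0 <= f x) -> 0 <= average k f.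
Proof.
move=> f0; apply: mule_ge0; last exact: integral_ge0.
by rewrite lee_fin invr_ge0 exprn_ge0// ltW.
Qed.

Lemma average_le k f g : (forall x, 0 <= f x) -> (forall x, f x <= g x) ->
  average k f <= average k g.
Proof.
move=> f0 fg; apply: lee_wpmul2l; first by rewrite lee_fin invr_ge0 exprn_ge0// ltW.
exact: ge0_le_integral_nomeas.
Qed.

Lemma average_cst k (r : R) : average k (cst r%:E) = r%:E.
Proof.
rewrite /average integral_cst; last exact: measurable_cube.
transitivity (((w k ^+ n)^-1)%:E * (r%:E * (w k ^+ n)%:E)).
  by congr (_ * (_ * _)); apply: leb_cube; exact: ltW.
transitivity ((w k ^+ n)^-1 * (r * w k ^+ n))%:E => //.
rewrite mulrCA mulVf ?mulr1//.
by rewrite expf_neq0// gt_eqF.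
Qed.

Lemma averageD k f g : (forall x, 0 <= f x) -> (forall x, 0 <= g x) ->
  measurable_fun setT f -> measurable_fun setT g ->
  average k (f \+ g) = average k f + average k g.
Proof.
move=> f0 g0 mf mg; rewrite /average ge0_integralD//; first last.
- exact: measurable_funTS.
- exact: measurable_funTS.
- exact: measurable_cube.
by rewrite ge0_muleDr// integral_ge0.
Qed.

Lemma averageZ k (r : R) f : (0 <= r)%R -> (forall x, 0 <= f x) ->
  measurable_fun setT f ->
  average k (fun x => r%:E * f x) = r%:E * average k f.
Proof.
move=> r0 f0 mf; rewrite /average ge0_integralZl//; first by rewrite muleCA.
- exact: measurable_cube.
- exact: measurable_funTS.
Qed.

Lemma average_sum k (f : nat -> Rn R n -> \bar R) :
  (forall i x, 0 <= f i x) -> (forall i, measurable_fun setT (f i)) ->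
  average k (fun x => \sum_(0 <= i <oo) f i x) =
  \sum_(0 <= i <oo) average k (f i).
Proof.
move=> f0 mf; rewrite /average integral_nneseries//; first last.
- by move=> i; exact: measurable_funTS.
- exact: measurable_cube.
by rewrite nneseriesZl// => i _; exact: integral_ge0.
Qed.

Lemma measurable_maxop f : measurable_fun setT (maxop f).
Proof.
rewrite (_ : maxop f = fun x => esups (fun k => (\1_(Q k) x)%:E * average k f) 0%N).
  apply: measurable_fun_esups => k; apply: emeasurable_funM => //.
  apply/measurable_EFinP; apply: measurable_indic; exact: measurable_cube.
apply/funext => x; rewrite /maxop /esups; congr ereal_sup.
by apply/seteqP; split => [_ [k _ <-]|_ [k _ <-]]; exists k.
Qed.

Lemma maxop_ubound f x k : Q k x -> average k f <= maxop f x.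
Proof.
move=> Qx; apply: ereal_sup_ubound; exists k => //.
by rewrite indicE mem_set// mul1e.
Qed.

Lemma maxop_le f x (b : \bar R) : 0 <= b ->
  (forall k, Q k x -> average k f <= b) -> maxop f x <= b.
Proof.
move=> b0 h; apply: ub_ereal_sup => _ [k _ <-].
by rewrite indicE; case: (boolP (x \in _)) => [/set_mem/h|_]; rewrite ?mul1e ?mul0e.
Qed.

Lemma maxop_ge0 f x : (forall x, 0 <= f x) -> 0 <= maxop f x.
Proof.
move=> f0; apply: le_trans (ereal_sup_ubound _); last by exists 0%N.
by rewrite mule_ge0 ?average_ge0.
Qed.

Lemma maxop_gt f x (b : \bar R) : 0 <= b -> b < maxop f x ->
  exists2 k, Q k x & b < average k f.
Proof.
move=> b0; rewrite ltNge => /negP h; apply/not_exists2P => h'; apply: h.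
apply: maxop_le => // k Qx; rewrite leNgt; apply/negP => bk.
by case: (h' k).
Qed.

Lemma maxop_le1 f x : (forall x, 0 <= f x <= 1) -> maxop f x <= 1.
Proof.
move=> f01; apply: maxop_le => // k _.
rewrite -(average_cst k 1); apply: average_le => z; by case/andP: (f01 z).
Qed.

Lemma maxopZ (r : R) f x : (0 <= r)%R -> (forall x, 0 <= f x) ->
  measurable_fun setT f -> maxop (fun x => r%:E * f x) x <= r%:E * maxop f x.
Proof.
move=> r0 f0 mf; apply: maxop_le; first by rewrite mule_ge0// maxop_ge0.
by move=> k Qx; rewrite averageZ//; apply: lee_wpmul2l => //; exact: maxop_ubound.
Qed.

Lemma maxop_sum (f : nat -> Rn R n -> \bar R) x :
  (forall i x, 0 <= f i x) -> (forall i, measurable_fun setT (f i)) ->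
  maxop (fun x => \sum_(0 <= i <oo) f i x) x <= \sum_(0 <= i <oo) maxop (f i) x.
Proof.
move=> f0 mf; apply: maxop_le.
  by apply: nneseries_ge0 => i _ _; exact: maxop_ge0.
move=> k Qx; rewrite average_sum//; apply: lee_nneseries => i _.
  by move=> _; exact: average_ge0.
exact: maxop_ubound.
Qed.

(** The cubes of a Vitali selection are disjoint and their triples cover the union. Each triple has
    measure 3^n |Q|, and y |Q| is at most the integral of [f] over Q. *)
Lemma weak_type_maxop_fin f (y : R) (s : seq nat) : (0 <= y)%R ->
  (forall x, 0 <= f x) -> measurable_fun setT f ->
  (forall k, k \in s -> y%:E <= average k f) ->
  y%:E * mu (\big[setU/set0]_(k <- s) Q k) <= (3 ^+ n)%:E * \int[mu]_x f x.
Proof.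
move=> y0 f0 mf ys.
have [D [uD tD Ds hD]] := vitali_cubes c w_gt0 s.
have mQ k : measurable (Q k) by exact: measurable_cube.
have mQ3 k : measurable (Q3 k) by exact: measurable_cube.
apply: (@le_trans _ _ (y%:E * mu (\big[setU/set0]_(k <- D) Q3 k))).
  apply: lee_wpmul2l => //; apply: le_measure; rewrite ?inE.
  - exact: bigsetU_measurable.
  - exact: bigsetU_measurable.
  rewrite -!bigcup_seq => x [k /= ks Qx].
  by have [j jD /(_ _ Qx)] := hD _ ks; exists j.
apply: (@le_trans _ _ (\sum_(k <- D) (3 ^+ n)%:E * \int[mu]_(x in Q k) f x)).
  apply: (@le_trans _ _ (y%:E * \sum_(k <- D) mu (Q3 k))).
    by apply: lee_wpmul2l => //; exact: le_measure_bigsetU.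
  rewrite ge0_sume_distrr// [leLHS]big_seq [leRHS]big_seq.
  apply: lee_sum => k /Ds /ys; rewrite /average leb_cube; last first.
    by rewrite mulr_ge0// ltW.
  rewrite exprMn EFinM muleCA => h; apply: lee_wpmul2l.
    by rewrite lee_fin exprn_ge0.
  have w0 : (0 < w k ^+ n)%R by rewrite exprn_gt0.
  by move: h; rewrite lee_pdivlMl// muleC.
rewrite -ge0_sume_distrr => [|k _]; last exact: integral_ge0.
apply: lee_wpmul2l; first by rewrite lee_fin exprn_ge0.
rewrite -ge0_integral_bigsetU//; first last.
- exact: measurable_funTS.
- apply: ge0_subset_integral => //; exact: bigsetU_measurable.
Qed.

(** The level set is the increasing union of finite unions of cubes with average above [y]. *)
Lemma weak_type_maxop f (y : R) : (0 < y)%R ->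
  (forall x, 0 <= f x) -> measurable_fun setT f ->
  y%:E * mu [set x | y%:E < maxop f x] <= (3 ^+ n)%:E * \int[mu]_x f x.
Proof.
move=> y0 f0 mf.
pose F N := \big[setU/set0]_(k <- [seq k <- iota 0 N | y%:E < average k f]) Q k.
have mF N : measurable (F N).
  by apply: bigsetU_measurable => k _; exact: measurable_cube.
have FE : [set x | y%:E < maxop f x] = \bigcup_N F N.
  apply/seteqP; split => x /=.
    move=> /maxop_gt; rewrite lee_fin => /(_ (ltW y0))[k Qx yk].
    exists k.+1 => //; rewrite /F -bigcup_seq; exists k => //.
    have : k \in [seq k0 <- iota 0 k.+1 | y%:E < average k0 f] by rewrite
      mem_filter yk mem_iota leq0n/=.
    by [].
  move=> [N _]; rewrite /F -bigcup_seq => -[k /=].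
  by rewrite mem_filter => /andP[yk _] Qx; apply: lt_le_trans yk (maxop_ubound _ _).
have Fcvg : mu (F N) @[N --> \oo] --> mu (\bigcup_N F N).
  apply: nondecreasing_cvg_mu => //; first exact: bigcup_measurable.
  move=> p q pq; apply/subsetPset; rewrite /F -!bigcup_seq => x [k /=].
  rewrite mem_filter mem_iota/= => /andP[yk kp] Qx; exists k => //=.
  by rewrite mem_filter yk mem_iota/= (leq_trans kp).
rewrite FE -lee_pdivlMl// -(cvg_lim _ Fcvg)//; apply: lime_le.
  by apply/cvg_ex; eexists; exact: Fcvg.
near=> N; rewrite lee_pdivlMl//; apply: weak_type_maxop_fin => //; first exact: ltW.
by move=> k; rewrite mem_filter => /andP[/ltW].
Unshelve. all: by end_near.
Qed.

(** The values of [f] up to [y] contribute at most [y] to any average, so an average above 2 y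
    leaves more than [y] to the part of [f] above [y]. *)
Lemma weak_type_maxop_trunc f (y : R) : (0 < y)%R ->
  (forall x, 0 <= f x) -> measurable_fun setT f ->
  y%:E * mu [set x | (2 * y)%:E < maxop f x] <=
  (3 ^+ n)%:E * \int[mu]_(x in [set x | y%:E < f x]) f x.
Proof.
move=> y0 f0 mf; pose E := [set x | y%:E < f x].
have mE : measurable E.
  by rewrite -[X in measurable X]setTI; exact: emeasurable_fun_o_infty.
pose g := f \_ E.
have g0 x : 0 <= g x by rewrite /g patchE; case: ifPn.
have mg : measurable_fun setT g.
  by apply/(measurable_restrict f mE measurableT); rewrite ?setIT ?setTI;
    exact: measurable_funTS.
have fg x : f x <= (g \+ cst y%:E) x.
  rewrite /= /g patchE; case: ifPn => [_|/negP];
    first by rewrite leeDl// lee_fin ltW.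
  by rewrite add0e leNgt => h; apply/negP => h'; apply: h; rewrite inE.
rewrite [X in _ <= _ * X]integral_mkcond.
apply: le_trans (weak_type_maxop y0 g0 mg).
apply: lee_wpmul2l; first by rewrite lee_fin ltW.
apply: le_measure; rewrite ?inE.
- by rewrite -[X in measurable X]setTI; apply: emeasurable_fun_o_infty => //;
  exact: measurable_maxop.
- by rewrite -[X in measurable X]setTI; apply: emeasurable_fun_o_infty => //;
  exact: measurable_maxop.
move=> x /= /maxop_gt; rewrite lee_fin mulr_ge0 ?ltW// => /(_ isT)[k Qx yk].
apply: lt_le_trans (maxop_ubound _ Qx).
have : (2 * y)%:E < average k g + y%:E.
  apply: lt_le_trans yk _; rewrite -[X in _ + X](average_cst k) -averageD//.
    exact: average_le.
  by move=> z /=; rewrite lee_fin ltW.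
by rewrite -lteBlDr// -EFinB; congr (_%:E < _); lra.
Qed.

End MaximalOperator.

(** * The maximal operator on L^(1 + d), with explicit dependence on d *)

Section StrongType.
Variables (R : realType) (n : nat) (c : nat -> Rn R n) (w : nat -> R).
Hypothesis w_gt0 : forall k, (0 < w k)%R.
Local Notation mu := (@leb R n).
Local Notation M := (@maxop R n c w).
Local Notation e k := (expR (- k%:R) : R).

(* With [m_k = min(z, e^-k)^d], the terms are at most
   [(m_k - m_(k+1)) / (1 - e^-d)], and the sum telescopes. *)
Lemma sum_geometric_below (z d : R) : (0 <= z)%R -> (0 < d <= 1)%R ->
  \sum_(0 <= k <oo) (if (e k < z)%R then (e k `^ d)%R else 0%R)%:E <=
  (z `^ d * (2 / d))%:E.
Proof.
move=> z0 /andP[d0 d1].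
(* This lower bound, linear in d, is the source of the factor 1 / d. It follows from e^-d <= 1 / (1
   + d) and d <= 1. *)
have q0 : (d / 2 <= 1 - expR (- d) :> R)%R.
  suff : (expR (- d) <= 1 - d / 2)%R by lra.
  have ed : (0 < 1 + d :> R)%R by lra.
  rewrite expRN; apply: (@le_trans _ _ (1 + d)^-1%R).
    by rewrite lef_pV2 ?posrE ?expR_gt0// expR_ge1Dx.
  by rewrite -[leLHS]mul1r ler_pdivrMr//; nra.
have q1 : (0 < 1 - expR (- d) :> R)%R by apply: lt_le_trans q0; rewrite divr_gt0.
pose m k : R := (Num.min z (e k) `^ d)%R.
have hk k : ((if (e k < z)%R then (e k `^ d)%R else 0%R)
    <= (m k - m k.+1) / (1 - expR (- d)))%R.
  rewrite ler_pdivlMr//.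
  have e1 : (e k.+1 <= e k)%R by rewrite ler_expR lerN2 ler_nat.
  case: ifPn => [kz|_].
    rewrite /m !min_r ?(ltW kz)//; last exact: le_trans e1 (ltW kz).
    rewrite -!expRM mulrBr mulr1 -expRD lerB// ler_expR -natr1; lra.
  rewrite mul0r subr_ge0; apply: ge0_ler_powR.
  - exact: ltW.
  - by rewrite nnegrE le_min z0 expR_ge0.
  - by rewrite nnegrE le_min z0 expR_ge0.
  - by rewrite le_min ge_min lexx/= ge_min e1 orbT.
have S N : (\sum_(0 <= k < N) (m k - m k.+1) / (1 - expR (- d)) <= z `^ d * (2 /
  d))%R.
  rewrite -mulr_suml.
  have -> : (\sum_(0 <= k < N) (m k - m k.+1) = m 0%N - m N)%R.
    rewrite -[LHS]opprK -sumrN (eq_bigr (fun k => m k.+1 - m k)%R) => [|k _].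
      by rewrite telescope_sumr// opprB.
    by rewrite opprB.
  apply: ler_pM.
  - rewrite subr_ge0; apply: ge0_ler_powR.
    + exact: ltW.
    + by rewrite nnegrE le_min z0 expR_ge0.
    + by rewrite nnegrE le_min z0 expR_ge0.
    + by rewrite le_min ge_min lexx/= ge_min ler_expR lerN2 ler_nat leq0n orbT.
  - by rewrite invr_ge0 ltW.
  - rewrite lerBlDr; apply: ler_wpDr; first exact: powR_ge0.
    by apply: ge0_ler_powR;
      rewrite ?nnegrE ?le_min ?ge_min ?lexx ?z0 ?expR_ge0// ltW.
  - by rewrite -[leRHS]invf_div lef_pV2 ?posrE ?divr_gt0.
apply: lime_le.
  by apply: is_cvg_nneseries => k _ _; case: ifPn => _; rewrite lee_fin// powR_ge0.
near=> N; rewrite sumEFin lee_fin; apply: le_trans (S N).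
by apply: ler_sum => k _.
Unshelve. all: by end_near.
Qed.

(** For x > 0 a single term suffices, the one with e^-(k + 1) < x <= e^-k. *)
Lemma powR_le_sum_levels (x q : R) : (0 <= x <= 1)%R -> (0 < q)%R ->
  (x `^ q)%:E <= \sum_(0 <= k <oo) (if (e k.+1 < x)%R then (e k `^ q)%R else 0%R)%:E.
Proof.
move=> /andP[x0 x1] q0.
have t0 k : 0 <= (if (e k.+1 < x)%R then (e k `^ q)%R else 0%R)%:E.
  by case: ifPn => _; rewrite lee_fin ?powR_ge0.
have [->|xn0] := eqVneq x 0%R.
  by rewrite powR0 ?gt_eqF//; apply: nneseries_ge0 => k _ _; case: ifPn => _;
    rewrite lee_fin ?powR_ge0.
have xp : (0 < x)%R by rewrite lt_neqAle eq_sym xn0.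
have lx : (0 <= - ln x)%R by rewrite oppr_ge0 ln_le0.
have /andP[h1 h2] := truncn_itv lx.
set k := Num.trunc (- ln x) in h1 h2.
apply: le_trans (nneseries_lim_ge k.+1 _) => [|j _ _]; last exact: t0.
rewrite big_nat_recr//=; apply: (@le_trans _ _ (0 + (e k `^ q)%:E)); last first.
  apply: leeD; first by apply: sume_ge0 => j _; exact: t0.
  rewrite ifT// -[ltRHS](lnK xp) ltr_expR; lra.
rewrite add0e lee_fin; apply: ge0_ler_powR; rewrite ?nnegrE ?expR_ge0// ?(ltW q0)//.
by rewrite -[leLHS](lnK xp) ler_expR; lra.
Qed.

(** Real-valued so that it can be iterated. On functions with values in [0, 1] the supremum is again
    in [0, 1], so [fine] loses nothing. *)
Definition maxopR (f : Rn R n -> R) (x : Rn R n) : R := fine (M (EFin \o f) x).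

Section bounded.
Variable f : Rn R n -> R.
Hypotheses (f01 : forall x, (0 <= f x <= 1)%R) (mf : measurable_fun setT f).

Lemma maxopRE x : (maxopR f x)%:E = M (EFin \o f) x.
Proof.
have f0 z : 0 <= (EFin \o f) z by rewrite /= lee_fin; case/andP: (f01 z).
have M0 : 0 <= M (EFin \o f) x by exact: maxop_ge0.
have M1 : M (EFin \o f) x <= 1.
  by apply: maxop_le1 => // z; rewrite f0/= lee_fin; case/andP: (f01 z).
by rewrite /maxopR fineK// ge0_fin_numE// (le_lt_trans M1)// ltry.
Qed.

Lemma maxopR_01 x : (0 <= maxopR f x <= 1)%R.
Proof.
have f0 z : 0 <= (EFin \o f) z by rewrite /= lee_fin; case/andP: (f01 z).
rewrite -!lee_fin maxopRE maxop_ge0//=.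
by apply: maxop_le1 => // z; rewrite f0/= lee_fin; case/andP: (f01 z).
Qed.

Lemma measurable_maxopR : measurable_fun setT (maxopR f).
Proof. by apply: measurableT_comp => //; exact: measurable_maxop. Qed.

(* Marcinkiewicz interpolation between [L^oo] and the weak type (1, 1), on the
   levels [e^-k]; they start at [1] because [f <= 1]. *)
Lemma strong_type_maxop (d : R) : (0 < d <= 1)%R ->
  \int[mu]_x (maxopR f x `^ (1 + d))%:E <=
  (8 * expR 2 * 3 ^+ n / d)%:E * \int[mu]_x (f x `^ (1 + d))%:E.
Proof.
move=> /andP[d0 d1].
have f0 z : 0 <= (EFin \o f) z by rewrite /= lee_fin; case/andP: (f01 z).
have f0R z : (0 <= f z)%R by case/andP: (f01 z).
have mEf : measurable_fun setT (EFin \o f) by exact/measurable_EFinP.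
have mlev (g : Rn R n -> R) (a : R) : measurable_fun setT g ->
    measurable [set x | (a < g x)%R].
  move=> mg; rewrite -[X in measurable X]setTI.
  rewrite (_ : [set x | _] = [set x | a%:E < (EFin \o g) x]).
    by apply: emeasurable_fun_o_infty => //; exact/measurable_EFinP.
  by apply/seteqP; split => x /=; rewrite lte_fin.
pose A k := [set x | (e k.+1 < maxopR f x)%R].
(* The set where f exceeds half of the level e^-(k + 1) that defines [A k], as the truncated weak
   type inequality requires. *)
pose B k := [set x | (e k < 2 * expR 1 * f x)%R].
have mA k : measurable (A k) by apply: mlev; exact: measurable_maxopR.
have mB k : measurable (B k) by apply: mlev; exact: measurable_funM.
have iE (S : set (Rn R n)) (a : R) x : (if x \in S then a else 0%R)%:E = a%:E *
  (\1_S x)%:E.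
  by rewrite indicE -EFinM; case: (x \in S); rewrite ?mulr1 ?mulr0.
have mi (S : set (Rn R n)) : measurable S -> measurable_fun setT (fun x => (\1_S
  x)%:E : \bar R).
  by move=> mS; apply/measurable_EFinP; exact: measurable_indic.
apply: (@le_trans _ _ (\int[mu]_x \sum_(0 <= k <oo) ((e k `^ (1 + d))%:E * (\1_(A
  k) x)%:E))).
  apply: ge0_le_integral_nomeas => x _; first by rewrite lee_fin powR_ge0.
  apply: le_trans (powR_le_sum_levels (maxopR_01 x) _) _; first by lra.
  apply: lee_nneseries => k _ ; first by case: ifPn => _; rewrite lee_fin ?powR_ge0.
  rewrite -iE; have -> : (x \in A k) = (e k.+1 < maxopR f x)%R by apply/idP/idP;
    rewrite inE.
  by [].
rewrite integral_nneseries//; last first.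
  by move=> k; apply: measurable_funeM; exact: mi.
apply: (@le_trans _ _ (\sum_(0 <= k <oo) (2 * expR 1 * 3 ^+ n)%:E *
    \int[mu]_x ((e k `^ d)%:E * ((f x)%:E * (\1_(B k) x)%:E)))).
  apply: lee_nneseries => k _.
    by move=> _; apply: integral_ge0 => x _; rewrite mule_ge0// lee_fin ?powR_ge0.
  rewrite ge0_integralZl//; last exact: mi.
    rewrite integral_indic// setIT.
    have e2 : (0 < e k.+1 / 2)%R by rewrite divr_gt0 ?expR_gt0.
    have := weak_type_maxop_trunc c w_gt0 e2 f0 mEf;
      rewrite (_ : [set x | (2 * (e k.+1 / 2))%:E < _] = A k); last first.
      apply/seteqP; split => x /=; rewrite -maxopRE lte_fin;
        rewrite mulrCA divff ?mulr1//.
    rewrite (_ : [set x | (e k.+1 / 2)%:E < _] = B k); last first.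
      have E x : (e k.+1 / 2 < f x)%R = (e k < 2 * expR 1 * f x)%R.
        rewrite ltr_pdivrMr// -(@ltr_pM2l _ (expR 1)) ?expR_gt0// -expRD.
        by congr (_ < _)%R; [congr expR; rewrite -natr1; lra|ring].
      by apply/seteqP; split => x /=; rewrite lte_fin E.
    rewrite integral_mkcond => wt'.
    rewrite ge0_integralZl//; first last.
    - by move=> x _; apply: mule_ge0 => //; rewrite lee_fin.
    - by apply: emeasurable_funM => //; exact: mi.
    rewrite (eq_integral ((EFin \o f) \_ (B k))) => [|x _]; last first.
      by rewrite patchE indicE; case: ifPn => _; rewrite ?mule1 ?mule0.
    rewrite -!expRM.
    (* Factors e^(-k (1 + d)) as 2 e times e^(-k d) times e^-(k + 1) / 2, the last being the level
       at which the weak type inequality is applied. *)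
    have -> : (- k%:R * (1 + d) = (1 + ln 2) + - k%:R * d + (- k.+1%:R - ln 2) :>
      R)%R.
      by rewrite -natr1; ring.
    rewrite expRD EFinM expRB (lnK (x := 2%R)) ?posrE// -muleA.
    apply: le_trans (lee_wpmul2l _ wt') _; first by rewrite lee_fin expR_ge0.
    rewrite expRD (expRD 1) lnK ?posrE// !muleA -!EFinM.
    by rewrite le_eqVlt; apply/orP; left; apply/eqP; congr (_%:E * _); ring.
rewrite nneseriesZl => [|k _]; last first.
  by apply: integral_ge0 => x _; rewrite !mule_ge0// lee_fin ?powR_ge0.
rewrite -integral_nneseries//; first last.
- by move=> k x _; rewrite !mule_ge0// lee_fin ?powR_ge0.
- move=> k; apply: measurable_funeM; apply: emeasurable_funM => //; exact: mi.
have mfd : measurable_fun setT (fun x => (f x `^ (1 + d))%:E).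
  by apply/measurable_EFinP; exact: (measurableT_comp (measurable_powR (1 + d)) mf).
apply: (@le_trans _ _ ((2 * expR 1 * 3 ^+ n)%:E *
   \int[mu]_x ((2 * expR 1 * (2 / d))%:E * (f x `^ (1 + d))%:E))).
  apply: lee_wpmul2l.
    by rewrite lee_fin !mulr_ge0 ?expR_ge0// exprn_ge0.
  apply: ge0_le_integral_nomeas => x _.
    by apply: nneseries_ge0 => k _ _; rewrite !mule_ge0// lee_fin ?powR_ge0.
  rewrite (eq_eseriesr (g := fun k => (f x)%:E * (if (e k < 2 * expR 1 * f x)%R
    then (e k `^ d)%R else 0%R)%:E)); last first.
    move=> k _; rewrite muleCA; congr (_ * _); rewrite -iE.
    by have -> : (x \in B k) = (e k < 2 * expR 1 * f x)%R by apply/idP/idP;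
      rewrite inE.
  rewrite nneseriesZl => [|k _]; last by case: ifPn => _; rewrite lee_fin ?powR_ge0.
  have z0 : (0 <= 2 * expR 1 * f x)%R by rewrite !mulr_ge0 ?expR_ge0.
  apply: (@le_trans _ _ ((f x)%:E * ((2 * expR 1 * f x) `^ d * (2 / d))%:E)).
    by apply: lee_wpmul2l; [rewrite lee_fin|apply: sum_geometric_below => //;
      rewrite d0].
  rewrite -!EFinM lee_fin powRM ?mulr_ge0 ?expR_ge0//.
  have -> : (f x * ((2 * expR 1) `^ d * f x `^ d * (2 / d)) =
     (2 * expR 1) `^ d * (2 / d * (f x * f x `^ d)))%R by ring.
  have -> : (f x * f x `^ d = f x `^ (1 + d))%R.
    have E : (d = (1 + d) - 1)%R by ring.
    by rewrite [in LHS]E mulr_powRB1// addr_gt0.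
  (* As d <= 1, (2 e)^d is at most 2 e; this is the second factor 2 e of the final constant. *)
  rewrite -[leRHS]mulrA; apply: ler_wpM2r.
    by rewrite mulr_ge0 ?powR_ge0// divr_ge0// ltW.
  apply: ler1_powR => //.
  have := expR_ge1Dx (1 : R); lra.
rewrite ge0_integralZl//; first last.
- by rewrite lee_fin !mulr_ge0 ?expR_ge0// invr_ge0 ltW.
- by move=> x _; rewrite lee_fin powR_ge0.
rewrite muleA -EFinM; rewrite le_eqVlt; apply/orP; left; apply/eqP; congr (_%:E * _).
have -> : (2 = 1 + 1 :> R)%R by ring.
by rewrite expRD; field; rewrite gt_eqF.
Qed.

End bounded.
End StrongType.

Lemma nneseries_geometric_le (R : realType) (a r : R) : (0 <= a)%R ->
  (0 <= r < 1)%R -> \sum_(0 <= k <oo) (a * r ^+ k)%:E <= (a / (1 - r))%:E.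
Proof.
move=> a0 /andP[r0 r1]; apply: lime_le.
  by apply: is_cvg_nneseries => k _ _; rewrite lee_fin mulr_ge0// exprn_ge0.
near=> N; rewrite sumEFin lee_fin.
have := geometric_seriesE a (negbT (lt_eqF r1)); rewrite funeqE => /(_ N).
rewrite /series/= => ->; rewrite ler_pM2r ?invr_gt0 ?subr_gt0//.
by rewrite ler_piMr// lerBlDr lerDl exprn_ge0.
Unshelve. all: by end_near.
Qed.

Lemma nneseries_shift_le (R : realType) (t : nat -> \bar R) :
  (forall k, 0 <= t k) ->
  \sum_(0 <= k <oo) t k.+1 <= \sum_(0 <= k <oo) t k.
Proof.
move=> t0; apply: lime_le; first exact: is_cvg_nneseries.
near=> N; apply: le_trans (nneseries_lim_ge N.+1 _) => //.
by rewrite big_nat_recl//= leeDr.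
Unshelve. all: by end_near.
Qed.

(** * Construction of A1 weights by iterating the maximal operator *)

Section A1Weights.
Variables (R : realType) (n : nat).
Local Notation mu := (@leb R n).
Implicit Types u v : Rn R n -> R.

Lemma maximal_le_maxop (c : nat -> Rn R n) (w : nat -> R) u x :
  (forall k, (0 < w k)%R) ->
  (forall a l, (0 < l)%R -> exists2 k, cube a l `<=` cube (c k) (w k) &
    (w k <= 2 * l)%R) ->
  measurable_fun setT u -> (forall x, (0 <= u x)%R) ->
  maximal u x <= (2 ^+ n)%:E * maxop c w (EFin \o u) x.
Proof.
move=> w0 cw mu_ u0; apply: ub_ereal_sup => _ [a [l [l0 xl ->]]].
have [k lk wk] := cw a l l0.
have Eu0 z : 0 <= (EFin \o u) z by rewrite lee_fin.
apply: (@le_trans _ _ ((2 ^+ n)%:E * average c w k (EFin \o u))); last first.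
  apply: lee_wpmul2l; first by rewrite lee_fin exprn_ge0.
  by apply: maxop_ubound; exact: lk.
rewrite leb_cube ?(ltW l0)//= /average muleA -EFinM.
have ln0 : (0 < l ^+ n)%R by rewrite exprn_gt0.
have wn0 : (0 < w k ^+ n)%R by rewrite exprn_gt0.
apply: lee_pmul.
- by rewrite lee_fin invr_ge0 ltW.
- by apply: integral_ge0 => y _; rewrite lee_fin.
- rewrite lee_fin -[leLHS]mul1r ler_pdivrMr// mulrAC ler_pdivlMr// mul1r -exprMn.
  by rewrite lerXn2r ?nnegrE ?mulr_ge0 ?(ltW l0) ?(ltW (w0 k)).
- apply: (@le_trans _ _ (\int[mu]_(y in cube a l) (u y)%:E)).
    by apply: ge0_le_integral_nomeas => y _; rewrite lee_fin ?ger0_norm.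
  apply: ge0_subset_integral => //.
  + exact: measurable_cube.
  + exact: measurable_cube.
  + by apply/measurable_EFinP; exact: measurable_funTS.
  + by move=> z _; rewrite lee_fin.
Qed.

Lemma bounded_weight u (b : R) : measurable_fun setT u ->
  (forall x, (0 <= u x <= b)%R) -> weight u.
Proof.
move=> mu_ ub; split => // [x|a l]; first by case/andP: (ub x).
apply: (@le_lt_trans _ _ (\int[mu]_(x in cube a l) (cst b%:E) x)).
  by apply: ge0_le_integral_nomeas => x _ /=; rewrite lee_fin; case/andP: (ub x).
rewrite integral_cst; last exact: measurable_cube.
have b0 : (0 <= b)%R by case/andP: (ub a) => h1 h2; exact: le_trans h2.
(* [l] may be negative, while the volume formula asks for a nonnegative side. *)
apply: (@le_lt_trans _ _ (b%:E * mu (cube a `|l|%R))).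
  apply: lee_wpmul2l; first by rewrite lee_fin.
  apply: le_measure; rewrite ?inE; [exact: measurable_cube..|].
  move=> x h i; have /andP[-> h2]/= := h i; apply: le_trans h2 _.
  by rewrite lerD2l ler_norm.
by rewrite leb_cube// -EFinM ltry.
Qed.

(** [F] will be a level set of an image under T, and [E] will contain the support of the argument.
    Over the possibly much larger [E] the mass of [u] remains comparable to |F|, at the price of a
    logarithm in the A1 constant. *)
Lemma exists_A1_weight : exists2 C : R, (1 <= C)%R &
  forall (F E : set (Rn R n)) (s l : R), measurable F -> measurable E ->
  (0 < s)%R -> (s <= l)%R -> mu F = s%:E -> mu E <= l%:E ->
  exists u, [/\ A1 u, forall x, F x -> (1 <= u x)%R,
    A1_const u (C * (1 + ln (l / s))) & \int[mu]_(x in E) (u x)%:E <= (C * s)%:E].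
Proof.
have [c [w [w0 cw]]] := @dense_cubes R n.
pose K : R := (8 * expR 2 * 3 ^+ n)%R.
have K1 : (1 <= K)%R.
  have e1 : (1 <= expR 2 :> R)%R by have := expR_ge1Dx (2 : R); lra.
  have e3 : (1 <= 3 ^+ n :> R)%R by rewrite exprn_ege1// ler1n.
  by rewrite /K; nra.
have n1 : (1 <= 2 ^+ n :> R)%R by rewrite exprn_ege1// ler1n.
have e0 := expR_gt0 (1 : R).
exists (2 ^+ n * (2 * K) + 2 * (1 + expR 1))%R; first by nra.
move=> F E s l mF mE s0 sl muF muE.
have ls : (1 <= l / s)%R by rewrite ler_pdivlMr// mul1r.
have lns := ln_ge0 ls.
set L := (1 + ln (l / s))%R.
have L1 : (1 <= L)%R by rewrite /L; lra.
pose d : R := L^-1%R.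
have d0 : (0 < d)%R by rewrite invr_gt0; lra.
have d1 : (d <= 1)%R by rewrite invf_le1//; lra.
pose D : R := (K * L)%R.
have D1 : (1 <= D)%R by rewrite /D; nra.
have D0 : (0 < D)%R by lra.
have l0 : (0 < l)%R by lra.
pose g k := iter k (maxopR c w) (\1_F : Rn R n -> R).
have g01 k x : (0 <= g k x <= 1)%R.
  elim: k x => [|k IH] x; last exact: maxopR_01.
  by rewrite /g/= indicE; case: (_ \in _); rewrite ?lexx ler01.
have mg k : measurable_fun setT (g k).
  elim: k => [|k IH]; first exact: measurable_indic.
  exact: measurable_maxopR.
have gS k x : (g k.+1 x)%:E = maxop c w (EFin \o g k) x by apply: maxopRE.
have Dk0 k : (0 < D ^+ k)%R by rewrite exprn_gt0.
(* Each application of the maximal operator multiplies the integral of the power 1 + d by at most K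
   / d = D. *)
have Gk k : \int[mu]_x (g k x `^ (1 + d))%:E <= (D ^+ k * s)%:E.
  elim: k => [|k IH].
    rewrite expr0 mul1r -muF -[X in _ <= _ X]setIT -integral_indic//.
    apply: ge0_le_integral_nomeas => x _; first by rewrite lee_fin powR_ge0.
    rewrite lee_fin indicE /g/= indicE; case: (_ \in _); first by rewrite powR1.
    by rewrite powR0// gt_eqF// ltr_wpDl.
  apply: le_trans (strong_type_maxop c w0 (g01 k) (mg k) _) _; first by rewrite d0.
  apply: le_trans (lee_wpmul2l _ IH) _.
    by rewrite lee_fin divr_ge0 ?(ltW d0)//; lra.
  by rewrite -EFinM lee_fin exprS mulrA -/K /d invrK.
have mgE k (S : set (Rn R n)) : measurable_fun S (EFin \o g k).
  by apply: measurable_funTS; exact/measurable_EFinP.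
have Ik k : \int[mu]_(x in E) (g k x)%:E <= (D ^+ k * (s * (1 + expR 1)))%:E.
  (* [g <= b + b^-d g^(1+d)] balances the two terms when [b = D^k s / l]. *)
  pose b := (D ^+ k * s / l)%R.
  have b0 : (0 < b)%R by rewrite divr_gt0// mulr_gt0.
  apply: (@le_trans _ _ (\int[mu]_(x in E) (b%:E + (b `^ (- d))%:E * (g k x `^ (1
    + d))%:E))).
    apply: ge0_le_integral_nomeas => x _; first by rewrite lee_fin;
      case/andP: (g01 k x).
    have gx := g01 k x.
    rewrite -EFinM -EFinD lee_fin; have [h|h] := leP (g k x) b.
      by apply: ler_wpDr => //; rewrite mulr_ge0// powR_ge0.
    apply: ler_wpDl; first exact: ltW.
    have g0 : (0 < g k x)%R by apply: lt_trans h.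
    rewrite powRD ?(gt_eqF g0) ?implybT// powRr1 ?(ltW g0)// mulrCA ler_peMr
      ?(ltW g0)//.
    rewrite powRN mulrC ler_pdivlMr ?powR_gt0// mul1r.
    by apply: ge0_ler_powR; rewrite ?nnegrE ltW.
  have hb : b%:E * mu E <= (b * l)%:E.
    by rewrite [leRHS]EFinM; apply: lee_wpmul2l => //; rewrite lee_fin ltW.
  have mgd : measurable_fun setT (fun x => (g k x `^ (1 + d))%:E).
    by apply/measurable_EFinP;
      exact: (measurableT_comp (measurable_powR (1 + d)) (mg k)).
  rewrite ge0_integralD//; first last.
  - by apply: measurable_funeM; exact: measurable_funTS.
  - by move=> x _; rewrite -EFinM lee_fin mulr_ge0 ?powR_ge0.
  - by move=> x _; rewrite lee_fin ltW.
  rewrite (_ : (fun=> b%:E) = cst b%:E)// integral_cst// ge0_integralZl//;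
    first last.
  - by rewrite lee_fin powR_ge0.
  - by move=> x _; rewrite lee_fin powR_ge0.
  - exact: measurable_funTS.
  have -> : (D ^+ k * (s * (1 + expR 1)) = b * l + D ^+ k * s * expR 1)%R.
    by rewrite /b mulfVK ?gt_eqF//; ring.
  rewrite EFinD; apply: leeD; first exact: hb.
  apply: (@le_trans _ _ ((b `^ (- d))%:E * (D ^+ k * s)%:E)).
    apply: lee_wpmul2l; first by rewrite lee_fin powR_ge0.
    apply: le_trans (Gk k); apply: ge0_subset_integral => //.
    by move=> x _; rewrite lee_fin powR_ge0.
  rewrite -EFinM lee_fin mulrC ler_wpM2l//; first by rewrite mulr_ge0// ltW.
  (* With d = 1 / L, (l / s)^d is at most e, since ln (l / s) <= L. This is what fixes the
     exponent. *)
  apply: (@le_trans _ _ ((l / s) `^ d)%R).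
    rewrite -mulN1r powRrM powR_inv1 ?(ltW b0)// /b; apply: ge0_ler_powR;
      rewrite ?nnegrE.
    - exact: ltW.
    - by rewrite invr_ge0 ltW.
    - by rewrite divr_ge0// ltW.
    rewrite invf_div ler_pM2l// lef_pV2 ?posrE ?mulr_gt0//.
    by rewrite ler_peMl ?(ltW s0)// exprn_ege1.
  rewrite /powR gt_eqF ?divr_gt0// ler_expR /d ler_pdivrMl; last by lra.
  by rewrite mulr1 /L lerDr.
(* The factor 2 keeps the series of masses over [E] convergent in spite of the growth D^k of the
   k-th iterate. *)
pose q k : R := ((2 * D) ^- k)%R.
have q0 k : (0 <= q k)%R by rewrite invr_ge0 exprn_ge0// mulr_ge0// ltW.
have qg0 k x : 0 <= (q k * g k x)%:E.
  by rewrite lee_fin mulr_ge0//; case/andP: (g01 k x).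
pose U x := \sum_(0 <= k <oo) (q k * g k x)%:E.
have U0 x : 0 <= U x by apply: nneseries_ge0.
have U2 x : U x <= 2%:E.
  have h2 : (1 / (1 - 2^-1) = 2 :> R)%R by field.
  rewrite -h2; apply: le_trans (nneseries_geometric_le _ _); [|by []|lra].
  apply: lee_nneseries => k _ //.
  rewrite lee_fin mul1r /q exprVn exprMn invfM -mulrA ler_piMr ?invr_ge0
    ?exprn_ge0//.
  have /andP[h0 h1] := g01 k x.
  have Dk1 : (1 <= D ^+ k)%R by rewrite exprn_ege1.
  by rewrite mulr_ile1 ?invr_ge0 ?(ltW (Dk0 k))// invf_le1.
pose u x := fine (U x).
have uE x : (u x)%:E = U x by rewrite fineK// ge0_fin_numE// (le_lt_trans (U2
  x))// ltry.
have mU : measurable_fun setT U.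
  apply: (@ge0_emeasurable_sum _ _ _ _ _ xpredT) => // k _.
  by apply/measurable_EFinP; exact: measurable_funM.
have mu_ : measurable_fun setT u by apply: measurableT_comp.
have u02 x : (0 <= u x <= 2)%R by rewrite -!lee_fin uE U0 U2.
have uF x : F x -> (1 <= u x)%R.
  move=> Fx; rewrite -lee_fin uE /U; apply: le_trans (nneseries_lim_ge 1 _) => //.
  by rewrite big_nat1 /q expr0 invr1 mul1r /g/= indicE mem_set.
(* The maximal operator takes the k-th term of the series to at most 2 D times the next one, hence
   the bound 2 D u. The factor 2^n is the passage from all cubes to the listed ones. *)
have uA x : maximal u x <= ((2 ^+ n * (2 * D)) * u x)%:E.
  apply: le_trans (maximal_le_maxop x w0 cw mu_ _) _; first by move=> z;
    case/andP: (u02 z).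
  rewrite -mulrA EFinM; apply: lee_wpmul2l; first by rewrite lee_fin exprn_ge0.
  have -> : EFin \o u = fun x => \sum_(0 <= k <oo) (q k * g k x)%:E by
    apply/funext => z; rewrite /= uE.
  apply: le_trans (maxop_sum c w0 _ _ _) _ => //.
    by move=> k; apply/measurable_EFinP; exact: measurable_funM.
  rewrite EFinM uE.
  apply: (@le_trans _ _ (\sum_(0 <= k <oo) (2 * D)%:E * (q k.+1 * g k.+1 x)%:E)).
    apply: lee_nneseries => k _.
      by move=> _; apply: maxop_ge0.
    have -> : (2 * D)%:E * (q k.+1 * g k.+1 x)%:E = (q k)%:E * maxop c w (EFin \o
      g k) x.
      rewrite -gS -!EFinM; congr _%:E; rewrite /q exprS.
      by field; rewrite ?gt_eqF// exprn_gt0// mulr_gt0.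
    apply: (@maxopZ _ _ c w w0 (q k) (EFin \o g k) x) => // z.
    by rewrite lee_fin; case/andP: (g01 k z).
  rewrite nneseriesZl//; apply: lee_wpmul2l; first by rewrite lee_fin mulr_ge0// ltW.
  exact: (nneseries_shift_le (t := fun k => (q k * g k x)%:E)).
exists u; split.
- split; first exact: bounded_weight u02.
    (* A weight vanishing almost everywhere would contradict u >= 1 on [F], which has measure s >
       0. *)
    move=> /= [N [mN N0 hN]].
    have : mu F <= mu N.
      apply: le_measure; rewrite ?inE// => x Fx; apply: hN => /= h.
      by have := uF x Fx; rewrite h; lra.
    by rewrite muF N0 lee_fin; lra.
  by exists (2 ^+ n * (2 * D))%R; apply: aeW.
- exact: uF.
- apply: aeW => x; apply: le_trans (uA x) _; rewrite lee_fin ler_wpM2r//.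
    by case/andP: (u02 x).
  rewrite (_ : ((_ + _) * L = 2 ^+ n * (2 * D) + 2 * (1 + expR 1) * L)%R);
    last by rewrite /D; ring.
  by rewrite lerDl; nra.
- rewrite (eq_integral U) => [|x _]; last by rewrite uE.
  rewrite integral_nneseries//; last first.
    by move=> k; apply/measurable_EFinP; apply: measurable_funTS;
      exact: measurable_funM.
  have h2 : (s * (1 + expR 1) / (1 - 2^-1) = 2 * (1 + expR 1) * s :> R)%R by field.
  apply: (@le_trans _ _ (2 * (1 + expR 1) * s)%:E).
    rewrite -h2; apply: le_trans (nneseries_geometric_le _ _); [|nra|lra].
    apply: lee_nneseries => k _; first by move=> _; exact: integral_ge0.
    under eq_integral do rewrite EFinM.
    rewrite ge0_integralZl//; first last.
    - by rewrite lee_fin.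
    - by move=> x _; rewrite lee_fin; case/andP: (g01 k x).
    - exact: mgE.
    apply: le_trans (lee_wpmul2l _ (Ik k)) _; first by rewrite lee_fin.
    rewrite -EFinM lee_fin /q exprMn exprVn le_eqVlt; apply/orP; left; apply/eqP.
    by field; rewrite !gt_eqF// exprn_gt0.
  by rewrite lee_fin ler_wpM2r ?(ltW s0)// lerDr !mulr_ge0//; lra.
Qed.

End A1Weights.

(** * Monotonicity and doubling of admissible functions *)

Section Admissible.
Variable R : realType.

(** Away from 1 the restriction to the half-line is harmless: for |h| < x - 1 the point x + h stays
    in it. *)
Lemma is_deriv_from1_is_derive (g : R -> R) (x d : R) : (1 < x)%R ->
  is_deriv_from1 g x d -> is_derive x 1%R g d.
Proof.
move=> x1 /cvgrPdist_le H.
have D : (fun h : R => h^-1 *: (g (h *: (1 : R^o) + x) - g x))%R @ (0%R : R)^' --> d.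
  apply/cvgrPdist_le => /= e e0.
  have [r /= r0 Hr] := H e e0.
  exists (Num.min r (x - 1)%R); first by rewrite /= lt_min r0 subr_gt0.
  move=> h /=; rewrite sub0r normrN lt_min => /andP[hr hx] h0.
  have hh : (`|h| < x - 1)%R := hx.
  have xh : (1 <= h + x)%R by move: hh; rewrite ltr_norml => /andP[]; lra.
  rewrite /GRing.scale/= mulr1 mulrC.
  have := Hr (h + x)%R; rewrite /ball/= opprD addrCA subrr addr0 normrN => /(_ hr).
  have E : (h + x - x = h)%R by ring.
  by rewrite E; apply => //; rewrite -subr_eq0 E.
apply: DeriveDef; first by apply/cvg_ex; exists d.
by apply/cvg_lim.
Qed.

Variable phi : \bar R -> \bar R.
Hypothesis phi_adm : admissible phi.
Local Notation g := (fun r : R => fine (phi r%:E)).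

Lemma admissible_fin x : (1 <= x)%R -> phi x%:E = (fine (phi x%:E))%:E.
Proof. by case: phi_adm => _ _ _ h _ x1; rewrite fineK// h. Qed.

Lemma admissible_ge1 x : (1 <= x)%R -> (1 <= fine (phi x%:E))%R.
Proof.
by case: phi_adm => h _ _ _ _ x1; rewrite -lee_fin -admissible_fin// h.
Qed.

Lemma admissible_le x y : (1 <= x)%R -> (x <= y)%R ->
  (fine (phi x%:E) <= fine (phi y%:E))%R.
Proof.
move=> x1; rewrite le_eqVlt => /orP[/eqP-> //|xy].
(* At 1 only a one-sided derivative is at hand, but there phi takes its least value 1. *)
have [->|xn1] := eqVneq x 1%R.
  case: (phi_adm) => _ -> _ _ _ /=; apply: admissible_ge1; exact: le_trans (ltW xy).
have x1' : (1 < x)%R by rewrite lt_neqAle eq_sym xn1.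
case: (phi_adm) => _ _ _ _ [c [b [c0 b0 H]]].
have D (z : R) : (1 < z)%R -> exists2 d, is_derive z 1%R g d & (0 <= d)%R.
  move=> z1; have [d [dd /andP[h _]]] := H z (ltW z1).
  exists d; first exact: is_deriv_from1_is_derive.
  have gz : (0 < g z)%R by apply: lt_le_trans (admissible_ge1 (ltW z1)).
  rewrite -(pmulr_lge0 d (x := (g z)^-1%R)) ?invr_gt0// .
  by apply: le_trans h; rewrite divr_ge0// ltW//; lra.
apply: (@ger0_derive1_ndecr _ g x y) => //.
- by move=> z; rewrite in_itv/= => /andP[xz _]; have [|d []] := D z; [lra|].
- move=> z; rewrite in_itv/= => /andP[xz _]; have [|d hd d0] := D z; first lra.
  by rewrite derive1E derive_val.
- apply: derivable_within_continuous => z; rewrite in_itv/= => /andP[xz _].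
  by have [|d []] := D z; [lra|].
- exact: ltW.
Qed.

(** By the upper bound on phi' / phi, ln phi - b ln is nonincreasing beyond 1, so that phi (c x) <=
    c^b phi (x) for x > 1. *)
Lemma admissible_dilation : exists K b : R, [/\ (1 <= K)%R, (0 < b)%R &
  forall c x : R, (1 <= c)%R -> (1 <= x)%R ->
    (fine (phi (c * x)%:E) <= K * c `^ b * fine (phi x%:E))%R].
Proof.
case: (phi_adm) => _ _ _ _ [c0 [b [c00 b0 H]]].
(* The factor phi 2 serves the endpoint x = 1: phi c <= phi (2 c) <= c^b phi 2. *)
exists (g 2%R), b; split => //; first by apply: admissible_ge1; rewrite ler1n.
have main c x : (1 <= c)%R -> (1 < x)%R -> (g (c * x) <= c `^ b * g x)%R.
  move=> c1 x1.
  have gz z : (1 <= z)%R -> (0 < g z)%R by move=> z1;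
    apply: lt_le_trans (admissible_ge1 z1).
  have D (z : R) : (1 < z)%R -> exists2 d, is_derive z 1%R (fun r => ln (g r) - b
    * ln r)%R d & (d <= 0)%R.
    move=> z1; have [d [dd /andP[_ h]]] := H z (ltW z1).
    have z0 : (0 < z)%R by lra.
    have dg := is_deriv_from1_is_derive z1 dd.
    have dl := is_derive1_ln z0.
    have dlg := is_derive1_ln (gz _ (ltW z1)).
    exists ((g z)^-1 * d - b * z^-1)%R.
      by apply: is_deriveB.
    by rewrite subr_le0 mulrC.
  have xcx : (x <= c * x)%R by nra.
  have : (ln (g (c * x)) - b * ln (c * x) <= ln (g x) - b * ln x)%R.
    apply: (@ler0_derive1_nincr _ (fun r => ln (g r) - b * ln r)%R x (c * x)%R)
      => //.
    - by move=> z; rewrite in_itv/= => /andP[xz _]; have [|d []] := D z; [lra|].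
    - move=> z; rewrite in_itv/= => /andP[xz _]; have [|d hd d0] := D z; first lra.
      by rewrite derive1E derive_val.
    - apply: derivable_within_continuous => z; rewrite in_itv/= => /andP[xz _].
      by have [|d []] := D z; [lra|].
  have gcx := gz (c * x)%R; have gx := gz x (ltW x1).
  have c0' : (0 < c)%R by lra. have x0' : (0 < x)%R by lra.
  rewrite lnM ?posrE// => h.
  rewrite -ler_ln ?posrE ?mulr_gt0 ?powR_gt0 ?gcx//; last by lra.
  by rewrite lnM ?posrE ?powR_gt0// ln_powR; lra.
move=> c x c1; rewrite le_eqVlt => /orP[/eqP <-|x1].
  rewrite mulr1; case: (phi_adm) => _ -> _ _ _; rewrite /= mulr1.
  apply: (@le_trans _ _ (g (c * 2)%R)); first by apply: admissible_le => //; lra.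
  by rewrite [leRHS]mulrC; apply: main; rewrite ?ltr1n.
apply: le_trans (main _ _ c1 x1) _.
rewrite -mulrA ler_peMl ?admissible_ge1 ?ler1n// mulr_ge0 ?powR_ge0//.
by apply: le_trans (admissible_ge1 (ltW x1)).
Qed.

End Admissible.

(** * Positivity and normalization of A1 weights *)

Section A1Facts.
Variables (R : realType) (n : nat).
Local Notation mu := (@leb R n).
Implicit Types u : Rn R n -> R.

Lemma cube_exhaust (x : Rn R n) : exists m : nat,
  cube [tuple - m%:R | i < n]%R (2 * m%:R)%R x.
Proof.
pose r := (\sum_(i < n) `|tnth x i|)%R.
have ri i : (`|tnth x i| <= r)%R.
  by rewrite /r (bigD1 i)//= lerDl sumr_ge0.
exists (Num.bound r) => i; rewrite tnth_mktuple.
have h1 : (r < (Num.bound r)%:R)%R.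
  by apply: archi_boundP; rewrite /r sumr_ge0.
have := ri i; rewrite ler_norml => /andP[h2 h3]; apply/andP; split; lra.
Qed.

(** Otherwise [u] would have zero integral over countably many cubes that cover the space. *)
Lemma weight_cube_gt0 u : weight u -> ~ {ae mu, forall x, u x = 0%R} ->
  exists a l, (0 < l)%R /\ 0 < \int[mu]_(x in cube a l) (u x)%:E.
Proof.
move=> [mu_ u0 ufin] unz; apply: contrapT => H; apply: unz.
have Eu0 S (x : Rn R n) : S x -> 0 <= (u x)%:E by rewrite lee_fin.
have mEu S : measurable_fun S (fun x => (u x)%:E).
  by apply: measurable_funTS; exact/measurable_EFinP.
pose Q m : set (Rn R n) := cube [tuple - (m.+1)%:R | i < n]%R (2 * m.+1%:R)%R.
have mQ m : measurable (Q m) by exact: measurable_cube.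
have IQ m : \int[mu]_(x in Q m) (u x)%:E = 0.
  apply/eqP; rewrite eq_le integral_ge0 ?andbT//; last exact: Eu0.
  rewrite leNgt; apply/negP => h; apply: H.
  exists [tuple - (m.+1)%:R | i < n]%R, (2 * m.+1%:R)%R; split => //.
have : \int[mu]_x `|(u x)%:E| = 0.
  apply/eqP; rewrite eq_le integral_ge0 ?andbT//.
  apply: (@le_trans _ _ (\int[mu]_x \sum_(0 <= m <oo) (((fun x => (u x)%:E) \_ (Q
    m)) x))).
    apply: ge0_le_integral_nomeas => // x _.
    have t0 (m : nat) : 0 <= ((fun x => (u x)%:E) \_ (Q m)) x.
      by rewrite patchE; case: ifPn => // _; rewrite lee_fin.
    have [m xm] := cube_exhaust x.
    apply: le_trans (nneseries_lim_ge m.+1 _) => //.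
    rewrite big_nat_recr//=; rewrite -[leLHS]add0e; apply: leeD;
      first by apply: sume_ge0.
    rewrite patchE ifT; first by rewrite ger0_norm.
    rewrite inE => i; have := xm i; rewrite !tnth_mktuple -natr1.
    by move=> /andP[h1 h2]; apply/andP; split; lra.
  rewrite integral_nneseries//; first last.
  - by move=> m x _; rewrite patchE; case: ifPn => // _; rewrite lee_fin.
  - move=> m; apply/(measurable_restrict _ (mQ m) measurableT).
    by rewrite setTI; exact: mEu.
  rewrite eseries0// => m _ _; rewrite -integral_mkcond; exact: IQ.
move=> /(ae_eq_integral_abs mu measurableT (mEu setT)).
by apply: filterS => x /(_ I)[].
Qed.

Lemma weight_cube_fin u a l : weight u ->
  \int[mu]_(x in cube a l) (u x)%:E \is a fin_num.
Proof.
by move=> [_ u0 ufin]; rewrite ge0_fin_numE//; apply: integral_ge0 => x _;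
  rewrite lee_fin.
Qed.

Lemma maximal_average u a l x : (0 < l)%R -> cube a l x -> (forall x, 0 <= u x)%R ->
  ((l ^+ n)^-1)%:E * \int[mu]_(y in cube a l) (u y)%:E <= maximal u x.
Proof.
move=> l0 xl u0; apply: ereal_sup_ubound; exists a, l; split => //.
rewrite leb_cube ?(ltW l0)//=; congr (_ * _); apply: eq_integral => y _.
by rewrite ger0_norm.
Qed.

(* Averaging [M u <= c u] over a cube of positive mass. *)
Lemma A1_const_ge1 u c : A1 u -> A1_const u c -> (1 <= c)%R.
Proof.
move=> [wu unz _] uc; have [mu_ u0 _] := wu.
have [a [l [l0 I0]]] := weight_cube_gt0 wu unz.
have Ifin := weight_cube_fin a l wu.
rewrite leNgt; apply/negP => c1.
(* [c] might be negative; [c'] keeps the right-hand integrand nonnegative and is still below 1. *)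
pose c' := Num.max c 0%R.
have c'1 : (c' < 1)%R by rewrite gt_max c1 ltr01.
have c'0 : (0 <= c')%R by rewrite le_max lexx orbT.
have ln0 : (0 < l ^+ n)%R by rewrite exprn_gt0.
pose I := \int[mu]_(y in cube a l) (u y)%:E.
have : \int[mu]_(x in cube a l) (((l ^+ n)^-1)%:E * I) <=
    \int[mu]_(x in cube a l) (c'%:E * (u x)%:E).
  apply: ae_ge0_le_integral.
  - exact: measurable_cube.
  - by move=> x _; apply: mule_ge0; [rewrite lee_fin invr_ge0 ltW|exact: ltW].
  - exact: measurable_cst.
  - by move=> x _; rewrite -EFinM lee_fin mulr_ge0.
  - by apply: measurable_funeM; apply: measurable_funTS; exact/measurable_EFinP.
  move: uc; apply: filterS => x ux xl.
  apply: le_trans (maximal_average l0 xl u0) _; apply: le_trans ux _.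
  by rewrite -EFinM lee_fin ler_wpM2r// le_max lexx.
rewrite (_ : (fun=> _ * I) = cst (((l ^+ n)^-1)%:E * I))// integral_cst;
  last exact: measurable_cube.
rewrite ge0_integralZl//; first last.
- by move=> x _; rewrite lee_fin.
- by apply: measurable_funTS; exact/measurable_EFinP.
- exact: measurable_cube.
rewrite [X in _ * X <= _](leb_cube _ (ltW l0)) -/I.
have IE : I = (fine I)%:E by rewrite fineK.
rewrite IE -!EFinM lee_fin mulrAC mulVf ?gt_eqF// mul1r.
have : (0 < fine I)%R by rewrite fine_gt0// I0 ltey_eq Ifin.
by move=> f0; rewrite leNgt gtr_pMl// c'1.
Qed.

(** Makes phi usable: it is evaluated at a real number, at least 1 and bounded by any A1 constant of
    [u]. *)
Lemma A1_norm_bounds u c : A1 u -> A1_const u c ->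
  exists r, [/\ A1_norm u = r%:E, (1 <= r)%R & (r <= c)%R].
Proof.
move=> uA uc.
have h1 : 1 <= A1_norm u.
  by apply: le_ereal_inf_tmp => _ [d ud <-]; rewrite lee_fin; exact: A1_const_ge1 ud.
have h2 : A1_norm u <= c%:E by apply: ereal_inf_lbound; exists c.
have fu : A1_norm u \is a fin_num.
  by rewrite fin_numE; apply/andP; split; apply/eqP => E; rewrite E in h1 h2.
by exists (fine (A1_norm u)); rewrite -!lee_fin fineK.
Qed.

(** Every point lies in a cube of positive mass, so M u > 0 everywhere, and c u >= M u almost
    everywhere. *)
Lemma A1_ae_gt0 u : A1 u -> {ae mu, forall x, (0 < u x)%R}.
Proof.
move=> [wu unz [c]]; have [mu_ u0 _] := wu.
have [a [l [l0 I0]]] := weight_cube_gt0 wu unz.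
apply: filterS => x ux.
pose r := (\sum_(i < n) `|tnth x i - tnth a i|)%R.
have r0 : (0 <= r)%R by rewrite sumr_ge0.
have ri i : (`|tnth x i - tnth a i| <= r)%R.
  by rewrite /r (bigD1 i)//= lerDl sumr_ge0.
pose a' : Rn R n := [tuple tnth a i - r | i < n]%R.
pose l' : R := (l + 2 * r)%R.
have l'0 : (0 < l')%R by rewrite /l'; lra.
have xl' : cube a' l' x.
  move=> i; rewrite tnth_mktuple /l'; have := ri i;
    rewrite ler_norml => /andP[h2 h3].
  by apply/andP; split; lra.
have M0 : 0 < maximal u x.
  apply: lt_le_trans (maximal_average l'0 xl' u0).
  apply: mule_gt0; first by rewrite lte_fin invr_gt0 exprn_gt0.
  apply: lt_le_trans I0 _; apply: ge0_subset_integral.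
  - exact: measurable_cube.
  - exact: measurable_cube.
  - by apply: measurable_funTS; exact/measurable_EFinP.
  - by move=> z _; rewrite lee_fin.
  - move=> z zl i; rewrite tnth_mktuple /l'; have /andP[h1 h2] := zl i.
    by apply/andP; split; lra.
have := lt_le_trans M0 ux; rewrite lte_fin => h; rewrite lt_neqAle u0 andbT.
by apply/eqP => h'; move: h; rewrite -h' mulr0 ltxx.
Qed.

(** The weight for the top piece of [f]: its norm is 1, where phi is normalized to 1. *)
Lemma A1_cst1 : A1 (cst 1%R : Rn R n -> R) /\ A1_const (cst 1%R : Rn R n -> R) 1.
Proof.
have c1 : A1_const (cst 1%R : Rn R n -> R) 1.
  apply: aeW => x; apply: ub_ereal_sup => _ [a [l [l0 xl ->]]].
  rewrite (_ : (fun y => `|_|%:E) = cst 1); last by apply/funext => y;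
    rewrite /= normr1.
  rewrite integral_cst; last exact: measurable_cube.
  rewrite leb_cube ?(ltW l0)//= [X in _ * (_ * X)](leb_cube _ (ltW l0)) mul1e
    -EFinM lee_fin mul1r.
  by rewrite mulVf// gt_eqF// exprn_gt0.
split=> //; split; last by exists 1%R.
- by apply: (@bounded_weight _ _ _ 1) => // x; rewrite /= ler01 lexx.
- move=> [N [mN N0 hN]].
  have : mu (cube [tuple 0 | i < n]%R 1) <= mu N.
    apply: le_measure; rewrite ?inE//; first exact: measurable_cube.
    by move=> x _; apply: hN => /= /eqP; rewrite oner_eq0.
  by rewrite N0 leb_cube// expr1n lee_fin; lra.
Qed.

End A1Facts.

(** * Lorentz functionals of weighted measures *)

Section Lorentz.
Variables (R : realType) (n : nat).
Local Notation mu := (@leb R n).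
Local Notation lam := (@lebesgue_measure R).
Implicit Types (f g u v : Rn R n -> R) (p : R).

Lemma weighted_ge0 v A : (forall x, (0 <= v x)%R) -> 0 <= weighted v A.
Proof. by move=> v0; apply: integral_ge0 => x _; rewrite lee_fin. Qed.

Lemma weighted_le v A B : (forall x, (0 <= v x)%R) -> A `<=` B ->
  weighted v A <= weighted v B.
Proof.
move=> v0 AB; rewrite /weighted integral_mkcond [leRHS]integral_mkcond.
apply: ge0_le_integral_nomeas => x _; first by rewrite patchE;
  case: ifPn => // _; rewrite lee_fin.
rewrite !patchE; case: ifPn => [/set_mem/AB xB|_]; first by rewrite mem_set.
by case: ifPn => // _; rewrite lee_fin.
Qed.

Lemma weighted0 v : weighted v set0 = 0.
Proof. by rewrite /weighted integral_set0. Qed.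

Lemma poweR_le p (x y : \bar R) : (0 <= p)%R -> 0 <= x -> x <= y ->
  poweR x p <= poweR y p.
Proof.
move=> p0 x0 xy; apply: gt0_ler_poweR => //; rewrite in_itv/= ?x0 ?leey//.
by rewrite (le_trans x0 xy).
Qed.

Lemma lorentz1_le v p f g : (0 <= p)%R -> (forall x, (0 <= v x)%R) ->
  (forall x, `|f x| <= `|g x|)%R ->
  lorentz1 (weighted v) p (EFin \o f) <= lorentz1 (weighted v) p (EFin \o g).
Proof.
move=> p0 v0 fg; apply: ge0_le_integral_nomeas => y _; first exact: poweR_ge0.
apply: poweR_le; rewrite ?invr_ge0 ?weighted_ge0//.
apply: weighted_le => // x /=; rewrite !lte_fin => h; exact: lt_le_trans (fg x).
Qed.

(** The distribution function is at most the mass of [E] and vanishes from height [a] on. *)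
Lemma lorentz1_bounded v p g (a : R) E : (0 < p)%R -> (0 <= a)%R ->
  (forall x, (0 <= v x)%R) ->
  (forall x, (`|g x| <= a)%R) -> (forall x, g x != 0%R -> E x) ->
  lorentz1 (weighted v) p (EFin \o g) <= poweR (weighted v E) p^-1 * a%:E.
Proof.
move=> p0 a0 v0 ga gE.
have pi0 : (0 <= p^-1)%R by rewrite invr_ge0 ltW.
apply: (@le_trans _ _ (\int[lam]_(y in `]0%R, +oo[)
    (poweR (weighted v E) p^-1 * (\1_(`]0%R, a[ : set R) y)%:E))).
  apply: ge0_le_integral_nomeas => y /=; first by move=> _; exact: poweR_ge0.
  rewrite in_itv/= andbT => y0; rewrite indicE; have [ya|ay] := ltP y a.
    rewrite mem_set/= ?in_itv/= ?y0//= mule1; apply: poweR_le => //.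
      exact: weighted_ge0.
    apply: weighted_le => // x /=; rewrite lte_fin => yg; apply: gE.
    by apply/eqP => g0; move: yg; rewrite g0 normr0 ltNge (ltW y0).
  rewrite memNset/= ?in_itv/= ?y0/= ?ltNge ?ay//= mule0 /distr_fun.
  rewrite (_ : [set x | _] = set0) ?weighted0 ?poweR0r ?invr_eq0 ?gt_eqF//.
  apply/seteqP; split => // x /=; rewrite lte_fin ltNge => /negP; apply.
  exact: le_trans (ga x) ay.
rewrite ge0_integralZl//; first last.
- exact: poweR_ge0.
- by apply/measurable_EFinP; exact: measurable_indic.
apply: lee_wpmul2l; first exact: poweR_ge0.
rewrite integral_indic//; apply: (@le_trans _ _ (lam `]0%R, a[)).
  by apply: le_measure; rewrite ?inE; [exact: measurableI|by []|move=> y []].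
by rewrite lebesgue_measure_itv/= lte_fin; case: ifPn => // _;
  rewrite ?sube0 ?lee_fin.
Qed.

Lemma lorentz_oo_level v p (h : Rn R n -> \bar R) (y : R) G (B : \bar R) :
  (0 < p)%R -> (forall x, (0 <= v x)%R) -> (0 < y)%R ->
  G `<=` [set x | y%:E < `|h x|] -> lorentz_oo (weighted v) p h <= B ->
  y%:E * poweR (weighted v G) p^-1 <= B.
Proof.
move=> p0 v0 y0 Gy; apply: le_trans.
apply: (@le_trans _ _ (y%:E * poweR (distr_fun (weighted v) h y) p^-1)).
  apply: lee_wpmul2l; first by rewrite lee_fin ltW.
  by apply: poweR_le; rewrite ?invr_ge0 ?(ltW p0) ?weighted_ge0//;
    exact: weighted_le.
by apply: ereal_sup_ubound; exists y => //=; rewrite in_itv/= y0.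
Qed.

Lemma weighted_cst1 A : measurable A -> weighted (cst 1%R) A = mu A.
Proof. by move=> mA; rewrite /weighted (eq_integral (cst 1))// integral_cst//
  mul1e. Qed.

(* Integrate [z ^ alpha <= b ^ alpha + b ^ (alpha - 1) z] with [b = s / l]. *)
Lemma weighted_powR_le u (alpha s l C : R) E : (0 < alpha <= 1)%R ->
  (0 < s)%R -> (s <= l)%R -> measurable E -> measurable_fun setT u ->
  (forall x, (0 <= u x)%R) -> mu E <= l%:E ->
  \int[mu]_(x in E) (u x)%:E <= (C * s)%:E ->
  weighted (fun x => u x `^ alpha)%R E <= ((1 + C) * s * (l / s) `^ (1 - alpha))%:E.
Proof.
move=> /andP[al0 al1] s0 sl mE mu_ u0 El EC.
have l0 : (0 < l)%R by lra.
pose b := (s / l)%R; have b0 : (0 < b)%R by rewrite divr_gt0.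
have bE : (b `^ (alpha - 1) = (l / s) `^ (1 - alpha))%R.
  rewrite -(opprB 1%R alpha) -mulN1r powRrM powR_inv1 ?(ltW b0)//.
  by rewrite /b invf_div.
apply: (@le_trans _ _ (\int[mu]_(x in E) ((b `^ alpha)%:E + (b `^ (alpha - 1))%:E
  * (u x)%:E))).
  apply: ge0_le_integral_nomeas => x _; first by rewrite lee_fin powR_ge0.
  rewrite -EFinM -EFinD lee_fin; have [h|h] := leP (u x) b.
    apply: ler_wpDr; first by rewrite mulr_ge0// powR_ge0.
    by apply: ge0_ler_powR; rewrite ?nnegrE// ltW.
  apply: ler_wpDl; first exact: powR_ge0.
  have ux0 : (0 < u x)%R by lra.
  have -> : (u x `^ alpha = u x `^ (alpha - 1) * u x)%R.
    rewrite -[X in (_ = _ * X)%R](powRr1 (u0 x)) -powRD ?subrK//.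
    by rewrite (gt_eqF ux0) implybT.
  apply: ler_wpM2r => //; rewrite -(opprB 1%R alpha) !powRN.
  rewrite lef_pV2 ?posrE ?powR_gt0//.
  by apply: ge0_ler_powR; rewrite ?nnegrE ?(ltW ux0) ?(ltW b0) ?(ltW h)//; lra.
rewrite ge0_integralD//; first last.
- by apply: measurable_funeM; apply: measurable_funTS; exact/measurable_EFinP.
- by move=> x _; rewrite -EFinM lee_fin mulr_ge0 ?powR_ge0.
- by move=> x _; rewrite lee_fin powR_ge0.
rewrite (_ : (fun=> (b `^ alpha)%:E) = cst (b `^ alpha)%:E)// integral_cst//
  ge0_integralZl//; first last.
- by rewrite lee_fin powR_ge0.
- by move=> x _; rewrite lee_fin.
- by apply: measurable_funTS; exact/measurable_EFinP.
have -> : ((1 + C) * s * (l / s) `^ (1 - alpha) =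
    b `^ alpha * l + b `^ (alpha - 1) * (C * s))%R.
  have -> : (b `^ alpha * l = b `^ (alpha - 1) * s)%R.
    have -> : (b `^ alpha = b `^ (alpha - 1) * b)%R.
      rewrite -[X in (_ = _ * X)%R](powRr1 (ltW b0)) -powRD ?subrK//.
      by rewrite (gt_eqF b0) implybT.
    by rewrite -mulrA {2}/b mulfVK ?gt_eqF.
  by rewrite bE; ring.
rewrite EFinD !EFinM; apply: leeD; apply: lee_wpmul2l; rewrite ?lee_fin ?powR_ge0//.
Qed.

End Lorentz.

(** * Level sets of T g for bounded g supported in a set of finite measure *)

Section Restricted.
Variables (R : realType) (n : nat) (phi : \bar R -> \bar R).
Hypothesis phi_adm : admissible phi.
Variables (alpha p0 : R).
Hypotheses (halpha : (0 < alpha <= 1)%R) (hp0 : (1 <= p0)%R).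
Variable T : (Rn R n -> R) -> Rn R n -> \bar R.
Hypothesis hbound : forall u : Rn R n -> R, A1 u ->
  weak_bounded p0 (fun x => u x `^ alpha)%R T (phi (A1_norm u)).
Local Notation mu := (@leb R n).

(* For [|g| <= a] supported in a set of measure [l], [a * growth (l / s)] controls
   the rearrangement of [T g] at [s]. *)
Definition growth (r : R) : R :=
  (Num.max 1 r `^ ((1 - alpha) / p0) * fine (phi (1 + ln (Num.max 1 r))%:E))%R.

Lemma growth_ge1 r : (1 <= growth r)%R.
Proof.
have m1 : (1 <= Num.max 1 r)%R by rewrite le_max lexx.
rewrite /growth -[leLHS]mulr1; apply: ler_pM => //.
  rewrite -[leLHS](powRr0 (Num.max 1 r)%R); apply: ler_powR => //.
  by rewrite divr_ge0 ?(le_trans ler01 hp0)// subr_ge0; case/andP: halpha.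
apply: admissible_ge1 => //.
by rewrite lerDl ln_ge0.
Qed.

Lemma growth_le r t : (r <= t)%R -> (growth r <= growth t)%R.
Proof.
move=> rt.
have m1 : (1 <= Num.max 1 r)%R by rewrite le_max lexx.
have m : (Num.max 1 r <= Num.max 1 t)%R by rewrite ge_max !le_max lexx rt orbT.
have l1 : (0 <= ln (Num.max 1 r))%R by rewrite ln_ge0.
rewrite /growth; apply: ler_pM.
- exact: powR_ge0.
- by apply: le_trans (admissible_ge1 phi_adm _) => //; rewrite lerDl.
- apply: ge0_ler_powR => //; rewrite ?nnegrE//; last 2 first.
  + by apply: le_trans m1.
  + by apply: le_trans m; apply: le_trans m1.
  by rewrite divr_ge0 ?(le_trans ler01 hp0)// subr_ge0; case/andP: halpha.
- apply: admissible_le => //; first by rewrite lerDl.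
  have p1 := lt_le_trans ltr01 m1.
  by rewrite lerD2l ler_ln ?posrE//; exact: lt_le_trans m.
Qed.

Lemma restricted_estimate : exists2 C : R, (0 < C)%R &
  forall (g : Rn R n -> R) (a l y s : R) (E G : set (Rn R n)),
  measurable_fun setT g -> (0 <= a)%R -> (0 < l)%R -> (0 < y)%R -> (0 < s)%R ->
  (forall x, (`|g x| <= a)%R) -> (forall x, g x != 0%R -> E x) ->
  measurable E -> mu E <= l%:E ->
  measurable G -> G `<=` [set x | y%:E < `|T g x|] -> mu G = s%:E ->
  (y <= C * a * growth (l / s))%R.
Proof.
have [C0 C01 HC0] := @exists_A1_weight R n.
have [K [b [K1 b0 Hdil]]] := admissible_dilation phi_adm.
have p00 : (0 < p0)%R := lt_le_trans ltr01 hp0.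
have [al0 al1] := andP halpha.
(* [C0] enters twice: through the A1 constant inside phi, where dilation turns it into K C0^b, and
   through the factor 1 + C0 in the mass of [E], taken to the power 1 / p0. *)
exists (K * C0 `^ b * (1 + C0) `^ p0^-1)%R.
  by rewrite !mulr_gt0 ?powR_gt0//; lra.
move=> g a l y s E G mg a0 l0 y0 s0 ga gE mE El mG Gy Gs.
(* The weight asks for s <= l. Replacing [l] by the maximum is what puts [Num.max 1] into
   [growth]. *)
pose l' := Num.max l s.
have sl' : (s <= l')%R by rewrite le_max lexx orbT.
have El' : mu E <= l'%:E by apply: le_trans El _; rewrite lee_fin le_max lexx.
have [u [uA u1 uc uE]] := HC0 G E s l' mG mE s0 sl' Gs El'.
have [[mu_ u0 _] _ _] := uA.
have [r [rE r1 rC]] := A1_norm_bounds uA uc.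
pose v x := (u x `^ alpha)%R.
have v0 x : (0 <= v x)%R by exact: powR_ge0.
have rls : (l' / s = Num.max 1 (l / s))%R.
  by rewrite /l' maxC maxr_pMl ?invr_ge0 ?(ltW s0)// divff// gt_eqF.
have m1 : (1 <= l' / s)%R by rewrite rls le_max lexx.
have lm0 := ln_ge0 m1.
have Wle := weighted_powR_le halpha s0 sl' mE mu_ u0 El' uE.
pose W := ((1 + C0) * s * (l' / s) `^ (1 - alpha))%R.
have W0 : (0 < W)%R by rewrite !mulr_gt0 ?powR_gt0//; lra.
have Lg : lorentz1 (weighted v) p0 (EFin \o g) <= (W `^ p0^-1 * a)%:E.
  apply: le_trans (lorentz1_bounded p00 a0 v0 ga gE) _.
  rewrite EFinM -poweR_EFin; apply: lee_wpmul2r; first by rewrite lee_fin.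
  by apply: poweR_le; rewrite ?invr_ge0 ?(ltW p00) ?weighted_ge0.
have gin : in_lorentz1 p0 v g by split => //; apply: le_lt_trans Lg _; rewrite ltry.
have := lorentz_oo_level p00 v0 y0 Gy (hbound uA gin).
have sG : s%:E <= weighted v G.
  rewrite -Gs -weighted_cst1//; apply: ge0_le_integral_nomeas => x Gx;
    rewrite lee_fin//.
  apply: (@le_trans _ _ (1 `^ alpha)%R); first by rewrite powR1.
  apply: ge0_ler_powR; rewrite ?nnegrE//; first exact: ltW.
  exact: u1.
rewrite rE (admissible_fin phi_adm r1) => H.
have : (y * s `^ p0^-1 <= fine (phi r%:E) * (W `^ p0^-1 * a))%R.
  rewrite -lee_fin; apply: (@le_trans _ _ (y%:E * poweR (weighted v G) p0^-1)).
    rewrite EFinM -poweR_EFin; apply: lee_wpmul2l; first by rewrite lee_fin ltW.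
    by apply: poweR_le; rewrite ?invr_ge0 ?(ltW p00) ?lee_fin ?(ltW s0).
  apply: le_trans H _; rewrite [leRHS]EFinM; apply: lee_wpmul2l => //.
  by rewrite lee_fin; apply: le_trans (admissible_ge1 phi_adm r1).
have hphi : (fine (phi r%:E) <= K * C0 `^ b * fine (phi (1 + ln (l' / s))%:E))%R.
  apply: le_trans (Hdil _ _ C01 _); first exact: admissible_le.
  by rewrite lerDl.
have sp : (0 < s `^ p0^-1)%R by rewrite powR_gt0.
rewrite -ler_pdivlMr// => H2; apply: le_trans H2 _.
rewrite ler_pdivrMr// /growth -rls.
have WE : (W `^ p0^-1 = (1 + C0) `^ p0^-1 * s `^ p0^-1 * (l' / s) `^ ((1 - alpha)
  / p0))%R.
  have c0 : (0 <= 1 + C0)%R by lra.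
  by rewrite /W powRM ?powR_ge0 ?mulr_ge0 ?(ltW s0)// powRM ?(ltW s0)// -powRrM.
rewrite WE; apply: le_trans (ler_wpM2r _ hphi) _.
  by rewrite !mulr_ge0 ?powR_ge0.
by rewrite le_eqVlt; apply/orP; left; apply/eqP; ring.
Qed.

End Restricted.

(** * Integrals of T g over sets of given measure *)

Section Average.
Variables (R : realType) (n : nat) (phi : \bar R -> \bar R).
Hypothesis phi_adm : admissible phi.
Variables (alpha p0 : R).
Hypotheses (halpha : (0 < alpha <= 1)%R) (hp0 : (1 <= p0)%R).
Variable T : (Rn R n -> R) -> Rn R n -> \bar R.
Hypothesis hbound : forall u : Rn R n -> R, A1 u ->
  weak_bounded p0 (fun x => u x `^ alpha)%R T (phi (A1_norm u)).
Local Notation mu := (@leb R n).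
Local Notation gr := (growth phi alpha p0).
Local Notation kappa := ((1 - alpha) / p0)%R.

Let growthE r : gr r = (Num.max 1 r `^ kappa * fine (phi (1 + ln (Num.max 1
  r))%:E))%R.
Proof. by []. Qed.


Let growth_gt0 r : (0 < gr r)%R.
Proof. exact: lt_le_trans ltr01 (growth_ge1 phi_adm halpha hp0 r). Qed.

Lemma kappa_ge0_lt1 : (0 <= kappa < 1)%R.
Proof.
have [al0 al1] := andP halpha; have p00 : (0 < p0)%R := lt_le_trans ltr01 hp0.
rewrite divr_ge0 ?subr_ge0 ?(ltW p00)//= ltr_pdivrMr// mul1r.
by apply: lt_le_trans hp0; rewrite ltrBlDr ltrDl.
Qed.

(* [q < 2] is what makes [s |-> growth (l / s)] integrable at [0]. *)
Lemma growth_dyadic : exists K q : R, [/\ (1 <= K)%R, (0 < q < 2)%R &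
  forall (j : nat) r, (gr (2 ^+ j * r) <= K * q ^+ j * gr r)%R].
Proof.
have [K [b [K1 b0 Hdil]]] := admissible_dilation phi_adm.
have /andP[k0 k1] := kappa_ge0_lt1.
(* [e] is small enough for kappa + e b < 1: the b-th power of a logarithm is going to cost only e b
   in the exponent, and q = 2^(kappa + e b) stays below 2. *)
pose e := Num.min 1%R ((1 - kappa) / (2 * b))%R.
have e0 : (0 < e)%R by rewrite lt_min ltr01 divr_gt0 ?subr_gt0// mulr_gt0.
have e1 : (e <= 1)%R by rewrite ge_min lexx.
have eb : (e * b <= (1 - kappa) / 2)%R.
  rewrite -ler_pdivlMr//; apply: (@le_trans _ _ ((1 - kappa) / (2 * b))%R).
    by rewrite ge_min lexx orbT.
  by rewrite invfM mulrA.
have ln2 : (0 < ln 2 :> R)%R by rewrite ln_gt0// ltr1n.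
exists (K * (e^-1) `^ b)%R, (expR ((kappa + e * b) * ln 2)); split.
- rewrite -[leLHS]mulr1; apply: ler_pM => //.
  apply: (@le_trans _ _ (1 `^ b)%R); first by rewrite powR1.
  apply: ge0_ler_powR; rewrite ?nnegrE ?(ltW b0) ?invr_ge0 ?(ltW e0)//.
  by rewrite invf_ge1.
- rewrite expR_gt0/= -[ltRHS](lnK (x := 2%R)) ?posrE// ltr_expR.
  by rewrite gtr_pMl//; lra.
move=> j r.
set m := Num.max 1%R r.
have m1 : (1 <= m)%R by rewrite le_max lexx.
have m0 : (0 < m)%R := lt_le_trans ltr01 m1.
have j1 : (1 <= 2 ^+ j :> R)%R by rewrite exprn_ege1// ler1n.
have j0 : (0 < 2 ^+ j :> R)%R := lt_le_trans ltr01 j1.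
apply: (@le_trans _ _ (gr (2 ^+ j * m))).
  by apply: growth_le => //; rewrite ler_pM2l// le_max lexx orbT.
have jm1 : (1 <= 2 ^+ j * m)%R by rewrite -[leLHS]mulr1; apply: ler_pM.
rewrite !growthE -/m.
rewrite (max_r jm1) powRM ?(ltW m0) ?(ltW j0)//.
have lm0 : (0 <= ln m)%R by rewrite ln_ge0.
have jl : (1 <= 1 + j%:R * ln 2 :> R)%R by rewrite lerDl mulr_ge0// ltW.
have gm1 : (1 <= 1 + ln m)%R by rewrite lerDl.
have H1 : (fine (phi (1 + ln (2 ^+ j * m))%:E) <=
    K * (1 + j%:R * ln 2) `^ b * fine (phi (1 + ln m)%:E))%R.
  apply: le_trans (Hdil _ _ jl gm1); apply: admissible_le => //.
    by rewrite lerDl ln_ge0.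
  rewrite lnM ?posrE// lnXn// -[(ln 2 *+ j)%R]mulr_natl.
  have : (0 <= (j%:R * ln 2) * ln m :> R)%R by rewrite !mulr_ge0// ltW.
  by lra.
(* Since e <= 1, one has 1 + x <= (1 + e x) / e <= exp (e x) / e; take x = j ln 2 and raise to the
   power b. *)
have H2 : ((1 + j%:R * ln 2) `^ b <= (e^-1) `^ b * expR (e * b * ln 2) ^+ j)%R.
  have -> : (expR (e * b * ln 2) ^+ j = expR (e * (j%:R * ln 2)) `^ b)%R.
    by rewrite -expRM_natr -expRM; congr expR; ring.
  rewrite -powRM ?invr_ge0 ?(ltW e0) ?expR_ge0//.
  apply: ge0_ler_powR; rewrite ?nnegrE ?(ltW b0)//.
  - exact: le_trans jl.
  - by rewrite mulr_ge0 ?invr_ge0 ?(ltW e0) ?expR_ge0.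
  rewrite ler_pdivlMl//; apply: le_trans (expR_ge1Dx _).
  by rewrite mulrDr mulr1 lerD2r.
have H3 : ((2 ^+ j) `^ kappa = expR (kappa * ln 2) ^+ j)%R.
  by rewrite /powR gt_eqF// lnXn// -expRM_natr; congr expR; rewrite -mulr_natr; ring.
rewrite H3; set P := expR _ ; set Q := expR _ in H2 *; set g0 := fine _ in H1 *;
  set g1 := fine _ in H1 *.
have -> : expR ((kappa + e * b) * ln 2) = (P * Q)%R by rewrite -expRD;
  congr expR; ring.
rewrite exprMn.
have g10 : (0 <= g1)%R by apply: le_trans (admissible_ge1 phi_adm gm1).
apply: (@le_trans _ _ (P ^+ j * m `^ kappa * (K * (e^-1 `^ b * Q ^+ j) * g1))%R).
  apply: ler_wpM2l; first by rewrite mulr_ge0 ?powR_ge0// exprn_ge0// expR_ge0.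
  apply: le_trans H1 _; apply: ler_wpM2r => //; apply: ler_wpM2l => //.
  exact: le_trans K1.
by rewrite le_eqVlt; apply/orP; left; apply/eqP; ring.
Qed.

(** Layers: the part of [F] where |T g| exceeds D_j = 2 C1 a growth (2^j l / s) has measure at most
    2^-j s, and the products D_(j + 1) 2^-j are summable because D_j grows at most like q^j with q <
    2. *)
Lemma average_estimate : exists2 C : R, (0 < C)%R &
  forall (g : Rn R n -> R) (a l s : R) (E F : set (Rn R n)),
  measurable_fun setT g -> (0 <= a)%R -> (0 < l)%R -> (0 < s)%R ->
  (forall x, (`|g x| <= a)%R) -> (forall x, g x != 0%R -> E x) ->
  measurable E -> mu E <= l%:E -> measurable_fun setT (T g) ->
  measurable F -> mu F = s%:E ->
  \int[mu]_(x in F) `|T g x| <= (C * a * s * gr (l / s))%:E.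
Proof.
have [C1 C10 HC1] := restricted_estimate phi_adm halpha hp0 hbound.
have [K [q [K1 /andP[q0 q2] Hdy]]] := growth_dyadic.
(* The term 1 stands for the level D_0 over all of [F], the other one for the geometric series of
   ratio q / 2 over the layers. *)
pose C := (2 * C1 * (1 + K * q / (1 - q / 2)))%R.
have q20 : (0 < 1 - q / 2)%R by lra.
have C0 : (0 < C)%R.
  by rewrite !mulr_gt0// ltr_pwDl// divr_ge0 ?(ltW q20)// mulr_ge0 ?(ltW q0)//; lra.
exists C => // g a' l s E F mg a'0 l0 s0 ga' gE mE El mTg mF Fs.
(* For a > 0 the levels D_j are positive and strictly above the restricted estimate. A bound that
   may be 0 is reached by an arbitrarily small perturbation. *)
suff main a : (0 < a)%R -> (forall x, (`|g x| <= a)%R) ->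
    \int[mu]_(x in F) `|T g x| <= (C * a * s * gr (l / s))%:E.
  apply/lee_addgt0Pr => e e0.
  have c0 : (0 < C * s * gr (l / s))%R by exact: mulr_gt0 (mulr_gt0 C0 s0) _.
  pose a := (a' + e / (C * s * gr (l / s)))%R.
  have ee : (0 < e / (C * s * gr (l / s)))%R by rewrite divr_gt0.
  apply: le_trans (main a _ _) _; first by rewrite ltr_wpDl.
    by move=> x; apply: le_trans (ga' x) _; rewrite lerDl ltW.
  rewrite -EFinD lee_fin /a mulrDr !mulrDl lerD2l.
  set Z := (C * s * gr (l / s))%R in c0 *.
  have -> : (C * (e / Z) * s * gr (l / s) = e / Z * (C * s * gr (l / s)))%R by ring.
  by rewrite -/Z mulfVK// gt_eqF.
move=> a0 ga.
pose D j := (2 * C1 * a * gr (2 ^+ j * (l / s)))%R.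
have D0 j : (0 < D j)%R.
  by rewrite /D mulr_gt0 ?growth_gt0// !mulr_gt0.
pose S j := F `&` [set x | (D j)%:E < `|T g x|].
have mS j : measurable (S j).
  apply: measurableI => //; rewrite -[X in measurable X]setTI.
  by apply: emeasurable_fun_o_infty => //; exact: measurableT_comp.
(* On a set of measure above 2^-j s the restricted estimate would cap the level at C1 a growth (2^j
   l / s), which is half of D_j. *)
have Sle j : mu (S j) <= (2^-1 ^+ j * s)%:E.
  rewrite leNgt; apply/negP => h.
  have SF : mu (S j) <= s%:E by rewrite -Fs; apply: le_measure; rewrite ?inE//;
    exact: subIsetl.
  have e2 : (0 < 2^-1 ^+ j :> R)%R by rewrite exprn_gt0// invr_gt0.
  have fS : mu (S j) \is a fin_num by rewrite ge0_fin_numE// (le_lt_trans SF)// ltry.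
  have sE : mu (S j) = (fine (mu (S j)))%:E by rewrite fineK.
  move: h; rewrite sE lte_fin => h.
  have s'0 : (0 < fine (mu (S j)))%R by apply: lt_trans h; rewrite mulr_gt0.
  have := HC1 g a l (D j) _ E (S j) mg (ltW a0) l0 (D0 j) s'0 ga gE mE El (mS j)
    _ sE.
  move=> /(_ (@subIsetr _ _ _)); apply/negP; rewrite -ltNge.
  apply: (@le_lt_trans _ _ (C1 * a * gr (2 ^+ j * (l / s)))%R).
    apply: ler_wpM2l; first by rewrite mulr_ge0 ?ltW.
    apply: growth_le => //; rewrite mulrCA; apply: ler_wpM2l; first exact: ltW.
    rewrite -[leRHS]invrK lef_pV2 ?posrE ?invr_gt0 ?divr_gt0 ?exprn_gt0//.
    by rewrite invf_div mulrC -exprVn ltW.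
  rewrite /D -!mulrA ltr_pMl; first by rewrite ltr1n.
  by rewrite mulr_gt0// mulr_gt0 ?growth_gt0.
have t0 x j : 0 <= (D j.+1)%:E * (\1_(S j) x)%:E :> \bar R.
  by rewrite mule_ge0// lee_fin ltW.
(* If |T g x| is above D_0 and i is least with |T g x| <= D_(i + 1), then x lies in [S i] and the
   i-th term alone dominates. *)
have pw x : F x -> `|T g x| <= (D 0%N)%:E + \sum_(0 <= j <oo) ((D j.+1)%:E *
  (\1_(S j) x)%:E).
  move=> Fx; have [h|h] := leP `|T g x| (D 0%N)%:E.
    by apply: le_trans h _; rewrite leeDl// nneseries_ge0.
  have S1 j : (D j)%:E < `|T g x| -> (\1_(S j) x)%:E = 1 :> \bar R.
    by move=> hj; rewrite indicE mem_set.
  have [[j hj]|hN] := pselect (exists j, `|T g x| <= (D j.+1)%:E).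
    have ej : exists j, `|T g x| <= (D j.+1)%:E by exists j.
    case: (ex_minnP ej) => i hi imin.
    have Di : (D i)%:E < `|T g x|.
      case: i hi imin => // i hi imin; rewrite ltNge; apply/negP => /imin.
      by rewrite ltnn.
    rewrite -[leLHS]add0e; apply: leeD; first by rewrite lee_fin ltW.
    apply: le_trans (nneseries_lim_ge i.+1 _) => //.
    rewrite big_nat_recr//= S1// mule1 -[leLHS]add0e; apply: leeD => //.
    exact: sume_ge0.
  (* Here |T g x| exceeds all levels: every indicator is 1 and the terms, each at least D_0, add up
     to infinity. *)
  rewrite (_ : \sum_(0 <= j <oo) _ = +oo) ?addey ?leey//.
  apply/eqyP => A A0.
  have Dj j : (D j)%:E < `|T g x|.
    by case: j => // j; rewrite ltNge; apply/negP => hj; apply: hN; exists j.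
  have A1 : (0 <= A / D 0%N)%R by rewrite divr_ge0// ltW.
  apply: le_trans (nneseries_lim_ge (Num.bound (A / D 0%N)) _) => //.
  apply: (@le_trans _ _ (\sum_(0 <= j < Num.bound (A / D 0%N)) (D 0%N)%:E)).
    rewrite sumEFin big_const_nat subn0 iter_addr_0 lee_fin -mulr_natl
      -ler_pdivrMr//.
    by rewrite ltW// archi_boundP.
  apply: lee_sum => j _; rewrite S1// mule1 lee_fin.
  apply: ler_wpM2l; first by rewrite !mulr_ge0 ?(ltW C10) ?(ltW a0).
  apply: growth_le => //; apply: ler_wpM2r; first by rewrite divr_ge0 ?ltW.
  by rewrite expr0 exprn_ege1// ler1n.
have mS1 j : measurable_fun setT (fun x => (\1_(S j) x)%:E : \bar R).
  by apply/measurable_EFinP; exact: measurable_indic.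
apply: (@le_trans _ _ (\int[mu]_(x in F) ((D 0%N)%:E +
    \sum_(0 <= j <oo) ((D j.+1)%:E * (\1_(S j) x)%:E)))).
  exact: ge0_le_integral_nomeas.
rewrite ge0_integralD//; first last.
- apply: (@ge0_emeasurable_sum _ _ _ _ _ xpredT) => // j _.
  by apply: measurable_funeM; exact: measurable_funTS.
- by move=> x _; rewrite nneseries_ge0.
- by move=> x _; rewrite lee_fin ltW.
rewrite (_ : (fun=> (D 0%N)%:E) = cst (D 0%N)%:E)// integral_cst//.
rewrite integral_nneseries//; last by move=> j; apply: measurable_funeM;
  exact: measurable_funTS.
have -> : (C * a * s * gr (l / s) = D 0%N * s +
    (2 * C1 * a * K * q * gr (l / s) * s) / (1 - q / 2))%R.
  by rewrite /D expr0 mul1r /C; ring.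
rewrite EFinD; apply: leeD; first by rewrite [leRHS]EFinM; apply: lee_wpmul2l;
  rewrite ?lee_fin ?(ltW (D0 _))//; rewrite -Fs.
apply: le_trans (nneseries_geometric_le (r := (q / 2)%R) _ _).
- apply: lee_nneseries => j _; first by move=> _; exact: integral_ge0.
  rewrite ge0_integralZl//; first last.
  + by rewrite lee_fin ltW.
  + exact: measurable_funTS.
  rewrite integral_indic//;
    apply: (@le_trans _ _ ((D j.+1)%:E * (2^-1 ^+ j * s)%:E)).
    apply: lee_wpmul2l; first by rewrite lee_fin ltW.
    by apply: le_trans (Sle j); apply: le_measure; rewrite ?inE;
      [exact: measurableI|exact: mS|exact: subIsetl].
  rewrite -EFinM lee_fin /D.
  have h := Hdy j.+1 (l / s)%R.
  apply: (@le_trans _ _ (2 * C1 * a * (K * q ^+ j.+1 * gr (l / s)) * (2^-1 ^+ j *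
    s))%R).
    apply: ler_wpM2r; first by rewrite mulr_ge0 ?(ltW s0)// exprn_ge0// invr_ge0.
    by apply: ler_wpM2l => //; rewrite !mulr_ge0 ?(ltW C10) ?(ltW a0).
  by rewrite exprS exprMn le_eqVlt; apply/orP; left; apply/eqP; ring.
- rewrite mulr_ge0 ?(ltW s0)// mulr_ge0 ?(ltW (growth_gt0 _))// mulr_ge0 ?(ltW q0)//.
  by rewrite mulr_ge0 ?(le_trans ler01 K1)// !mulr_ge0 ?(ltW C10) ?(ltW a0).
- by lra.
Qed.

End Average.

(** * Truncation of a real function at a height *)

Section Truncation.
Variable R : realType.
Implicit Types a b x : R.

Definition trunc_at a x : R := Num.max (- a)%R (Num.min a x).

Lemma trunc_at_spec a x : (0 <= a)%R ->
  [\/ (a < x)%R /\ trunc_at a x = a, (x < - a)%R /\ trunc_at a x = (- a)%R |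
      (- a <= x <= a)%R /\ trunc_at a x = x].
Proof.
move=> a0; rewrite /trunc_at.
have [h1|h1] := leP a x.
  rewrite max_r; last lra.
  have [h|h] := ltP a x; first by constructor 1.
  by constructor 3; split; lra.
have [h2|h2] := leP (- a)%R x; first by constructor 3; split => //; lra.
by constructor 2; split.
Qed.

Lemma trunc_at_le a x : (0 <= a)%R -> (`|trunc_at a x| <= a)%R.
Proof. by move=> a0; rewrite ler_norml; case: (trunc_at_spec x a0) => -[h ->];
  lra. Qed.

Lemma trunc_at_le_id a x : (0 <= a)%R -> (`|trunc_at a x| <= `|x|)%R.
Proof.
move=> a0; case: (ger0P x) => hx; rewrite ler_norml;
by case: (trunc_at_spec x a0) => -[h ->]; lra.
Qed.

Lemma sub_trunc_at_le a x : (0 <= a)%R -> (`|x - trunc_at a x| <= `|x|)%R.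
Proof.
move=> a0; case: (ger0P x) => hx; rewrite ler_norml;
by case: (trunc_at_spec x a0) => -[h ->]; lra.
Qed.

Lemma sub_trunc_at_neq0 a x : (0 <= a)%R -> (x - trunc_at a x != 0)%R ->
  (a < `|x|)%R.
Proof.
move=> a0; case: (trunc_at_spec x a0) => -[h ->].
- by move=> _; apply: lt_le_trans (ler_norm _).
- by move=> _; rewrite -normrN; apply: lt_le_trans (ler_norm _); lra.
- by rewrite subrr eqxx.
Qed.

Lemma trunc_at_diff_le a b x : (0 <= b)%R -> (b <= a)%R ->
  (`|trunc_at a x - trunc_at b x| <= a)%R.
Proof.
move=> b0 ba; have a0 : (0 <= a)%R by lra.
rewrite ler_norml.
by case: (trunc_at_spec x a0) => -[h ->]; case: (trunc_at_spec x b0) => -[h' ->];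
  lra.
Qed.

Lemma trunc_at_diff_le_id a b x : (0 <= b)%R -> (b <= a)%R ->
  (`|trunc_at a x - trunc_at b x| <= `|x|)%R.
Proof.
move=> b0 ba; have a0 : (0 <= a)%R by lra.
case: (ger0P x) => hx; rewrite ler_norml;
by case: (trunc_at_spec x a0) => -[h ->]; case: (trunc_at_spec x b0) => -[h' ->];
  lra.
Qed.

Lemma trunc_at_diff_neq0 a b x : (0 <= b)%R -> (b <= a)%R ->
  (trunc_at a x - trunc_at b x != 0)%R -> (b < `|x|)%R.
Proof.
move=> b0 ba; have a0 : (0 <= a)%R by lra.
case: (trunc_at_spec x b0) => -[h ->].
- by move=> _; apply: lt_le_trans (ler_norm _).
- by move=> _; rewrite -normrN; apply: lt_le_trans (ler_norm _); lra.
case: (trunc_at_spec x a0) => -[h' ->]; last by rewrite subrr eqxx.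
  by move=> /eqP; lra.
by move=> /eqP; lra.
Qed.

Lemma measurable_trunc_at a d (S : measurableType d) (f : S -> R) :
  measurable_fun setT f -> measurable_fun setT (fun z => trunc_at a (f z)).
Proof.
by move=> mf; apply: measurable_maxr => //; exact: measurable_minr.
Qed.

End Truncation.

(** * The decreasing rearrangement of a measurable function *)

Section RearrangementFacts.
Variables (R : realType) (n : nat).
Local Notation mu := (@leb R n).
Variable f : Rn R n -> R.
Hypothesis mf : measurable_fun setT f.
Local Notation fs := (rearrangement mu (EFin \o f)).

Lemma measurable_norm_gt (a : R) : measurable [set x | (a < `|f x|)%R].
Proof.
rewrite (_ : [set x | _] = [set x | a%:E < `|(EFin \o f) x|]).
  rewrite -[X in measurable X]setTI; apply: emeasurable_fun_o_infty => //.
  by apply: measurableT_comp => //; exact/measurable_EFinP.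
by apply/seteqP; split => x /=; rewrite lte_fin.
Qed.

Lemma distr_funE (a : R) : distr_fun mu (EFin \o f) a = mu [set x | (a < `|f x|)%R].
Proof. by congr (mu _); apply/seteqP; split => x /=; rewrite lte_fin. Qed.

Lemma rearrangement_ge0 t : 0 <= fs t.
Proof. by apply: le_ereal_inf_tmp => _ [s [s0 _] <-]; rewrite lee_fin ltW. Qed.

Lemma rearrangement_le s t : (s <= t)%R -> fs t <= fs s.
Proof.
move=> st; apply: ereal_inf_le_tmp => _ [z [z0 zs] <-]; exists z => //; split => //.
by apply: le_trans zs _; rewrite lee_fin.
Qed.

Lemma rearrangement_ge s (z : R) : s%:E < mu [set x | (z < `|f x|)%R] -> z%:E <=
  fs s.
Proof.
move=> sz; apply: le_ereal_inf_tmp => _ [y [y0 ys] <-]; rewrite lee_fin leNgt.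
apply/negP => yz; move: sz; apply/negP; rewrite -leNgt; apply: le_trans ys.
rewrite distr_funE; apply: le_measure; rewrite ?inE; [exact: measurable_norm_gt..|].
by move=> x /=; exact: lt_trans.
Qed.

(** Each height a + 1 / (k + 1) lies above some competitor of the infimum, so its level set has
    measure at most s; these sets increase to the level set at height a. *)
Lemma measure_gt_rearrangement s (a : R) : fs s = a%:E ->
  mu [set x | (a < `|f x|)%R] <= s%:E.
Proof.
move=> fa; pose F k := [set x | (a + k.+1%:R^-1 < `|f x|)%R].
have mF k : measurable (F k) by exact: measurable_norm_gt.
have FE : [set x | (a < `|f x|)%R] = \bigcup_k F k.
  apply/seteqP; split => x /=; last first.
    by move=> [k _]; apply: le_lt_trans; rewrite lerDl.
  rewrite -subr_gt0 => h; exists (Num.bound (`|f x| - a)^-1) => //;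
    rewrite /F/= -ltrBrDl.
  rewrite -[ltRHS]invrK ltf_pV2 ?posrE ?invr_gt0//.
  have := archi_boundP (ltW (_ : 0 < (`|f x| - a)^-1)%R).
  rewrite invr_gt0 => /(_ h) h'; apply: lt_trans h' _.
  by rewrite ltr_nat.
have Fcvg : mu (F k) @[k --> \oo] --> mu (\bigcup_k F k).
  apply: nondecreasing_cvg_mu => //; first exact: bigcup_measurable.
  move=> p q pq; apply/subsetPset => x; apply: le_lt_trans.
  by rewrite lerD2l lef_pV2 ?posrE// ler_nat ltnS.
rewrite FE -(cvg_lim _ Fcvg)//; apply: lime_le.
  by apply/cvg_ex; eexists; exact: Fcvg.
near=> k.
have : fs s < (a + k.+1%:R^-1)%:E by rewrite fa lte_fin ltrDl.
move=> /ereal_inf_lt[_ [z [z0 zs] <-]]; rewrite lte_fin => za.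
apply: le_trans zs; rewrite distr_funE; apply: le_measure; rewrite ?inE//.
  exact: measurable_norm_gt.
by move=> x; apply: lt_trans.
Unshelve. all: by end_near.
Qed.

End RearrangementFacts.

(** * Smallness of an integral near 0 *)

Section TailLemma.
Variable R : realType.
Local Notation lam := (@lebesgue_measure R).

Lemma nonincreasing_emeasurable (G : R -> \bar R) :
  (forall x y, (x <= y)%R -> G y <= G x) -> measurable_fun setT G.
Proof.
move=> H; apply: (measurability _ (ErealGenOInfty.measurableE R)).
move=> /= _ [_ [a ->]] <-; apply: measurableI => //.
apply: is_interval_measurable => x y /=;
  rewrite !in_itv/= !andbT => hx hy z /andP[xz zy].
by rewrite in_itv/= andbT; apply: lt_le_trans hy (H _ _ zy).
Qed.

(** [G] is going to be the power 1 / p0 of the distribution function of [f]: its integral over ]0,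
    d[ bounds the Lorentz norm of the truncation of [f] at height d. *)
Lemma integral_near0 (G : R -> \bar R) (e : R) : (0 < e)%R ->
  (forall y, 0 <= G y) -> (forall x y, (x <= y)%R -> G y <= G x) ->
  \int[lam]_(y in `]0%R, +oo[) G y < +oo ->
  exists2 d : R, (0 < d)%R & \int[lam]_(y in `]0%R, d[) G y <= e%:E.
Proof.
move=> e0 G0 Gd Gfin.
have mG := nonincreasing_emeasurable Gd.
pose I k : set R := [set` `]0%R, (k.+1%:R^-1)%R[ ].
pose g k y := G y * (\1_(I k) y)%:E.
have mI k : measurable (I k) by exact: measurable_itv.
have mg k : measurable_fun (`]0%R, +oo[ : set R) (g k).
  apply: emeasurable_funM; first exact: measurable_funTS.
  by apply/measurable_EFinP; apply: measurable_funTS; exact: measurable_indic.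
have [|||||_ _ H] := @dominated_convergence _ _ _ lam (`]0%R, +oo[ : set R) _ g
  (cst 0) G mg.
- exact: measurable_itv.
- exact: measurable_cst.
- apply: aeW => y /=; rewrite in_itv/= andbT => y0.
  apply: cvg_near_cst; near=> k.
  rewrite /g indicE memNset ?mule0// /I/= in_itv/= y0/=; apply/negP; rewrite -leNgt.
  rewrite -[leRHS]invrK lef_pV2 ?posrE ?invr_gt0//.
  near: k; exists (Num.bound y^-1) => // k /= hk.
  have yi : (0 <= y^-1)%R by rewrite invr_ge0 ltW.
  by apply: le_trans (ltW (archi_boundP yi)) _; rewrite ler_nat (leq_trans hk).
- apply/integrableP; split; first exact: measurable_funTS.
  by under eq_integral do rewrite gee0_abs//.
- apply: aeW => y k _; rewrite /g indicE; case: (_ \in _);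
  rewrite ?mule1 ?mule0 ?abse0//.
  by rewrite gee0_abs.
have {}H : (fun k => \int[lam]_(y in `]0%R, +oo[) g k y) @ \oo --> 0.
  by move: H; rewrite integral0.
have e0' : 0 < e%:E by rewrite lte_fin.
have := H _ (open_ereal_lt' e0').
move=> [k _ /(_ k (leqnn _))] hk; exists (k.+1%:R^-1)%R => //.
apply: le_trans (ltW hk); rewrite integral_mkcond [leRHS]integral_mkcond.
apply: ge0_le_integral_nomeas => y _; first by rewrite patchE; case: ifPn.
rewrite !patchE /g indicE; case: (boolP (y \in _)) => h; last first.
  by case: ifPn => // _; rewrite mule0.
rewrite /= mule1 ifT//; move: h; rewrite !inE/= !in_itv/= andbT => /andP[].
by [].
Unshelve. all: by end_near.
Qed.

End TailLemma.

(** * Decomposition of f by truncation, and the bottom piece *)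

Section Core.
Variables (R : realType) (n : nat) (phi : \bar R -> \bar R).
Hypothesis phi_adm : admissible phi.
Variables (alpha p0 : R).
Hypotheses (halpha : (0 < alpha <= 1)%R) (hp0 : (1 <= p0)%R).
Variable T : (Rn R n -> R) -> Rn R n -> \bar R.
Hypothesis hT : sublinear_on (A1_domain alpha p0) T.
Hypothesis hbound : forall u : Rn R n -> R, A1 u ->
  weak_bounded p0 (fun x => u x `^ alpha)%R T (phi (A1_norm u)).
Local Notation mu := (@leb R n).
Local Notation lam := (@lebesgue_measure R).
Local Notation gr := (growth phi alpha p0).

Let p00 : (0 < p0)%R := lt_le_trans ltr01 hp0.

Lemma poweR_inv_le (x : \bar R) (b : R) : 0 <= x -> poweR x p0^-1 <= b%:E ->
  x <= (b `^ p0)%:E.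
Proof.
move=> x0 h; have -> : x = poweR (poweR x p0^-1) p0.
  by rewrite -poweRrM mulVf ?gt_eqF// poweRe1.
rewrite -poweR_EFin; apply: poweR_le => //; [exact: ltW|exact: poweR_ge0].
Qed.

Lemma A1_domain_le (f h : Rn R n -> R) : A1_domain alpha p0 f ->
  measurable_fun setT h -> (forall x, (`|h x| <= `|f x|)%R) -> A1_domain alpha p0 h.
Proof.
move=> [u uA [mf Lf]] mh hf; exists u; first exact: uA.
split; first exact: mh.
apply: le_lt_trans Lf; apply: lorentz1_le => //; first exact: ltW.
by move=> x; exact: powR_ge0.
Qed.

Lemma A1_domain_measurable (f : Rn R n -> R) : A1_domain alpha p0 f ->
  measurable_fun setT f.
Proof. by move=> [u _ []]. Qed.

(** Lets smallness for the measure v dx be converted into smallness for Lebesgue measure. The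
    sublevel sets decrease to a null set, and [F] has finite measure. *)
Lemma measure_sublevel_small (v : Rn R n -> R) (F : set (Rn R n)) (e : R) :
  measurable_fun setT v -> {ae mu, forall x, (0 < v x)%R} -> measurable F ->
  mu F < +oo -> (0 < e)%R ->
  exists2 c : R, (0 < c)%R & mu (F `&` [set x | (v x <= c)%R]) <= e%:E.
Proof.
move=> mv v0 mF Ffin e0.
have ml c : measurable [set x | (v x <= c)%R].
  rewrite (_ : [set x | _] = [set x | (EFin \o v) x <= c%:E]).
    by rewrite -[X in measurable X]setTI; apply: emeasurable_fun_infty_c => //;
      exact/measurable_EFinP.
  by apply/seteqP; split => x /=; rewrite lee_fin.
pose S k := F `&` [set x | (v x <= k.+1%:R^-1)%R].
have mS k : measurable (S k) by apply: measurableI.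
have S0 : mu (\bigcap_k S k) = 0.
  apply: (@measure_negligible _ _ _ mu); first exact: bigcap_measurable.
  apply: negligibleS v0 => x Sx /= vx.
  have [_ /=] := Sx (Num.bound (v x)^-1) I.
  apply/negP; rewrite -ltNge -[ltRHS]invrK ltf_pV2 ?posrE ?invr_gt0//.
  have h : (0 <= (v x)^-1)%R by rewrite invr_ge0 ltW.
  by apply: lt_trans (archi_boundP h) _; rewrite ltr_nat.
have : mu (S k) @[k --> \oo] --> mu (\bigcap_k S k).
  apply: nonincreasing_cvg_mu => //.
  - by apply: le_lt_trans Ffin; apply: le_measure; rewrite ?inE//; exact: subIsetl.
  - exact: bigcap_measurable.
  - move=> p q pq; apply/subsetPset => x [Fx /= h]; split => //=;
    apply: le_trans h _.
    by rewrite lef_pV2 ?posrE// ler_nat ltnS.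
rewrite S0 => /(_ _ (open_ereal_lt' (_ : 0 < e%:E))); rewrite lte_fin => /(_ e0).
by move=> [k _ /(_ k (leqnn _)) /= hk]; exists k.+1%:R^-1%R => //; exact: ltW.
Qed.

Lemma tail_small (f u : Rn R n -> R) (F : set (Rn R n)) (y e : R) : A1 u ->
  in_lorentz1 p0 (fun x => u x `^ alpha)%R f -> measurable F -> mu F < +oo ->
  (0 < y)%R -> (0 < e)%R ->
  exists2 d : R, (0 < d)%R & forall a, (0 <= a)%R -> (a <= d)%R ->
    mu (F `&` [set x | y%:E < `|T (fun x => trunc_at a (f x)) x|]) <= e%:E.
Proof.
move=> uA [mf Lf] mF Ffin y0 e0.
set v := fun x : Rn R n => (u x `^ alpha)%R in Lf.
have [[mu_ u0 _] _ [c uc]] := uA.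
have v0 x : (0 <= v x)%R by exact: powR_ge0.
have mv : measurable_fun setT v by exact: (measurableT_comp (measurable_powR
  alpha) mu_).
have vae : {ae mu, forall x, (0 < v x)%R}.
  by move: (A1_ae_gt0 uA); apply: filterS => x; exact: powR_gt0.
have e20 : (0 < e / 2)%R by rewrite divr_gt0.
have [b b0 hb] := measure_sublevel_small mv vae mF Ffin e20.
have [r [rE r1 _]] := A1_norm_bounds uA uc.
pose K := fine (phi r%:E).
have K1 : (1 <= K)%R by exact: admissible_ge1.
have K0 : (0 < K)%R := lt_le_trans ltr01 K1.
(* Chosen so that K z / y = (b e / 2)^(1 / p0): a Lorentz norm of at most z forces v(S) <= b e /
   2. *)
pose z := (y * (b * (e / 2)) `^ p0^-1 / K)%R.
have z0 : (0 < z)%R by rewrite divr_gt0// mulr_gt0// powR_gt0// mulr_gt0.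
pose G y := poweR (distr_fun (weighted v) (EFin \o f) y) p0^-1.
have [||d d0 hd] := integral_near0 z0 (G := G) _ _ Lf.
- by move=> x; exact: poweR_ge0.
- move=> x1 x2 x12; apply: poweR_le; rewrite ?invr_ge0 ?(ltW p00) ?weighted_ge0//.
  by apply: weighted_le => // x /=; apply: le_lt_trans; rewrite lee_fin.
exists d => // a a0 ad.
set h := fun x => trunc_at a (f x).
have mh : measurable_fun setT h by exact: measurable_trunc_at.
have hf x : (`|h x| <= `|f x|)%R by exact: trunc_at_le_id.
have Lh : lorentz1 (weighted v) p0 (EFin \o h) <= z%:E.
  apply: le_trans hd; rewrite /lorentz1 integral_mkcond [leRHS]integral_mkcond.
  apply: ge0_le_integral_nomeas => x _; first by rewrite patchE;
    case: ifPn => // _; exact: poweR_ge0.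
  rewrite !patchE; case: ifPn => [|_]; last by case: ifPn => // _; exact: poweR_ge0.
  rewrite inE/= in_itv/= andbT => x0; case: ifPn => [_|].
    apply: poweR_le; rewrite ?invr_ge0 ?(ltW p00) ?weighted_ge0//.
    by apply: weighted_le => // w /=; rewrite !lte_fin => hw;
      exact: lt_le_trans (hf w).
  move=> /negP; rewrite inE/= in_itv/= x0/= => /negP; rewrite -leNgt => dx.
  rewrite /distr_fun (_ : [set _ | _] = set0) ?weighted0 ?poweR0r ?invr_eq0
    ?gt_eqF//.
  apply/seteqP; split => // w /=; rewrite lte_fin ltNge => /negP; apply.
  by apply: le_trans (trunc_at_le _ a0) _; exact: le_trans ad dx.
have hin : in_lorentz1 p0 v h.
  by split; [exact: mh|apply: le_lt_trans Lh _; rewrite ltry].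
have hdom : A1_domain alpha p0 h by exists u; [exact: uA|exact: hin].
set S := [set x | y%:E < `|T h x|].
have mS : measurable S.
  rewrite -[X in measurable X]setTI; apply: emeasurable_fun_o_infty => //.
  by apply: measurableT_comp => //; case: hT => + _ _; exact.
have WS : weighted v S <= (b * (e / 2))%:E.
  have := lorentz_oo_level p00 v0 y0 (@subset_refl _ S) (hbound uA hin).
  rewrite rE (admissible_fin phi_adm r1) -/K => H.
  have : poweR (weighted v S) p0^-1 <= ((b * (e / 2)) `^ p0^-1)%:E.
    have y1 : (0 < y^-1)%R by rewrite invr_gt0.
    rewrite -(lee_pmul2l _ (_ : 0 < y%:E)) ?lte_fin//; apply: le_trans H _.
    apply: le_trans (lee_wpmul2l _ Lh) _; first by rewrite lee_fin ltW.
    by rewrite -!EFinM lee_fin /z mulrC mulfVK ?gt_eqF.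
  move/poweR_inv_le => /(_ (weighted_ge0 _ v0)); rewrite -powRrM mulVf ?gt_eqF//.
  by rewrite powRr1// ltW// mulr_gt0.
have ml : measurable [set x | (v x <= b)%R].
  rewrite (_ : [set x | _] = [set x | (EFin \o v) x <= b%:E]).
    by rewrite -[X in measurable X]setTI; apply: emeasurable_fun_infty_c => //;
      exact/measurable_EFinP.
  by apply/seteqP; split => x /=; rewrite lee_fin.
(* Here v > b, so v(S) <= b e / 2 leaves Lebesgue measure at most e / 2; the sublevel set accounts
   for the other e / 2. *)
pose S' := (F `&` S) `\` [set x | (v x <= b)%R].
have mS' : measurable S' by apply: measurableD => //; exact: measurableI.
have S'le : mu S' <= (e / 2)%:E.
  rewrite -(lee_pmul2l _ (_ : 0 < b%:E)) ?lte_fin//; apply: le_trans WS.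
  apply: (@le_trans _ _ (weighted v S')); last by apply: weighted_le => // x [[]].
  rewrite -integral_cst//; apply: ge0_le_integral_nomeas => x;
    first by rewrite lee_fin ltW.
  by move=> [_ /= /negP]; rewrite -ltNge lee_fin => /ltW.
have -> : e = (e / 2 + e / 2)%R by field.
rewrite EFinD; apply: (@le_trans _ _ (mu (F `&` [set x | (v x <= b)%R]) + mu S')).
  apply: (@le_trans _ _ (mu ((F `&` [set x | (v x <= b)%R]) `|` S'))).
    apply: le_measure; rewrite ?inE; [exact: measurableI| |].
      by apply: measurableU => //; exact: measurableI.
    move=> x [Fx Sx]; have [h1|h1] := leP (v x) b; [by left|right; split => //=].
    by apply/negP; rewrite -ltNge.
  by apply: measureU2 => //; exact: measurableI.
exact: leeD.
Qed.

(** Telescoping. Each induction step splits the last truncation once more, so only finitely many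
    uses of subadditivity occur. *)
Lemma sublinear_trunc_chain (f : Rn R n -> R) (a : nat -> R) N :
  A1_domain alpha p0 f -> (forall k, (0 <= a k)%R) ->
  (forall k, (a k.+1 <= a k)%R) ->
  {ae mu, forall x, `|T f x| <= `|T (fun x => f x - trunc_at (a 0%N) (f x))%R x| +
    \sum_(0 <= k < N) `|T (fun x => trunc_at (a k) (f x) - trunc_at (a k.+1) (f
      x))%R x| +
    `|T (fun x => trunc_at (a N) (f x)) x|}.
Proof.
move=> fdom a0 aS; have mf := A1_domain_measurable fdom.
have mtr k : measurable_fun setT (fun x => trunc_at (a k) (f x)) by exact:
  measurable_trunc_at.
have trdom k : A1_domain alpha p0 (fun x => trunc_at (a k) (f x)).
  by apply: (A1_domain_le fdom) => // x; exact: trunc_at_le_id.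
case: hT => _ hadd _.
elim: N => [|N IH].
  have fE : f = ((fun x => f x - trunc_at (a 0%N) (f x)) \+ (fun x => trunc_at (a
    0%N) (f x)))%R.
    by apply/funext => x /=; rewrite subrK.
  have := hadd (fun x => f x - trunc_at (a 0%N) (f x))%R (fun x => trunc_at (a
    0%N) (f x)).
  rewrite -fE => H; have {}H := H _ (trdom 0%N).
  have /H : A1_domain alpha p0 (fun x => f x - trunc_at (a 0%N) (f x))%R.
    apply: (A1_domain_le fdom); first exact: measurable_funB.
    by move=> x; exact: sub_trunc_at_le.
  by apply: filterS => x; rewrite big_geq// adde0.
have ddom : A1_domain alpha p0 (fun x => trunc_at (a N) (f x) - trunc_at (a N.+1)
  (f x))%R.
  apply: (A1_domain_le fdom); first exact: measurable_funB.
  by move=> x; exact: trunc_at_diff_le_id.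
have := hadd _ _ ddom (trdom N.+1).
rewrite (_ : (_ \+ _)%R = (fun x => trunc_at (a N) (f x))); last first.
  by apply/funext => x /=; rewrite subrK.
apply: filterS2 IH => x h1 h2; apply: le_trans h1 _.
rewrite big_nat_recr//= -!addeA; apply: leeD => //; apply: leeD => //.
Qed.

End Core.

(** * Summation of the pieces *)

Section CoreEstimate.
Variables (R : realType) (n : nat) (phi : \bar R -> \bar R).
Hypothesis phi_adm : admissible phi.
Variables (alpha p0 : R).
Hypotheses (halpha : (0 < alpha <= 1)%R) (hp0 : (1 <= p0)%R).
Variable T : (Rn R n -> R) -> Rn R n -> \bar R.
Hypothesis hT : sublinear_on (A1_domain alpha p0) T.
Hypothesis hbound : forall u : Rn R n -> R, A1 u ->
  weak_bounded p0 (fun x => u x `^ alpha)%R T (phi (A1_norm u)).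
Local Notation mu := (@leb R n).
Local Notation gr := (growth phi alpha p0).

Let p00 : (0 < p0)%R := lt_le_trans ltr01 hp0.

Lemma lorentz1_leb (v g : Rn R n -> R) : measurable_fun setT g ->
  (forall x, v x = 1%R) ->
  lorentz1 (weighted v) p0 (EFin \o g) = lorentz1 mu p0 (EFin \o g).
Proof.
move=> mg v1; apply: eq_integral => y _; congr (poweR _ _).
rewrite distr_funE /distr_fun /weighted (eq_integral (cst 1));
  last by move=> x _; rewrite v1.
rewrite (_ : [set x | _] = [set x | (y < `|g x|)%R])//.
by rewrite integral_cst ?mul1e//; exact: measurable_norm_gt.
Qed.

(** A level set may have infinite measure, while averages are estimated over sets of finite
    measure. *)
Lemma measure_gt_subset_fin (H : set (Rn R n)) (t : R) : measurable H -> t%:E <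
  mu H ->
  exists F, [/\ measurable F, F `<=` H, t%:E < mu F & mu F < +oo].
Proof.
move=> mH tH.
pose Q m : set (Rn R n) := cube [tuple - m%:R | i < n]%R (2 * m%:R)%R.
have mQ m : measurable (Q m) by exact: measurable_cube.
have HE : H = \bigcup_m (H `&` Q m).
  apply/seteqP; split => [x Hx|x [m _ []]//].
  by have [m xm] := cube_exhaust x; exists m.
have : mu (H `&` Q m) @[m --> \oo] --> mu (\bigcup_m (H `&` Q m)).
  apply: nondecreasing_cvg_mu.
  - by move=> m; exact: measurableI.
  - by apply: bigcup_measurable => m _; exact: measurableI.
  - move=> p q pq; apply/subsetPset => x [Hx h]; split => // i.
    have := h i; rewrite !tnth_mktuple => /andP[h1 h2].
    have pq' : (p%:R <= q%:R :> R)%R by rewrite ler_nat.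
    by apply/andP; split; lra.
rewrite -HE => /(_ _ (open_ereal_gt' tH)) [m _ /(_ m (leqnn _)) /= hm].
exists (H `&` Q m); split => //; first exact: measurableI.
apply: (@le_lt_trans _ _ (mu (Q m))).
  by apply: le_measure; rewrite ?inE; [exact: measurableI|exact: mQ|exact: subIsetr].
by rewrite leb_cube ?ltry// mulr_ge0.
Qed.

(** The weak type inequality for the weight 1. The factor 4^(1 / p0) lowers the measure of the
    exceptional set to t / 4, and [e] keeps the height positive even if A = 0. *)
Lemma first_part_small (g : Rn R n -> R) (t A e : R) : A1_domain alpha p0 g ->
  (0 < t)%R -> (0 <= A)%R -> (0 < e)%R ->
  lorentz1 mu p0 (EFin \o g) <= A%:E ->
  mu [set x | (4 `^ p0^-1 * A / t `^ p0^-1 + e)%:E < `|T g x|] <= (t / 4)%:E.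
Proof.
move=> gdom t0 A0 e0 LA; have mg := A1_domain_measurable gdom.
have [c1A c1c] := A1_cst1 R n.
set v := fun x => ((cst 1 : Rn R n -> R) x `^ alpha)%R.
have v1 x : v x = 1%R by rewrite /v/= powR1.
have v0 x : (0 <= v x)%R by rewrite v1.
have Lv := lorentz1_leb mg v1.
have gin : in_lorentz1 p0 v g.
  by split; [exact: mg|rewrite Lv; apply: le_lt_trans LA _; rewrite ltry].
set y := (_ + e)%R.
have tp : (0 < t `^ p0^-1)%R by rewrite powR_gt0.
have y0 : (0 < y)%R.
  by rewrite /y ltr_wpDl// divr_ge0 ?(ltW tp)// mulr_ge0// powR_ge0.
set S := [set x | _].
have mS : measurable S.
  rewrite -[X in measurable X]setTI; apply: emeasurable_fun_o_infty => //.
  by apply: measurableT_comp => //; case: hT => + _ _; exact.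
have := lorentz_oo_level p00 v0 y0 (@subset_refl _ S) (hbound c1A gin).
have [r [rE r1 r1']] := A1_norm_bounds c1A c1c.
have -> : phi (A1_norm (cst 1%R : Rn R n -> R)) = 1.
  rewrite rE (_ : r = 1%R); first by case: phi_adm.
  by apply/eqP; rewrite eq_le r1 r1'.
have -> : weighted v S = mu S.
  rewrite /weighted (eq_integral (cst 1)); last by move=> x _; rewrite v1.
  by rewrite integral_cst// mul1e.
rewrite mul1e Lv => H.
have {}H : y%:E * poweR (mu S) p0^-1 <= A%:E by exact: le_trans H LA.
rewrite leNgt; apply/negP => tS.
have : y%:E * ((t / 4) `^ p0^-1)%:E <= A%:E.
  apply: le_trans H; apply: lee_wpmul2l; first by rewrite lee_fin ltW.
  rewrite -poweR_EFin; apply: poweR_le;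
    rewrite ?invr_ge0 ?(ltW p00) ?lee_fin ?divr_ge0 ?(ltW t0)//.
  exact: ltW.
rewrite -EFinM lee_fin; apply/negP; rewrite -ltNge.
have f4 : (0 < 4 `^ p0^-1 :> R)%R by rewrite powR_gt0.
have -> : ((t / 4) `^ p0^-1 = t `^ p0^-1 / 4 `^ p0^-1)%R.
  rewrite powRM ?(ltW t0)//; congr (_ * _)%R.
  by rewrite -powR_inv1// -powRrM mulN1r powRN.
rewrite /y mulrDl mulrA divfK ?gt_eqF// mulrAC divff ?gt_eqF// mul1r ltrDl.
by rewrite mulr_gt0// divr_gt0.
Qed.

(** Were |T f| above the claimed bound plus e on a set of measure above t, then removing the sets
    where the top and the bottom pieces are large, t / 4 each, would leave measure at least t / 2.
    There the middle pieces add up to at least C B + e / 2, while their averages add up to at most C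
    B. The t / 2 is the origin of the factor 2 in the argument of [growth]. *)
Lemma rearrangement_sum_estimate : exists2 C : R, (0 < C)%R &
  forall (t A B : R) (f : Rn R n -> R) (s a : nat -> R), A1_domain alpha p0 f ->
  (0 < t)%R -> s 0%N = t -> (forall k, (s k <= s k.+1)%R) ->
  (forall k, rearrangement mu (EFin \o f) (s k) = (a k)%:E) ->
  (forall e, (0 < e)%R -> exists k, (a k <= e)%R) ->
  (0 <= A)%R ->
  lorentz1 mu p0 (EFin \o (fun x => f x - trunc_at (a 0%N) (f x))%R) <= A%:E ->
  (forall N, (\sum_(0 <= k < N) a k * gr (2 * (s k.+1 / t)) <= B)%R) ->
  rearrangement mu (T f) t <= (4 `^ p0^-1 * A / t `^ p0^-1 + C * B)%:E.
Proof.
have [C C0 HC] := average_estimate phi_adm halpha hp0 hbound.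
exists C => // t A B f s a fdom t0 s0 sS sa a_small A0 LA SB.
have mf := A1_domain_measurable fdom.
have a0 k : (0 <= a k)%R by rewrite -lee_fin -sa; exact: rearrangement_ge0.
have aS k : (a k.+1 <= a k)%R by rewrite -lee_fin -!sa; exact: rearrangement_le.
have st k : (t <= s k)%R by elim: k => [|k IH]; [rewrite s0|exact: le_trans (sS k)].
have B0 : (0 <= B)%R by have := SB 0%N; rewrite big_geq.
set A' := (4 `^ p0^-1 * A / t `^ p0^-1)%R.
have A'0 : (0 <= A')%R by rewrite divr_ge0 ?powR_ge0// mulr_ge0// powR_ge0.
apply/lee_addgt0Pr => e e0.
set Y := (A' + C * B)%R.
have Y0 : (0 <= Y)%R by rewrite /Y addr_ge0// mulr_ge0// ltW.
apply: ereal_inf_lbound; exists (Y + e)%R => //; split; first by rewrite ltr_wpDl.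
rewrite leNgt; apply/negP => tH.
case: (hT) => Tmeas _ _.
have mTf : measurable_fun setT (T f) by exact: Tmeas.
have mlev (h : Rn R n -> R) (y : R) : A1_domain alpha p0 h ->
    measurable [set x | y%:E < `|T h x|].
  move=> hdom; rewrite -[X in measurable X]setTI;
    apply: emeasurable_fun_o_infty => //.
  by apply: measurableT_comp => //; exact: Tmeas.
have [F [mF FH tF Ffin]] := measure_gt_subset_fin (mlev f (Y + e)%R fdom) tH.
have e4 : (0 < e / 4)%R by rewrite divr_gt0.
have [u uA fin] := fdom.
have t4 : (0 < t / 4)%R by rewrite divr_gt0.
(* Within [F] the bottom piece exceeds e / 4 on measure at most t / 4 once its height is at most
   [d]; this determines [N] and makes the chain finite. *)
have [d d0 hd] := tail_small phi_adm hp0 hT hbound uA fin mF Ffin e4 t4.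
have [N aN] := a_small d d0.
have {hd} hd := hd (a N) (a0 N) aN.
set g := (fun x => f x - trunc_at (a 0%N) (f x))%R in LA.
pose h k := (fun x => trunc_at (a k) (f x) - trunc_at (a k.+1) (f x))%R.
set w := (fun x => trunc_at (a N) (f x)) in hd.
have mtr k : measurable_fun setT (fun x => trunc_at (a k) (f x)) by exact:
  measurable_trunc_at.
have mh k : measurable_fun setT (h k) by exact: measurable_funB.
have gdom : A1_domain alpha p0 g.
  apply: (A1_domain_le hp0 fdom); first exact: measurable_funB.
  by move=> x; exact: sub_trunc_at_le.
have hdom k : A1_domain alpha p0 (h k).
  by apply: (A1_domain_le hp0 fdom) => // x; exact: trunc_at_diff_le_id.
have wdom : A1_domain alpha p0 w.
  by apply: (A1_domain_le hp0 fdom); [exact: mtr|move=> x; exact: trunc_at_le_id].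
have Hg := first_part_small gdom t0 A0 e4 LA.
rewrite -/A' in Hg.
set Sg := [set x | _] in Hg; set Sw := [set x | _] in hd.
have mSg : measurable Sg by exact: mlev.
have mSw : measurable Sw by exact: mlev.
pose F' := (F `\` Sg) `\` (F `&` Sw).
have mF' : measurable F'.
  by apply: measurableD; [exact: measurableD|exact: measurableI].
have F'F : F' `<=` F by move=> x [[]].
have F'fin : mu F' < +oo.
  by apply: le_lt_trans Ffin; apply: le_measure; rewrite ?inE.
pose tau := fine (mu F').
have tauE : mu F' = tau%:E by rewrite fineK// ge0_fin_numE.
have tau_ge : (t / 2 <= tau)%R.
  have : mu F <= mu F' + (t / 4 + t / 4)%:E.
    apply: (@le_trans _ _ (mu F' + (mu Sg + mu (F `&` Sw)))).
      apply: (@le_trans _ _ (mu (F' `|` (Sg `|` (F `&` Sw))))).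
        apply: le_measure; rewrite ?inE//.
          by apply: measurableU => //; apply: measurableU => //; exact: measurableI.
        move=> x Fx; have [h1|h1] := pselect (Sg x); first by right; left.
        by have [h2|h2] := pselect (Sw x); [right; right|left; split => // -[]].
      have mU : measurable (Sg `|` (F `&` Sw)) by apply: measurableU => //;
        exact: measurableI.
      apply: le_trans (measureU2 _ _ _) _ => //; apply: leeD => //.
      by apply: measureU2 => //; exact: measurableI.
    by apply: leeD => //; rewrite EFinD; exact: leeD.
  move=> /(lt_le_trans tF); rewrite tauE -EFinD lte_fin; lra.
have tau0 : (0 < tau)%R by lra.
have chain := sublinear_trunc_chain hp0 hT N fdom a0 aS.
have mTh k : measurable_fun setT (T (h k)) := Tmeas _ (hdom k).
have mTh' k : measurable_fun F' (fun x => `|T (h k) x|).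
  by apply: measurable_funTS; exact: measurableT_comp.
have low : \int[mu]_(x in F') (cst (C * B + e / 2)%:E) x <=
    \int[mu]_(x in F') \sum_(0 <= k < N) `|T (h k) x|.
  apply: ae_ge0_le_integral => //.
  - by move=> x _; rewrite lee_fin addr_ge0 ?divr_ge0 ?(ltW e0)// mulr_ge0// ltW.
  - by move=> x _; apply: sume_ge0.
  - by apply: emeasurable_sum.
  move: chain; apply: filterS => x hx F'x.
  have [[Fx /negP nSg] nSw] := F'x.
  have Ye : (Y + e)%:E < `|T f x| by exact: FH.
  have Tg : `|T g x| <= (A' + e / 4)%:E by rewrite leNgt; exact: nSg.
  have Tw : `|T w x| <= (e / 4)%:E by rewrite leNgt; apply/negP => Sx; apply: nSw.
  have : (Y + e)%:E <= (A' + e / 4)%:E + \sum_(0 <= k < N) `|T (h k) x| + (e / 4)%:E.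
    apply: le_trans (ltW Ye) _; apply: le_trans hx _.
    by apply: leeD => //; apply: leeD.
  rewrite addeAC -EFinD -leeBlDl// -EFinB; apply: le_trans.
  by rewrite lee_fin /Y; lra.
have up : \int[mu]_(x in F') \sum_(0 <= k < N) `|T (h k) x| <= (C * B * tau)%:E.
  rewrite ge0_integral_sum//.
  apply: (@le_trans _ _ (\sum_(0 <= k < N) (C * tau * (a k * gr (2 * (s k.+1 /
    t))))%:E)).
    apply: lee_sum => k _.
    have l0 : (0 < s k.+1)%R by apply: lt_le_trans (st _).
    (* The piece is bounded by [a k] and lives where |f| > a k.+1, a set of measure at most s
       k.+1. *)
    have hb x : (`|h k x| <= a k)%R by exact: trunc_at_diff_le.
    have hs x : h k x != 0%R -> [set x | (a k.+1 < `|f x|)%R] x.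
      by exact: trunc_at_diff_neq0.
    have hm := measure_gt_rearrangement mf (sa k.+1).
    apply: le_trans (HC (h k) (a k) (s k.+1) tau _ F' (mh k) (a0 k) l0 tau0 hb hs
      (measurable_norm_gt mf _) hm (mTh k) mF' tauE) _.
    rewrite lee_fin -!mulrA; apply: ler_wpM2l; first exact: ltW.
    rewrite mulrCA; apply: ler_wpM2l; first exact: ltW.
    apply: ler_wpM2l => //; apply: growth_le => //.
    rewrite mulrCA; apply: ler_wpM2l; first exact: ltW.
    rewrite -[leRHS]invrK lef_pV2 ?posrE ?invr_gt0 ?mulr_gt0 ?invr_gt0//.
    by rewrite invfM invrK mulrC.
  rewrite sumEFin lee_fin -mulr_sumr mulrAC.
  by rewrite -!mulrA; apply: ler_wpM2l; [exact: ltW|rewrite mulrC [leRHS]mulrC;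
    apply: ler_wpM2l; [exact: ltW|exact: SB]].
have := le_trans low up; rewrite integral_cst// [X in _ * X <= _]tauE -EFinM lee_fin.
rewrite ler_pM2r//; lra.
Qed.

End CoreEstimate.

(** * Sums of integrals over disjoint blocks *)

Section BlockIntegrals.
Variable R : realType.
Local Notation lam := (@lebesgue_measure R).

Lemma sum_integral_le d (S : measurableType d) (mu : {measure set S -> \bar R})
    (D : set S) (J : nat -> set S) (g : nat -> S -> \bar R) (F : S -> \bar R) :
  measurable D -> (forall k, measurable (J k)) -> (forall k, J k `<=` D) ->
  trivIset setT J -> (forall k, measurable_fun (J k) (g k)) ->
  (forall k x, J k x -> 0 <= g k x) -> (forall k x, J k x -> g k x <= F x) ->
  (forall x, D x -> 0 <= F x) ->
  \sum_(0 <= k <oo) \int[mu]_(x in J k) g k x <= \int[mu]_(x in D) F x.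
Proof.
move=> mD mJ JD tJ mg g0 gF F0.
have gp0 k x : 0 <= ((g k) \_ (J k)) x.
  by rewrite patchE; case: ifPn => // /set_mem; exact: g0.
rewrite (eq_eseriesr (g := fun k => \int[mu]_(x in D) ((g k) \_ (J k)) x));
  last first.
  move=> k _; rewrite [RHS]integral_mkcond [LHS]integral_mkcond.
  apply: eq_integral => x _; rewrite !patchE; case: ifPn => [/set_mem/JD Dx|_].
    by rewrite mem_set.
  by case: ifPn.
rewrite -integral_nneseries//; last first.
  move=> k; apply/(measurable_restrict _ (mJ k) mD).
  exact: measurable_funS (@subIsetr _ _ _) (mg k).
apply: ge0_le_integral_nomeas => x Dx; first by apply: nneseries_ge0.
apply: lime_le; first by apply: is_cvg_nneseries => k _ _.
near=> N.
have [[k [kN Jk]]|H] := pselect (exists k, (k < N)%N /\ J k x).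
  rewrite (big_rem k)/=; last by rewrite mem_index_iota.
  rewrite big1_seq => [|j /andP[_ jk]].
    by rewrite adde0 patchE mem_set//; exact: gF.
  rewrite patchE; case: ifPn => // /set_mem Jj.
  have jk' : j = k by apply: (tJ j k I I); exists x.
  by move: jk; rewrite jk' mem_rem_uniq ?iota_uniq// inE eqxx.
rewrite big1_seq ?F0// => j /andP[_]; rewrite mem_index_iota => /andP[_ jN].
rewrite patchE; case: ifPn => // /set_mem Jj; exfalso; apply: H; by exists j.
Unshelve. all: by end_near.
Qed.

Lemma trivIset_itvoo (s : nat -> R) : (forall k, (s k <= s k.+1)%R) ->
  trivIset setT (fun k => [set` `]s k, s k.+1[ ] : set R).
Proof.
move=> sS; have sm i j : (i <= j)%N -> (s i <= s j)%R.
  by move=> /subnKC <-; elim: (j - i)%N => [|m IH];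
    rewrite ?addn0// addnS (le_trans IH).
move=> i j _ _ [x [/=]]; rewrite !in_itv/= => /andP[x1 x2] /andP[x3 x4].
apply/eqP; rewrite eqn_leq; apply/andP; split; rewrite leqNgt; apply/negP => ij.
  by have := sm _ _ ij; lra.
by have := sm _ _ ij; lra.
Qed.

Lemma integral_powRN1 (a b : R) : (0 < a)%R -> (a < b)%R ->
  \int[lam]_(x in `]a, b[) (x `^ (-1))%:E = (ln b - ln a)%:E.
Proof.
move=> a0 ab.
have mp : measurable_fun setT (fun x : R => (x `^ (-1))%:E).
  by apply/measurable_EFinP; exact: measurable_powR.
rewrite -(integral_itv_bndoo true false); last exact: measurable_funTS.
have ln_d (x : R) : (0 < x)%R -> derivable (@ln R) x 1.
  by move=> x0; have [] := is_derive1_ln x0.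
have lnc (x : R) : (0 < x)%R -> {for x, continuous (@ln R)} by exact: continuous_ln.
rewrite (@continuous_FTC2 R (fun x => x `^ (-1))%R (@ln R) a b ab)//.
- apply: derivable_within_continuous => x; rewrite in_itv/= => /andP[ax _].
  apply: derivable_powR; rewrite in_itv/= andbT; lra.
- split.
  + by move=> x; rewrite in_itv/= => /andP[ax _]; apply: ln_d; lra.
  + by apply: cvg_at_right_filter; exact: lnc.
  + by apply: cvg_at_left_filter; apply: lnc; lra.
- move=> x; rewrite in_itv/= => /andP[ax _].
  have x0 : (0 < x)%R by lra.
  by rewrite derive1E; have [_ ->] := is_derive1_ln x0; rewrite powR_inv1// ltW.
Qed.

Lemma integral_cst_itvoo (a b : R) (m : R) : (a <= b)%R ->
  \int[lam]_(x in `]a, b[) m%:E = (m * (b - a))%:E.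
Proof.
move=> ab; rewrite (_ : (fun=> m%:E) = cst m%:E)// integral_cst//.
rewrite [X in _ * X]lebesgue_measure_itv/= lte_fin; case: ltP => h;
  first by rewrite -EFinB -EFinM.
have -> : b = a by apply/le_anti; rewrite h ab.
by rewrite subrr mulr0 mule0.
Qed.

End BlockIntegrals.

(** * The first integral and the top piece of f *)

Section FirstPart.
Variables (R : realType) (n : nat) (p0 : R).
Hypothesis hp0 : (1 <= p0)%R.
Local Notation mu := (@leb R n).
Local Notation lam := (@lebesgue_measure R).
Variable f : Rn R n -> R.
Hypothesis mf : measurable_fun setT f.
Local Notation fs := (rearrangement mu (EFin \o f)).

Let p00 : (0 < p0)%R := lt_le_trans ltr01 hp0.
Let pinv1 : (p0^-1 <= 1)%R.
Proof. by rewrite invf_le1. Qed.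

(** As p0 >= 1, both factors of the integrand are nonincreasing. On the block from 2^-(k + 1) t to
    2^-k t, of length 2^-k t / 2, the integrand is at least its value at the right end. *)
Lemma dyadic_sum_le_integral (t : R) : (0 < t)%R ->
  \sum_(0 <= k <oo) (fs (2 ^- k * t) * (((2 ^- k * t) `^ p0^-1 / 2)%R)%:E) <=
  \int[lam]_(s in `]0%R, t[) (fs s * (1 / s `^ (1 - 1 / p0))%:E).
Proof.
move=> t0.
have e0 k : (0 < 2 ^- k * t :> R)%R by rewrite mulr_gt0// invr_gt0 exprn_gt0.
have eS k : (2 ^- k.+1 * t = 2 ^- k * t / 2 :> R)%R by rewrite exprS invfM; ring.
have et k : (2 ^- k * t <= t :> R)%R.
  by rewrite ler_piMl ?(ltW t0)// invf_le1 ?exprn_gt0// exprn_ege1// ler1n.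
pose J k : set R := [set` `]2 ^- k.+1 * t, 2 ^- k * t[ ]%R.
have mJ k : measurable (J k) by exact: measurable_itv.
pose m k := fs (2 ^- k * t) * ((2 ^- k * t) `^ (p0^-1 - 1))%:E.
apply: le_trans (@sum_integral_le R _ _ lam [set` `]0%R, t[ ] J (fun k => cst (m
  k)) _ _ mJ _ _ _ _ _ _).
- apply: lee_nneseries => k _.
    by move=> _; rewrite mule_ge0 ?rearrangement_ge0// lee_fin divr_ge0// powR_ge0.
  have hl : lam (J k) = (2 ^- k * t / 2)%:E.
    rewrite lebesgue_measure_itv/= lte_fin eS ifT; last first.
      by have := e0 k; lra.
    by rewrite -EFinB; congr _%:E; field.
  have hi : \int[lam]_(x in J k) cst (m k) x = m k * (2 ^- k * t / 2)%:E.
    by rewrite integral_cst; [rewrite -hl|exact: mJ].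
  apply: (@le_trans _ _ (m k * (2 ^- k * t / 2)%:E)); last by rewrite -hi.
  rewrite /m -muleA -EFinM; apply: lee_wpmul2l; first exact: rearrangement_ge0.
  rewrite lee_fin mulrA [X in (_ <= X / 2)%R]mulrC mulr_powRB1 ?(ltW (e0 k))//
    invr_gt0.
  exact: p00.
- exact: measurable_itv.
- move=> k x /=; rewrite !in_itv/= => /andP[h1 h2]; apply/andP; split.
    by apply: lt_trans h1.
  by apply: lt_le_trans h2 (et k).
- have sm i j : (i <= j)%N -> (2 ^- j * t <= 2 ^- i * t :> R)%R.
    move=> ij; rewrite ler_pM2r// lef_pV2 ?posrE ?exprn_gt0//.
    by rewrite ler_weXn2l// ler1n.
  move=> i j _ _ [x [/=]]; rewrite /J/= !in_itv/= => /andP[x1 x2] /andP[x3 x4].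
  apply/eqP; rewrite eqn_leq; apply/andP; split; rewrite leqNgt; apply/negP => ij.
    by have := sm _ _ ij; lra.
  by have := sm _ _ ij; lra.
- by move=> k; exact: measurable_cst.
- by move=> k x _ /=; rewrite mule_ge0 ?rearrangement_ge0// lee_fin powR_ge0.
- move=> k x; rewrite /J/= in_itv/= => /andP[h1 h2].
  have x0 : (0 < x)%R by apply: lt_trans h1.
  apply: lee_pmul; rewrite ?rearrangement_ge0 ?lee_fin ?powR_ge0//.
    by apply: rearrangement_le; exact: ltW.
  rewrite -[(p0^-1 - 1)%R]opprB powRN !div1r lef_pV2 ?posrE ?powR_gt0//.
  by apply: ge0_ler_powR;
    rewrite ?nnegrE ?(ltW x0) ?(ltW (e0 k)) ?(ltW h2)// subr_ge0.
- by move=> x _; rewrite mule_ge0 ?rearrangement_ge0// lee_fin divr_ge0// powR_ge0.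
Qed.

(** The term k = 0 of the dyadic sum is enough. *)
Lemma rearrangement_le_integral (t : R) : (0 < t)%R ->
  fs t <= (2 / t `^ p0^-1)%:E *
   \int[lam]_(s in `]0%R, t[) (fs s * (1 / s `^ (1 - 1 / p0))%:E).
Proof.
move=> t0; have tp : (0 < t `^ p0^-1)%R by rewrite powR_gt0.
apply: le_trans (lee_wpmul2l _ (dyadic_sum_le_integral t0)); last first.
  by rewrite lee_fin divr_ge0// ltW.
apply: le_trans (lee_wpmul2l _ (nneseries_lim_ge 1 _)).
- rewrite big_nat1 expr0 invr1 mul1r muleCA -EFinM.
  rewrite (_ : (2 / _ * _)%R = 1%R) ?mule1//.
  by field; rewrite gt_eqF.
- by rewrite lee_fin divr_ge0// ltW.
- by move=> k _ _; rewrite mule_ge0 ?rearrangement_ge0// lee_fin divr_ge0// powR_ge0.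
Qed.

(** For z > 0 let m be the measure of the set where the top piece exceeds z; it is at most t. If
    2^-(k + 1) t < m <= 2^-k t, then z is at most f^* at 2^-(k + 1) t. So m^(1 / p0) is at most the
    sum over k of (2^-k t)^(1 / p0) times the indicator of [E k], and integrating in z gives the
    dyadic sum shifted by one index. *)
Lemma lorentz1_first_part (t a : R) : (0 < t)%R -> fs t = a%:E ->
  lorentz1 mu p0 (EFin \o (fun x => f x - trunc_at a (f x))%R) <=
  4%:E * \int[lam]_(s in `]0%R, t[) (fs s * (1 / s `^ (1 - 1 / p0))%:E).
Proof.
move=> t0 fa.
have a0 : (0 <= a)%R by rewrite -lee_fin -fa rearrangement_ge0.
set g := (fun x => _)%R.
have mg : measurable_fun setT g by apply: measurable_funB => //;
  exact: measurable_trunc_at.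
have e0 k : (0 < 2 ^- k * t :> R)%R by rewrite mulr_gt0// invr_gt0 exprn_gt0.
have eS k : (2 ^- k.+1 * t = 2 ^- k * t / 2 :> R)%R by rewrite exprS invfM; ring.
apply: le_trans (lee_wpmul2l _ (dyadic_sum_le_integral t0)); last by [].
pose E k : set R := [set z | (0 < z)%R /\ z%:E <= fs (2 ^- k.+1 * t)].
have mE k : measurable (E k).
  apply: is_interval_measurable => x y /= [x0 _] [_ hy] z /andP[xz zy].
  by split; [exact: lt_le_trans xz|apply: le_trans hy; rewrite lee_fin].
have lE k : lam (E k) <= fs (2 ^- k.+1 * t).
  have := rearrangement_ge0 f (2 ^- k.+1 * t)%R.
  rewrite le_eqVlt => /orP[/eqP h0|].
    rewrite (_ : E k = set0) ?measure0 ?rearrangement_ge0//.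
    apply/seteqP; split => // z [z0]; rewrite -h0 lee_fin; lra.
  case fE : (fs _) => [r| |]; rewrite ?leey//.
  rewrite lte_fin => r0; apply: (@le_trans _ _ (lam [set` `]0%R, r] ])).
    apply: le_measure; rewrite ?inE; [exact: mE|exact: measurable_itv|].
    by move=> z [z0]; rewrite fE lee_fin /= in_itv/= => ->; rewrite z0.
  by rewrite lebesgue_measure_itv/= lte_fin r0 sube0.
apply: (@le_trans _ _ (\int[lam]_(z in `]0%R, +oo[)
   \sum_(0 <= k <oo) (((2 ^- k * t) `^ p0^-1)%:E * (\1_(E k) z)%:E))).
  apply: ge0_le_integral_nomeas => z /=; first by move=> _; exact: poweR_ge0.
  rewrite in_itv/= andbT => z0; rewrite distr_funE.
  have T0 k : 0 <= ((2 ^- k * t) `^ p0^-1)%:E * (\1_(E k) z)%:E :> \bar R.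
    by rewrite mule_ge0// lee_fin powR_ge0.
  set G := [set x | _].
  have mG : measurable G by exact: measurable_norm_gt.
  have Gt : mu G <= t%:E.
    apply: le_trans (measure_gt_rearrangement mf fa).
    apply: le_measure; rewrite ?inE//; first exact: measurable_norm_gt.
    move=> x /= h; apply: sub_trunc_at_neq0 => //.
    apply/eqP => h'; have gx0 : g x = 0%R := h'.
    by have : (z < `|g x|)%R := h; rewrite gx0 normr0; lra.
  have Gfin : mu G \is a fin_num by rewrite ge0_fin_numE// (le_lt_trans Gt)// ltry.
  pose m := fine (mu G); have mE' : mu G = m%:E by rewrite fineK.
  have m0 : (0 <= m)%R by rewrite -lee_fin -mE'.
  have mt : (m <= t)%R by rewrite -lee_fin -mE'.
  rewrite mE' poweR_EFin.
  have [mz|mz] := eqVneq m 0%R.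
    by rewrite mz powR0 ?invr_eq0 ?gt_eqF//; apply: nneseries_ge0.
  have mp : (0 < m)%R by rewrite lt_neqAle eq_sym mz.
  have exk : exists k, (2 ^- k * t < m)%R.
    exists (Num.bound (t / m)).
    have h := archi_boundP (divr_ge0 (ltW t0) m0).
    rewrite mulrC ltr_pdivrMr ?exprn_gt0// -ltr_pdivrMl// mulrC.
    by apply: lt_trans h _; rewrite -natrX ltr_nat ltn_expl.
  case: (ex_minnP exk) => -[|k] hk kmin.
    by exfalso; move: hk; rewrite expr0 invr1 mul1r; lra.
  have mk : (m <= 2 ^- k * t)%R.
    by rewrite leNgt; apply/negP => /kmin; rewrite ltnn.
  apply: le_trans (nneseries_lim_ge k.+1 _) => //.
  rewrite big_nat_recr//= indicE mem_set/=; last first.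
    split => //; apply: rearrangement_ge => //.
    apply: (@lt_le_trans _ _ (mu G)); first by rewrite mE' lte_fin.
    apply: le_measure; rewrite ?inE//; first exact: measurable_norm_gt.
    by move=> x /= h; apply: lt_le_trans (sub_trunc_at_le (f x) a0).
  rewrite mule1 -[leLHS]add0e; apply: leeD; first exact: sume_ge0.
  by rewrite lee_fin; apply: ge0_ler_powR;
    rewrite ?nnegrE ?invr_ge0 ?(ltW p00) ?(ltW (e0 k)).
rewrite integral_nneseries//; last first.
- by move=> k z _; rewrite mule_ge0// lee_fin powR_ge0.
- move=> k; apply: measurable_funeM; apply: measurable_funTS.
  apply/measurable_EFinP; apply: measurable_indic; exact: mE.
rewrite -nneseriesZl; last first.
  by move=> k _; rewrite mule_ge0 ?rearrangement_ge0// lee_fin divr_ge0// powR_ge0.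
apply: le_trans (nneseries_shift_le (t := fun k => 4%:E * (fs (2 ^- k * t) * ((2
  ^- k * t) `^ p0^-1 / 2)%:E)) _); last first.
  by move=> k; rewrite !mule_ge0 ?rearrangement_ge0// lee_fin divr_ge0// powR_ge0.
apply: lee_nneseries => k _.
  by move=> _; apply: integral_ge0 => z _; rewrite mule_ge0// lee_fin powR_ge0.
rewrite ge0_integralZl//; first last.
- by rewrite lee_fin powR_ge0.
- apply: measurable_funTS; apply/measurable_EFinP; apply: measurable_indic;
  exact: mE.
rewrite [leRHS](_ : _ = fs (2 ^- k.+1 * t) * (4 * ((2 ^- k.+1 * t) `^ p0^-1 /
  2))%:E); last first.
  by rewrite muleCA -EFinM.
rewrite integral_indic; [|exact: measurable_itv|exact: mE].
apply: (@le_trans _ _ (((2 ^- k * t) `^ p0^-1)%:E * fs (2 ^- k.+1 * t))).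
  apply: lee_wpmul2l; first by rewrite lee_fin powR_ge0.
  apply: le_trans (lE k); apply: le_measure; rewrite ?inE.
  - by apply: measurableI; [exact: mE|exact: measurable_itv].
  - exact: mE.
  - exact: subIsetl.
rewrite muleC; apply: lee_wpmul2l; first exact: rearrangement_ge0.
rewrite lee_fin eS [X in (_ <= _ * (X / _))%R]powRM ?(ltW (e0 k)) ?invr_ge0//.
set P := ((2 ^- k * t) `^ p0^-1)%R.
have P0 : (0 <= P)%R by exact: powR_ge0.
(* That is 2^(1 / p0) <= 2. The shift of index costs 2 and the halves in the dyadic sum another 2,
   whence the constant 4. *)
have h2 : (2^-1 <= 2^-1 `^ p0^-1 :> R)%R.
  by apply: ger1_powR => //; rewrite invr_gt0 invf_le1// ler1n ltr0n.
have : (P * 2^-1 <= P * 2^-1 `^ p0^-1)%R by exact: ler_wpM2l.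
lra.
Qed.

End FirstPart.

(** * Blocks adapted to the second kernel *)

Section Blocks.
Variables (R : realType) (phi : \bar R -> \bar R).
Hypothesis phi_adm : admissible phi.
Variables (alpha p0 : R).
Hypotheses (halpha : (0 < alpha <= 1)%R) (hp0 : (1 <= p0)%R).
Local Notation lam := (@lebesgue_measure R).
Local Notation gr := (growth phi alpha p0).
Local Notation kappa := ((1 - alpha) / p0)%R.
Local Notation g := (fun x => fine (phi x%:E)).

Let p00 : (0 < p0)%R := lt_le_trans ltr01 hp0.

(* [w k] minorizes the kernel of the second integral on the [k]-th block, and its
   integral there dominates the cost of the piece between [s k.+1] and [s k.+2]. *)
Definition blocks (c t : R) (s : nat -> R) : Prop :=
  [/\ s 0%N = t, forall k, (s k <= s k.+1)%R, (gr (2 * (s 1%N / t)) <= c)%R &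
  exists w : nat -> R -> R,
  [/\ forall k, measurable_fun setT (w k),
    forall k x, (s k < x < s k.+1)%R -> (0 <= w k x)%R,
    forall k x, (s k < x < s k.+1)%R ->
      (w k x <= fine (phi_tilde phi alpha p0 (1 + ln (x / t))) *
         (1 / x `^ (1 - kappa)))%R &
    forall k, (gr (2 * (s k.+2 / t)))%:E <=
      (c / t `^ kappa)%:E * \int[lam]_(x in `]s k, s k.+1[) (w k x)%:E]].

Lemma phi_tilde_fin x : (1 <= x)%R ->
  phi_tilde phi alpha p0 x = (fine (phi_tilde phi alpha p0 x))%:E /\
  (0 <= fine (phi_tilde phi alpha p0 x))%R.
Proof.
move=> x1; rewrite /phi_tilde; case: ifPn => _.
  have [al0 al1] := andP halpha.
  have h : (1 <= x `^ (p0 / alpha))%R.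
    apply: (le_trans x1); apply: le1r_powR => //.
    by rewrite ler_pdivlMr// mul1r (le_trans al1 hp0).
  split; first exact: (admissible_fin phi_adm).
  exact: le_trans ler01 (admissible_ge1 phi_adm h).
rewrite (admissible_fin phi_adm x1) -EFinM; split => //=.
rewrite mulr_ge0 ?invr_ge0 ?(le_trans ler01 x1)//.
exact: le_trans ler01 (admissible_ge1 phi_adm x1).
Qed.

Lemma exists_blocks_lt1 : (alpha < 1)%R -> exists2 c : R, (0 < c)%R &
  forall t, (0 < t)%R -> exists s, blocks c t s.
Proof.
move=> al1; have [al0 _] := andP halpha.
have [K [q [K1 /andP[q0 q2] Hdy]]] := growth_dyadic phi_adm halpha hp0.
have /andP[k0 k1] := kappa_ge0_lt1 halpha hp0.
have K0 : (0 < K)%R := lt_le_trans ltr01 K1.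
have Hdy' j r : (gr (2 ^+ j * r) <= K * 2 ^+ j * gr r)%R.
  apply: le_trans (Hdy _ _) _; apply: ler_wpM2r.
    by apply: le_trans (growth_ge1 phi_adm halpha hp0 r).
  by apply: ler_wpM2l; rewrite ?(ltW K0)// lerXn2r ?nnegrE ?(ltW q0) ?(ltW q2).
have ln2 : (0 <= ln 2 :> R)%R by rewrite ln_ge0// ler1n.
(* As 2 s_(k + 2) / t = 2^(k + 3), [growth] there is at most 8 K times its value at 2^k. Another 2
   comes from the length of a block, which is half of its right end. *)
exists (16 * K)%R; first by rewrite mulr_gt0.
move=> t t0; exists (fun k => 2 ^+ k * t)%R; split.
- by rewrite expr0 mul1r.
- by move=> k; rewrite ler_pM2r// ler_weXn2l// ler1n.
- rewrite mulfK ?gt_eqF// -exprS -[X in gr X]mulr1.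
  apply: le_trans (Hdy' _ _) _.
  have -> : gr 1 = 1%R.
    by rewrite /growth maxxx powR1 ln1 addr0 mul1r; case: phi_adm => _ ->.
  by rewrite mulr1 expr2; lra.
have e0 k : (0 < 2 ^+ k * t)%R by rewrite mulr_gt0// exprn_gt0.
have gk k : (1 <= 1 + k%:R * ln 2 :> R)%R by rewrite lerDl mulr_ge0.
have gk0 k : (0 <= g (1 + k%:R * ln 2)%R)%R by apply: le_trans (admissible_ge1
  phi_adm (gk k)).
(* phi is least at the left end of the block, the power at the right end. *)
pose m k := (g (1 + k%:R * ln 2)%R * (2 ^+ k.+1 * t) `^ (kappa - 1))%R.
have m0 k : (0 <= m k)%R by rewrite mulr_ge0// powR_ge0.
exists (fun k => cst (m k)); split.
- by move=> k; exact: measurable_cst.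
- by move=> k x _; exact: m0.
- move=> k x /andP[h1 h2] /=.
  have x0 : (0 < x)%R by apply: lt_trans h1.
  have xt : (2 ^+ k <= x / t)%R by rewrite ler_pdivlMr// ltW.
  have xt0 : (0 < x / t)%R by rewrite divr_gt0.
  have lx : (1 + k%:R * ln 2 <= 1 + ln (x / t))%R.
    rewrite lerD2l mulr_natl -lnXn// ler_ln ?posrE// exprn_gt0//.
  apply: ler_pM => //; first exact: powR_ge0.
    rewrite /phi_tilde al1; apply: admissible_le => //.
    apply: (le_trans lx); apply: le1r_powR; first by apply: le_trans (gk k) lx.
    by rewrite ler_pdivlMr// mul1r; apply: le_trans hp0; exact: ltW.
  rewrite div1r -[(kappa - 1)%R]opprB powRN lef_pV2 ?posrE ?powR_gt0//.
  by apply: ge0_ler_powR;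
    rewrite ?nnegrE ?(ltW x0) ?(ltW (e0 _)) ?(ltW h2)// subr_ge0 ltW.
move=> k.
rewrite integral_cst_itvoo; last by rewrite ler_pM2r// ler_weXn2l// ler1n.
rewrite -EFinM lee_fin mulfK ?gt_eqF// -exprS.
have -> : (2 ^+ k.+3 = 2 ^+ 3 * 2 ^+ k :> R)%R by rewrite -exprD.
apply: le_trans (Hdy' _ _) _.
have e2 : (0 < 2 ^+ k :> R)%R by rewrite exprn_gt0.
have grE : gr (2 ^+ k) = ((2 ^+ k) `^ kappa * g (1 + k%:R * ln 2)%R)%R.
  rewrite /growth max_r ?exprn_ege1 ?ler1n//.
  by rewrite lnXn// mulr_natl.
have -> : (2 ^+ k.+1 * t - 2 ^+ k * t = 2 ^+ k.+1 * t / 2 :> R)%R.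
  by rewrite exprS; field.
have -> : (m k * (2 ^+ k.+1 * t / 2) =
   g (1 + k%:R * ln 2)%R * ((2 ^+ k.+1) `^ kappa * t `^ kappa) / 2)%R.
  rewrite -powRM ?(ltW t0) ?exprn_ge0// /m -[X in (_ = _ * X / 2)%R](mulr_powRB1
    (ltW (e0 _))).
    by ring.
  by rewrite divr_gt0 ?subr_gt0.
have tk : (0 < t `^ kappa)%R by rewrite powR_gt0.
rewrite grE.
have h : ((2 ^+ k) `^ kappa <= (2 ^+ k.+1) `^ kappa :> R)%R.
  by apply: ge0_ler_powR; rewrite ?nnegrE ?exprn_ge0// ler_weXn2l// ler1n.
set a := ((2 ^+ k) `^ kappa)%R in h *; set b := ((2 ^+ k.+1) `^ kappa)%R in h *.
set z := (t `^ kappa)%R in tk *; set G := fine _.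
have -> : (16 * K / z * (G * (b * z) / 2) = 8 * K * G * b)%R by field;
  rewrite gt_eqF.
have -> : (K * 2 ^+ 3 * (a * G) = 8 * K * G * a)%R by ring.
by apply: ler_wpM2l => //; rewrite !mulr_ge0// ?(ltW K0)//; exact: gk0.
Qed.

Lemma exists_blocks_eq1 : alpha = 1%R -> exists2 c : R, (0 < c)%R &
  forall t, (0 < t)%R -> exists s, blocks c t s.
Proof.
move=> al1.
have [K [b [K1 b0 Hdil]]] := admissible_dilation phi_adm.
have K0 : (0 < K)%R := lt_le_trans ltr01 K1.
have kE : kappa = 0%R by rewrite al1 subrr mul0r.
have ln2 : (ln 2 <= 2 :> R)%R by rewrite ltW// ln_sublinear.
have ln20 : (0 <= ln 2 :> R)%R by rewrite ln_ge0// ler1n.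
(* The 2 makes up for the half in the integral of the minorant. The factor 8^b is the cost of
   enlarging the argument of phi from 2^k to ln 2 + 2^(k + 2), which is at most 8 times 2^k. *)
pose c : R := (2 * (K * 8 `^ b))%R.
have c0 : (0 < c)%R by rewrite !mulr_gt0// powR_gt0.
have e1 k : (1 <= 2 ^+ k :> R)%R by rewrite exprn_ege1// ler1n.
have grE (k : nat) : (gr (2 * expR (2 ^+ k.+2 - 1)) <= c / 2 * g (2 ^+ k)%R)%R.
  have E1 : (1 <= expR (2 ^+ k.+2 - 1) :> R)%R.
    by apply: le_trans (expR_ge1Dx _); have := e1 k.+2; lra.
  rewrite /growth kE powRr0 mul1r max_r; last by lra.
  rewrite lnM ?posrE ?expR_gt0// expRK.
  apply: (@le_trans _ _ (g (8 * 2 ^+ k)%R)).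
    apply: admissible_le => //; first by have := e1 k.+2; lra.
    by rewrite !exprS; have := e1 k; lra.
  apply: le_trans (Hdil _ _ _ (e1 k)) _; first by rewrite ler1n.
  by rewrite (_ : c / 2 = K * 8 `^ b)%R// /c; field.
exists c => // t t0; exists (fun k => t * expR (2 ^+ k - 1))%R.
have sE k : (t * expR (2 ^+ k - 1) / t = expR (2 ^+ k - 1) :> R)%R.
  by rewrite mulrAC divff ?gt_eqF// mul1r.
have s0 k : (0 < t * expR (2 ^+ k - 1))%R by rewrite mulr_gt0// expR_gt0.
have eS k : (2 ^+ k < 2 ^+ k.+1 :> R)%R by rewrite ltr_eXn2l// ltr1n.
have sS k : (t * expR (2 ^+ k - 1) < t * expR (2 ^+ k.+1 - 1))%R.
  by rewrite ltr_pM2l// ltr_expR ltrD2r.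
split.
- by rewrite expr0 subrr expR0 mulr1.
- by move=> k; exact: ltW.
- rewrite sE; apply: le_trans (le_trans (grE 0%N) _).
    apply: growth_le => //; rewrite ler_pM2l// ler_expR lerD2r ltW//.
  rewrite expr0; case: (phi_adm) => _ -> _ _ _; rewrite /= mulr1; lra.
(* On the k-th block 1 + ln (x / t) runs from 2^k to 2^(k + 1): phi is least at the left end and the
   reciprocal at the right one. The factor 1 / x is kept and integrated exactly. *)
pose m k : R := (g (2 ^+ k)%R / 2 ^+ k.+1)%R.
have gk0 k : (0 <= g (2 ^+ k)%R)%R by apply: le_trans (admissible_ge1 phi_adm (e1
  k)).
have m0 k : (0 <= m k)%R by rewrite divr_ge0// exprn_ge0.
exists (fun k x => m k * x `^ (-1))%R; split.
- by move=> k; apply: measurable_funM => //; exact: measurable_powR.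
- by move=> k x _; rewrite mulr_ge0 ?powR_ge0.
- move=> k x /andP[h1 h2].
  have x0 : (0 < x)%R by apply: lt_trans h1.
  have xt0 : (0 < x / t)%R by rewrite divr_gt0.
  have l1 : (2 ^+ k <= 1 + ln (x / t))%R.
    rewrite -lerBlDl -[leLHS](expRK (R := R)) ler_ln ?posrE ?expR_gt0//.
    by rewrite ler_pdivlMr// mulrC ltW.
  have l2 : (1 + ln (x / t) <= 2 ^+ k.+1)%R.
    rewrite -lerBrDl -[leRHS](expRK (R := R)) ler_ln ?posrE ?expR_gt0//.
    by rewrite ler_pdivrMr// mulrC ltW.
  have l0 : (0 < 1 + ln (x / t))%R by have := e1 k; lra.
  apply: ler_pM => //; first exact: powR_ge0.
    rewrite /phi_tilde al1 ltxx (admissible_fin phi_adm); last exact: le_trans l1.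
    rewrite -EFinM /= mulrC; apply: ler_pM => //.
    + exact: admissible_le.
    + by rewrite lef_pV2 ?posrE ?exprn_gt0.
  by rewrite kE subr0 powRr1 ?(ltW x0)// powR_inv1 ?(ltW x0)// div1r.
move=> k; rewrite sE kE powRr0 divr1.
under eq_integral do rewrite EFinM.
have mp : measurable_fun setT (fun x : R => (x `^ (-1))%:E).
  by apply/measurable_EFinP; exact: measurable_powR.
rewrite ge0_integralZl//; first last.
- by rewrite lee_fin.
- by move=> x _; rewrite lee_fin powR_ge0.
- exact: measurable_funTS.
rewrite integral_powRN1// !lnM ?posrE ?expR_gt0// !expRK -!EFinM lee_fin.
apply: le_trans (grE k) _.
have -> : (c * (m k * (ln t + (2 ^+ k.+1 - 1) - (ln t + (2 ^+ k - 1)))) = c / 2 *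
  g (2 ^+ k))%R.
  by rewrite /m exprS; field; rewrite expf_neq0.
by [].
Qed.

Lemma exists_blocks : exists2 c : R, (0 < c)%R &
  forall t, (0 < t)%R -> exists s, blocks c t s.
Proof.
have [_] := andP halpha; rewrite le_eqVlt => /orP[/eqP|].
  exact: exists_blocks_eq1.
exact: exists_blocks_lt1.
Qed.

End Blocks.

Unset Implicit Arguments.
Set Strict Implicit.
Set Printing Implicit Defensive.

Theorem theorem1p9 (R : realType) (n : nat) (hn : (0 < n)%N)
    (phi : \bar R -> \bar R) (hphi : admissible phi)
    (alpha p0 : R) (halpha : (0 < alpha <= 1)%R) (hp0 : (1 <= p0)%R)
    (T : (Rn R n -> R) -> Rn R n -> \bar R)
    (hT : sublinear_on (A1_domain alpha p0) T)
    (hbound : forall u : Rn R n -> R, A1 u ->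
      weak_bounded p0 (fun x => u x `^ alpha)%R T (phi (A1_norm u))) :
  exists2 C : R, (0 < C)%R &
    forall (t : R) (f : Rn R n -> R), (0 < t)%R -> A1_domain alpha p0 f ->
      let fstar := rearrangement (@leb R n) (EFin \o f) in
      rearrangement (@leb R n) (T f) t <=
      C%:E *
      ((1 / t `^ (1 / p0))%:E *
         \int[@lebesgue_measure R]_(s in `]0%R, t[)
           (fstar s * (1 / s `^ (1 - 1 / p0))%:E) +
       (1 / t `^ ((1 - alpha) / p0))%:E *
         \int[@lebesgue_measure R]_(s in `]t, +oo[)
           (phi_tilde phi alpha p0 (1 + ln (s / t)) * fstar s *
            (1 / s `^ (1 - (1 - alpha) / p0))%:E)).
Proof.
have p00 : (0 < p0)%R := lt_le_trans ltr01 hp0.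
have [C1 C10 Hcore] := rearrangement_sum_estimate hphi halpha hp0 hT hbound.
have [c c0 Hblocks] := exists_blocks hphi halpha hp0.
have cC0 : (0 < C1 * c)%R by rewrite mulr_gt0.
(* 16 is the bound 4 on 4^(1 / p0) times the 4 of the top piece; 2 C1 c pays for the first middle
   piece through f^*(t). *)
exists (16 + 2 * (C1 * c))%R; first by lra.
move=> t f t0 fdom; cbv zeta; set fs := rearrangement (@leb R n) (EFin \o f).
have mf := A1_domain_measurable fdom.
pose kappa := ((1 - alpha) / p0)%R.
move E1 : (\int[lebesgue_measure]_(s in `]0%R, t[) _) => I1.
move E2 : (\int[lebesgue_measure]_(s in `]t, +oo[) _) => I2.
have lt_ge0 x : (t < x)%R -> (1 <= 1 + ln (x / t))%R.
  by move=> tx; rewrite lerDl ln_ge0// ler_pdivlMr// mul1r ltW.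
have I1_ge0 : 0 <= I1.
  rewrite -E1; apply: integral_ge0 => x _; rewrite mule_ge0 ?rearrangement_ge0//.
  by rewrite lee_fin divr_ge0// powR_ge0.
have F2_ge0 x : (t < x)%R -> 0 <= phi_tilde phi alpha p0 (1 + ln (x / t)) * fs x *
    (1 / x `^ (1 - (1 - alpha) / p0))%:E.
  move=> tx; have [-> h] := phi_tilde_fin hphi halpha hp0 (lt_ge0 x tx).
  by rewrite !mule_ge0 ?rearrangement_ge0 ?lee_fin// divr_ge0// powR_ge0.
have I2_ge0 : 0 <= I2.
  by rewrite -E2; apply: integral_ge0 => x /=; rewrite in_itv/= andbT; exact: F2_ge0.
have C_gt0 : (0 < 16 + 2 * (C1 * c))%R by lra.
have q1 : (0 < 1 / t `^ (1 / p0))%R by rewrite divr_gt0// powR_gt0.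
have q2 : (0 < 1 / t `^ ((1 - alpha) / p0))%R by rewrite divr_gt0// powR_gt0.
(* If one of the integrals is infinite, so is the right-hand side; afterwards all quantities are
   real. *)
have [I1oo|I1fin] := eqVneq I1 +oo.
  rewrite I1oo gt0_muley ?lte_fin// addye; last first.
    by rewrite gt_eqF// (lt_le_trans ltNy0)// mule_ge0// lee_fin ltW.
  by rewrite gt0_muley ?lte_fin// leey.
have [I2oo|I2fin] := eqVneq I2 +oo.
  rewrite I2oo [X in _ + X]gt0_muley ?lte_fin// addey; last first.
    by rewrite gt_eqF// (lt_le_trans ltNy0)// mule_ge0// lee_fin ltW.
  by rewrite gt0_muley ?lte_fin// leey.
have I1E : I1 = (fine I1)%:E by rewrite fineK// ge0_fin_numE// lt_neqAle I1fin leey.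
have I2E : I2 = (fine I2)%:E by rewrite fineK// ge0_fin_numE// lt_neqAle I2fin leey.
have i1 : (0 <= fine I1)%R by rewrite fine_ge0.
have i2 : (0 <= fine I2)%R by rewrite fine_ge0.
set P1 := (1 / t `^ (1 / p0))%R in q1 *;
  set P2 := (1 / t `^ ((1 - alpha) / p0))%R in q2 *.
have P1E : (P1 = 1 / t `^ p0^-1)%R by rewrite /P1 (div1r p0).
(* Makes the rearrangement finite from t on, so that the cutting heights are real numbers. *)
have fst : fs t <= (2 * P1 * fine I1)%:E.
  apply: le_trans (rearrangement_le_integral hp0 f t0) _.
  by rewrite E1 I1E -EFinM lee_fin P1E div1r.
have [s [s0 sS gr1 [w [mw w0 wle wint]]]] := Hblocks t t0.
have st k : (t <= s k)%R by elim: k => [|k IH]; [rewrite s0|exact: le_trans (sS k)].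
have sfin k : fs (s k) = (fine (fs (s k)))%:E.
  rewrite fineK// ge0_fin_numE ?rearrangement_ge0//.
  by apply: le_lt_trans (rearrangement_le f (st k)) _; apply: le_lt_trans fst _;
    rewrite ltry.
pose a k := fine (fs (s k)).
have a0 k : (0 <= a k)%R by rewrite fine_ge0// rearrangement_ge0.
pose A := (4 * fine I1)%R.
have A0 : (0 <= A)%R by rewrite mulr_ge0.
have LA : lorentz1 (@leb R n) p0 (EFin \o (fun x => f x - trunc_at (a 0%N) (f
  x))%R) <= A%:E.
  have h : fs t = (a 0%N)%:E by rewrite /a -sfin s0.
  by apply: le_trans (lorentz1_first_part hp0 mf t0 h) _; rewrite E1 I1E -EFinM.
pose gr := growth phi alpha p0.
have gr_ge1 r : (1 <= gr r)%R by exact: growth_ge1.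
(* The piece of index k + 1 is charged to the k-th block, on which f^* is at least [a k.+1]. *)
have tail_sum N : (\sum_(0 <= k < N) a k.+1 * gr (2 * (s k.+2 / t)) <= c * P2 *
  fine I2)%R.
  rewrite -lee_fin EFinM -I2E -E2 -sumEFin.
  have -> : (c * P2 = c / t `^ ((1 - alpha) / p0))%R by rewrite /P2 mulrA mulr1.
  have ctk : (0 <= c / t `^ ((1 - alpha) / p0))%R by rewrite divr_ge0 ?powR_ge0//
    ltW.
  pose g k x := (a k.+1 * w k x)%:E.
  have mg k : measurable_fun setT (g k).
    by apply/measurable_EFinP; apply: measurable_funM.
  pose J k : set R := [set` `]s k, s k.+1[ ].
  have mJ k : measurable (J k) by exact: measurable_itv.
  have inJ k x : J k x -> (s k < x < s k.+1)%R by rewrite /J/= in_itv.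
  apply: (@le_trans _ _ ((c / t `^ ((1 - alpha) / p0))%:E *
      \sum_(0 <= k <oo) \int[lebesgue_measure]_(x in J k) g k x)); last first.
    apply: lee_wpmul2l; first by rewrite lee_fin.
    apply: (@sum_integral_le R _ _ lebesgue_measure [set` `]t, +oo[ ] J g).
    - exact: measurable_itv.
    - exact: mJ.
    - move=> k x /inJ /andP[h1 _]; rewrite /= in_itv/= andbT.
      exact: le_lt_trans (st k) h1.
    - exact: trivIset_itvoo.
    - by move=> k; exact: (measurable_funTS (mg k)).
    - by move=> k x /inJ /w0 h; rewrite lee_fin mulr_ge0.
    - move=> k x /inJ hx; have /andP[h1 h2] := hx.
      have [-> h] := phi_tilde_fin hphi halpha hp0 (lt_ge0 x (le_lt_trans (st k)
        h1)).
      have ax : (a k.+1)%:E <= fs x.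
        by rewrite /a -sfin; apply: rearrangement_le; exact: ltW.
      apply: (@le_trans _ _ ((fine (phi_tilde phi alpha p0 (1 + ln (x / t))))%:E
        * (a k.+1)%:E *
          (1 / x `^ (1 - (1 - alpha) / p0))%:E)).
        by rewrite -!EFinM lee_fin [leRHS]mulrAC [leRHS]mulrC; apply: ler_wpM2l;
          [exact: a0|exact: wle].
      apply: lee_wpmul2r; first by rewrite lee_fin divr_ge0// powR_ge0.
      by apply: lee_wpmul2l; rewrite ?lee_fin.
    - by move=> x /=; rewrite in_itv/= andbT; exact: F2_ge0.
  have g0 k : 0 <= \int[lebesgue_measure]_(x in J k) g k x.
    by apply: integral_ge0 => x /inJ /w0 h; rewrite lee_fin mulr_ge0.
  apply: (@le_trans _ _ (\sum_(0 <= k < N) (c / t `^ ((1 - alpha) / p0))%:E *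
      \int[lebesgue_measure]_(x in J k) g k x)).
    apply: lee_sum => k _; rewrite /g.
    under eq_integral do rewrite EFinM.
    rewrite ge0_integralZl//; first last.
    - by rewrite lee_fin.
    - by move=> x /inJ /w0 h; rewrite lee_fin.
    - by apply/measurable_EFinP; exact: (measurable_funTS (mw k)).
    - exact: mJ.
    by rewrite EFinM muleCA; apply: lee_wpmul2l; rewrite ?lee_fin.
  rewrite -ge0_sume_distrr//; apply: lee_wpmul2l; first by rewrite lee_fin.
  exact: nneseries_lim_ge.
(* The first summand is for the piece of index 0: all blocks are taken by the later pieces, so it is
   charged to the first integral. *)
pose B := (2 * P1 * fine I1 * c + c * P2 * fine I2)%R.
have SB N : (\sum_(0 <= k < N) a k * gr (2 * (s k.+1 / t)) <= B)%R.
  have T0 : (0 <= c * P2 * fine I2)%R := mulr_ge0 (mulr_ge0 (ltW c0) (ltW q2)) i2.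
  have a0le : (a 0%N <= 2 * P1 * fine I1)%R by rewrite -lee_fin /a -sfin s0.
  case: N => [|N].
    rewrite big_geq// /B; apply: addr_ge0 T0.
    exact: mulr_ge0 (mulr_ge0 (mulr_ge0 (ler0n _ 2) (ltW q1)) i1) (ltW c0).
  rewrite big_nat_recl//; apply: lerD; last exact: tail_sum.
  by apply: ler_pM => //; exact: le_trans (gr_ge1 _).
(* As [growth] is at least 1, the partial sums of the heights are bounded by [B], so the heights
   cannot all stay above e. *)
have a_small e : (0 < e)%R -> exists k, (a k <= e)%R.
  move=> e0; apply: contrapT => H.
  have ae k : (e < a k)%R by rewrite ltNge; apply/negP => h; apply: H; exists k.
  have B0 : (0 <= B)%R by have := SB 0%N; rewrite big_geq.
  have Be : (0 <= B / e)%R by rewrite divr_ge0// ltW.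
  have := SB (Num.bound (B / e)); apply/negP; rewrite -ltNge.
  apply: (@lt_le_trans _ _ (\sum_(0 <= k < Num.bound (B / e)) e)%R).
    by rewrite big_const_nat subn0 iter_addr_0 -mulr_natl -ltr_pdivrMr//
      archi_boundP.
  apply: ler_sum => k _; rewrite -[leLHS]mulr1; apply: ler_pM => //; exact: ltW.
apply: le_trans (Hcore t A B f s a fdom t0 s0 sS sfin a_small A0 LA SB) _.
rewrite I1E I2E.
rewrite (_ : P1%:E * _ + _ = (P1 * fine I1 + P2 * fine I2)%:E)// -EFinM lee_fin.
have f4 : (4 `^ p0^-1 <= 4 :> R)%R by apply: ler1_powR; rewrite ?ler1n// invf_le1.
have -> : (4 `^ p0^-1 * A / t `^ p0^-1 = 4 `^ p0^-1 * (4 * (P1 * fine I1)))%R.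
  by rewrite P1E /A; ring.
have X0 : (0 <= P1 * fine I1)%R by rewrite mulr_ge0// ltW.
have Y0 : (0 <= P2 * fine I2)%R by rewrite mulr_ge0// ltW.
have h1 : (4 `^ p0^-1 * (4 * (P1 * fine I1)) <= 4 * (4 * (P1 * fine I1)))%R.
  by apply: ler_wpM2r => //; rewrite mulr_ge0.
have -> : (C1 * B = 2 * (C1 * c) * (P1 * fine I1) + C1 * c * (P2 * fine I2))%R.
  by rewrite /B; ring.
have h2 : (0 <= C1 * c * (P2 * fine I2))%R by rewrite mulr_ge0// ltW.
have h3 : (0 <= 16 * (P2 * fine I2))%R by rewrite mulr_ge0.
by rewrite mulrDr !mulrDl; lra.
Qed.
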